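(* Let $\nu>0$ and $L>0$. Let $q\in C^1([0,L])$ satisfy $q(0)=0$, $q'(0)>0$ and $q(x)>0$ for every $x\in(0,L]$. For any $0<a<b\le L$, the minimal time of observability from $\omega=(a,b)\times(0,\pi)$ of the generalized singular Grushin system described in the context satisfies $$T(\omega)\ \ge\ \frac{d_{\operatorname{agm}}(a)}{2q'(0)(1+\nu)},\qquad\text{where } d_{\operatorname{agm}}(a)=\int_0^a q(s)\,ds .$$
   Context: Let $\Omega=(0,L)\times(0,\pi)$. The system is, for $f_0\in L^2(\Omega)$, $$\partial_t f-\partial_x^2 f-q(x)^2\partial_y^2 f+\frac{\nu^2-1/4}{x^2}f=0\ \text{ in }(0,T)\times\Omega,\qquad f=0\ \text{ on }(0,T)\times\partial\Omega,\qquad f(0)=f_0 .$$ Its solution is $f(t)=e^{-tG}f_0$, where $G$ is the positive self-adjoint operator on $L^2(\Omega)$ associated with the (Friedrichs) closed form obtained by completing $C_0^\infty(\Omega)$ for $$(u,v)_V=\int_\Omega \partial_xu\,\partial_xv+q(x)^2\partial_yu\,\partial_yv+\frac{\nu^2-1/4}{x^2}uv\,dx\,dy .$$ The system is observable from an open set $\omega\subset\Omega$ in time $T>0$ if there is $C>0$ such that for all $f_0\in L^2(\Omega)$ the solution satisfies $\int_\Omega|f(T,x,y)|^2\,dx\,dy\le C\int_0^T\int_\omega|f(t,x,y)|^2\,dx\,dy\,dt$. The minimal time of observability is $T(\omega)=\inf\{T>0:\ \text{the system is observable in time }T\text{ from }\omega\}$, with $T(\omega)=+\infty$ if the system is not observable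 in any time. *)

(* Defs.v *)
From HB Require Import structures.
From mathcomp Require Import all_boot all_order all_algebra.
From mathcomp Require Import all_classical all_reals all_analysis.

Set Implicit Arguments.
Unset Strict Implicit.
Unset Printing Implicit Defensive.

Import Order.TTheory GRing.Theory Num.Theory.
Import numFieldNormedType.Exports.

Local Open Scope classical_set_scope.
Local Open Scope ring_scope.

Section Grushin.
Context {R : realType}.
Implicit Types (u v w : R * R -> R) (D : set (R * R)).

(* [q] is of class C^1 on [0, L] with derivative [dq]; the limit is taken
   within [0, L], so that the derivatives at 0 and L are one-sided. *)
Definition C1_on (L : R) (q dq : R -> R) : Prop :=
  {within `[0, L], continuous dq} /\
  forall x, x \in `[0, L] ->
    (q y - q x) / (y - x) @[y --> within `[0, L] (dnbhs x)] --> dq x.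

Definition d_agm (q : R -> R) (a : R) : R :=
  \int[@lebesgue_measure R]_(s in `[0, a]) q s.

Definition lebesgue2 := (@lebesgue_measure R \x @lebesgue_measure R)%E.

Definition Omega (L : R) : set (R * R) := `]0, L[ `*` `]0, pi[.

Definition strip (a b : R) : set (R * R) := `]a, b[ `*` `]0, pi[.

Definition normsq D u : \bar R := (\int[lebesgue2]_(p in D) ((u p) ^+ 2)%:E)%E.

Definition inner D u v : R := \int[lebesgue2]_(p in D) (u p * v p).

(* Elements of L^2(D) are represented by functions; every notion below is
   invariant under modification of these functions on a null subset of D. *)
Definition L2 D u : Prop :=
  measurable_fun D (u : measurableTypeR R * measurableTypeR R -> R) /\
  (normsq D u < +oo)%E.

Definition pdx u : R * R -> R := 'D_(1, 0) u.
Definition pdy u : R * R -> R := 'D_(0, 1) u.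

Fixpoint Ck (k : nat) u : Prop :=
  continuous u /\
  if k is j.+1 then
    [/\ forall p, derivable u p (1, 0), forall p, derivable u p (0, 1),
        Ck j (pdx u) & Ck j (pdy u)]
  else True.

(* C_0^oo(D), the functions being extended by 0 outside of D *)
Definition test_function D u : Prop :=
  (forall k, Ck k u) /\
  exists K, [/\ compact K, K `<=` D & forall p, ~ K p -> u p = 0].

Variables (nu L : R) (q : R -> R).

(* (u, v)_V for u, v in C_0^oo(Omega) *)
Definition form u v : R :=
  \int[lebesgue2]_(p in Omega L)
    (pdx u p * pdx v p + q p.1 ^+ 2 * (pdy u p * pdy v p)
     + (nu ^+ 2 - 1 / 4) / p.1 ^+ 2 * (u p * v p)).

(* The completion V of C_0^oo(Omega) is realized inside L^2(Omega):
   [approx phi u] says that the V-Cauchy sequence [phi] of test functions,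
   which defines an element of V, corresponds to [u] in L^2(Omega). *)
Definition approx (phi : nat -> R * R -> R) u : Prop :=
  [/\ forall n, test_function (Omega L) (phi n),
      forall e : R, 0 < e -> exists N : nat, forall m n : nat,
        (N <= m)%N -> (N <= n)%N ->
        form (phi m \- phi n) (phi m \- phi n) < e
    & normsq (Omega L) (phi n \- u) @[n --> \oo] --> 0%E].

Definition form_domain u : Prop := L2 (Omega L) u /\ exists phi, approx phi u.

(* [closed_form u v l]: (u, v)_V = l for the closed form on V.  The limit does
   not depend on the approximating sequences since the form is closable. *)
Definition closed_form u v (l : R) : Prop :=
  exists phi psi, [/\ approx phi u, approx psi v
    & form (phi n) (psi n) @[n --> \oo] --> l].

(* [opG u w]: u is in the domain D(G) of the operator associated with the
   closed form, and G u = w. *)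
Definition opG u w : Prop :=
  [/\ form_domain u, L2 (Omega L) w
    & forall v, form_domain v -> closed_form u v (inner (Omega L) w v)].

(* [is_solution f0 f]: f is the solution t |-> e^{-tG} f0, characterized as
   the unique f in C([0, +oo[; L^2(Omega)), differentiable on ]0, +oo[ with
   values in D(G), such that f' = - G f on ]0, +oo[ and f(0) = f0. *)
Definition is_solution (f0 : R * R -> R) (f : R -> R * R -> R) : Prop :=
  [/\ forall t, 0 <= t -> L2 (Omega L) (f t),
      normsq (Omega L) (f 0 \- f0) = 0%E,
      forall t, 0 <= t ->
        normsq (Omega L) (f s \- f t) @[s --> within `[0, +oo[ (nbhs t)]
          --> 0%E
    & forall t, 0 < t -> exists w, opG (f t) w /\
        normsq (Omega L) (fun p => (f (t + h) p - f t p) / h + w p)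
          @[h --> 0^'] --> 0%E].

Definition observable D (T : R) : Prop :=
  exists C : R, 0 < C /\
    forall f0 f, L2 (Omega L) f0 -> is_solution f0 f ->
      (normsq (Omega L) (f T)
         <= C%:E * \int[@lebesgue_measure R]_(t in `]0%R, T[) normsq D (f t))%E.

(* +oo when the system is not observable in any time *)
Definition minimal_time D : \bar R :=
  ereal_inf [set T%:E | T in [set T : R | 0 < T /\ observable D T]].

End Grushin.

(* Main.v *)
From Pilot Require Import Defs.
From HB Require Import structures.
From mathcomp Require Import all_boot all_order all_algebra.
From mathcomp Require Import all_classical all_reals all_analysis.
From mathcomp Require Import measurable_realfun ring lra.

Import Order.TTheory GRing.Theory Num.Theory.
Import numFieldNormedType.Exports.
Import Pilot.Defs.

Local Open Scope classical_set_scope.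
Local Open Scope ring_scope.

(* Observability is tested on f(t) = e^{-lam t} u with u(x, y) = x^{nu+1/2} h(x) sin(n y),
   where lam is the lowest Dirichlet eigenvalue of
   - d^2/dx^2 + (nu^2 - 1/4)/x^2 + n^2 q(x)^2 on (0, L). The function h solves a singular
   radial equation by Picard iteration, and lam is found by shooting. For every
   Q0 > q'(0), comparison with the harmonic oscillator near x = 0 gives
   lam <= 2 n Q0 (1 + nu) + O(1). For every kappa < 1 and n large,
   exp(- kappa n d_agm) is a supersolution away from x = 0, so the mass of u in the strip
   is at most of order e^{- 2 kappa n (d_agm(a) - eps)} times its total mass.
   Observability in time T then forces
   e^{- 2 lam T} <= C e^{- 2 kappa n (d_agm(a) - eps)} for all large n, hence the bound
   on T as kappa -> 1, eps -> 0 and Q0 -> q'(0).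

   That u is in D(G) is shown with explicit test functions (Bernstein polynomials times
   flat cut-offs) whose energy densities are dominated by a multiple of
   1 + x^{2 nu - 1}, so dominated convergence replaces Hardy's inequality. *)

(** The exponent [nu + 1/2] is the larger root of [r (r - 1) = nu^2 - 1/4], the behaviour at 0 that
    the Friedrichs form selects. Factoring it out trades the inverse-square potential for the drift
    [(2 nu + 1) / x], and the equation for [h] can be started from [h 0 = 1], [h' 0 = 0]. This is
    the drift of radial functions in dimension [2 nu + 2], where the oscillator of frequency
    [b = n Q0] has ground state energy [b (2 nu + 2)]: this is the source of the constant
    [2 (1 + nu)].

    No spectral theorem is invoked. The upper bound on [lam], the place where [h] vanishes and the
    decay of [h] all come from the monotonicity of a Wronskian weighted by [x^(2 nu + 1)], once the
    shooting has given a nonnegative [h].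

    For [nu < 1/2] the coefficient [nu^2 - 1/4] is negative and the density of the form has no sign.
    What saves the approximation is that [x^(2 nu - 1)], the size of every term of the energy
    density near 0, is integrable for all [nu > 0]. *)

Ltac nneg := repeat match goal with
  | |- _ => first [done | apply: ltW; done]
  | |- is_true (@Order.le _ _ _ (@GRing.exp _ _ 2)) => exact: sqr_ge0
  | |- is_true (@Order.le _ _ _ (@GRing.exp _ _ _)) => apply: exprn_ge0
  | |- is_true (@Order.le _ _ _ (@Num.norm _ _ _)) => exact: normr_ge0
  | |- is_true (@Order.le _ _ _ (@Algebra.add _ _ _)) => apply: addr_ge0
  | |- is_true (@Order.le _ _ _ (@GRing.mul _ _ _)) => apply: mulr_ge0
  | |- is_true (@Order.le _ _ _ (@GRing.inv _ _)) => rewrite invr_ge0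
  | |- is_true (@Order.le _ _ _ (expR _)) => exact: expR_ge0
  | |- is_true (@Order.le _ _ _ (_ `^ _)) => exact: powR_ge0
  end.

(** * Differentiation rules for functions of one variable *)

Section Calculus.
Context {R : realType}.
Implicit Types (f g df dg : R -> R) (a b c x y r s t e p B M : R).
Notation mu := (@lebesgue_measure R).

Lemma is_derive1_continuous f x c : is_derive x 1 f c -> {for x, continuous f}.
Proof. by move=> [df _]; apply/differentiable_continuous/derivable1_diffP. Qed.

Lemma derive_mono f df a b : {within `[a, b], continuous f} ->
  (forall x, a < x < b -> is_derive x 1 f (df x)) ->
  (forall x, a < x < b -> 0 <= df x) -> a <= b -> f a <= f b.
Proof.
move=> cf Hd Hge; rewrite le_eqVlt => /predU1P[->//|ab].
have [c cab E] : exists2 c, c \in `]a, b[ & f b - f a = df c * (b - a).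
  by apply: MVT => // x xab; apply: Hd; move: xab; rewrite in_itv.
rewrite -subr_ge0 E mulr_ge0 ?subr_ge0 ?(ltW ab)//.
by apply: Hge; move: cab; rewrite in_itv.
Qed.

Lemma der_eq f x a b : is_derive x 1 f a -> a = b -> is_derive x 1 f b.
Proof. by move=> + <-. Qed.

Lemma der_cst x c : is_derive x 1 (fun=> c : R) 0.
Proof. exact: is_derive_cst. Qed.

Lemma der_id x : is_derive x 1 (fun y => y : R) 1.
Proof. exact: is_derive_id. Qed.

Lemma derD f g x a b : is_derive x 1 f a -> is_derive x 1 g b ->
  is_derive x 1 (fun y => f y + g y) (a + b).
Proof. by move=> fa gb; exact: is_deriveD. Qed.

Lemma derN f x a : is_derive x 1 f a -> is_derive x 1 (fun y => - f y) (- a).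
Proof. by move=> fa; exact: is_deriveN. Qed.

Lemma derB f g x a b : is_derive x 1 f a -> is_derive x 1 g b ->
  is_derive x 1 (fun y => f y - g y) (a - b).
Proof. by move=> fa gb; exact: is_deriveB. Qed.

Lemma derM f g x a b : is_derive x 1 f a -> is_derive x 1 g b ->
  is_derive x 1 (fun y => f y * g y) (a * g x + f x * b).
Proof.
move=> fa gb; have h := is_deriveM fa gb; apply: (der_eq _ _ _ _ h).
by rewrite /GRing.scale/= addrC (mulrC (g x)).
Qed.

Lemma der_comp f g x a b : is_derive x 1 f a -> is_derive (f x) 1 g b ->
  is_derive x 1 (fun y => g (f y)) (b * a).
Proof. by move=> fa gb; exact: is_derive1_comp. Qed.

Lemma derX n f x a : is_derive x 1 f a ->
  is_derive x 1 (fun y => f y ^+ n) (n%:R * f x ^+ n.-1 * a).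
Proof.
move=> fa; elim: n => [|n IH].
  apply: (der_eq _ _ 0); last by rewrite mul0r mul0r.
  by under eq_fun do rewrite expr0; exact: der_cst.
under eq_fun do rewrite exprS.
apply: (der_eq _ _ _ _ (derM _ _ _ _ _ fa IH)); case: n {IH} => [|n] /=.
  by rewrite expr0; ring.
by rewrite exprS -(natr1 n.+1); ring.
Qed.

Lemma derV f x a : f x != 0 -> is_derive x 1 f a ->
  is_derive x 1 (fun y => (f y)^-1) (- a / f x ^+ 2).
Proof.
move=> fx fa; apply: (der_eq _ _ _ _ (is_deriveV fx fa)).
by rewrite /GRing.scale/= mulNr mulrC mulNr.
Qed.

Lemma der_expR f x a : is_derive x 1 f a ->
  is_derive x 1 (fun y => expR (f y)) (expR (f x) * a).
Proof. by move=> fa; apply: der_comp fa _; exact: is_derive_expR. Qed.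

Lemma der_near f g x a : {near x, f =1 g} -> is_derive x 1 g a ->
  is_derive x 1 f a.
Proof. move=> fg; apply: near_eq_is_derive; near=> y; apply/esym; near: y.
exact: fg.
Unshelve. all: by end_near. Qed.

End Calculus.

Ltac der := lazymatch goal with
  | |- is_derive ?x _ (fun _ => ?c) _ => notypeclasses refine (der_cst x c)
  | |- is_derive ?x _ (fun y => y) _ => notypeclasses refine (der_id x)
  | |- is_derive ?x _ (fun y => @?f y + @?g y) _ =>
      notypeclasses refine (derD f g x _ _ _ _); [der|der]
  | |- is_derive ?x _ (fun y => - @?f y) _ =>
      notypeclasses refine (derN f x _ _); der
  | |- is_derive ?x _ (fun y => @?f y * @?g y) _ =>
      notypeclasses refine (derM f g x _ _ _ _); [der|der]
  | |- is_derive ?x _ (fun y => @?f y ^+ ?n) _ =>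
      notypeclasses refine (derX n f x _ _); der
  | |- is_derive ?x _ (fun y => expR (@?f y)) _ =>
      notypeclasses refine (der_expR f x _ _); der
  | |- _ => cbv beta; try eassumption
  end.

(** * Continuity of functions on the whole line *)

Section Continuity.
Context {R : realType}.
Implicit Types (f g : R -> R) (c x e : R).

Lemma cont_cst c : continuous (fun _ : R => c).
Proof. by move=> x; exact: cvg_cst. Qed.

Lemma cont_id : continuous (fun y : R => y).
Proof. by move=> x; exact: cvg_id. Qed.

Lemma contD f g : continuous f -> continuous g -> continuous (fun x => f x + g x).
Proof. by move=> cf cg x; apply: cvgD; [exact: cf|exact: cg]. Qed.

Lemma contN f : continuous f -> continuous (fun x => - f x).
Proof. by move=> cf x; apply: cvgN; exact: cf. Qed.

Lemma contM f g : continuous f -> continuous g -> continuous (fun x => f x * g x).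
Proof. by move=> cf cg x; apply: cvgM; [exact: cf|exact: cg]. Qed.

Lemma contX f n : continuous f -> continuous (fun x => f x ^+ n).
Proof.
move=> cf; elim: n => [|n IH]; first by under eq_fun do rewrite expr0; exact: cont_cst.
by under eq_fun do rewrite exprS; exact: contM.
Qed.

Lemma cont_expR f : continuous f -> continuous (fun x => expR (f x)).
Proof.
by move=> cf x; apply: continuous_comp; [exact: cf|exact: continuous_expR].
Qed.

Lemma cont_norm f : continuous f -> continuous (fun x => `|f x|).
Proof. by move=> cf x; apply: cvg_norm; exact: cf. Qed.

Lemma near_dist x e : 0 < e -> \forall y \near x, `|x - y| < e.
Proof. by move=> e0; exact: (nbhsx_ballx x e). Qed.

End Continuity.

Ltac cont := lazymatch goal with
  | |- continuous (fun _ => ?c) => exact (cont_cst c)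
  | |- continuous (fun y => y) => exact cont_id
  | |- continuous (fun y => @?f y + @?g y) =>
      notypeclasses refine (contD f g _ _); [cont|cont]
  | |- continuous (fun y => - @?f y) => notypeclasses refine (contN f _); cont
  | |- continuous (fun y => @?f y * @?g y) =>
      notypeclasses refine (contM f g _ _); [cont|cont]
  | |- continuous (fun y => @?f y ^+ ?n) => notypeclasses refine (contX f n _); cont
  | |- continuous (fun y => `|@?f y|) => notypeclasses refine (cont_norm f _); cont
  | |- continuous (fun y => expR (@?f y)) =>
      notypeclasses refine (cont_expR f _); cont
  | |- _ => cbv beta; try assumption
  end.

Ltac derE := notypeclasses refine (der_eq _ _ _ _ _ _); [der|cbv beta].

(** * Primitives and the weighted average that inverts the radial operator *)

Section Primitive.
Context {R : realType}.
Implicit Types (f g df dg : R -> R) (a b c x y r s t e p B M : R).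
Notation mu := (@lebesgue_measure R).

(** The interval is empty for [x < 0], so the primitive is 0 there. Continuity then holds on the
    whole line, and only the derivative is restricted to [x > 0]. *)
Definition prim f x : R := \int[mu]_(t in `[0, x]) f t.

Lemma continuous_integrable f a b : continuous f ->
  mu.-integrable `[a, b] (EFin \o f).
Proof.
move=> cf; apply: continuous_compact_integrable; first exact: segment_compact.
exact: continuous_subspaceT.
Qed.

Lemma prim0 f x : x <= 0 -> prim f x = 0.
Proof.
rewrite le_eqVlt => /predU1P[->|x0]; rewrite /prim.
  by rewrite set_itv1 Rintegral_set1.
by rewrite set_itv_ge ?Rintegral_set0// bnd_simp -ltNge.
Qed.

Lemma prim_derive f x : continuous f -> 0 < x -> is_derive x 1 (prim f) (f x).
Proof.
move=> cf x0; have [d1 d2] := @continuous_FTC1_closed R f 0 x (x + 1)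
  (ltac:(lra)) (continuous_integrable f 0 (x + 1) cf) x0 (cf x).
by split; [exact: d1|rewrite -d2 derive1E].
Qed.

Lemma prim_continuous f : continuous f -> continuous (prim f).
Proof.
move=> cf x; have [x0|x0|->] := ltgtP x 0.
- rewrite /continuous_at prim0 ?ltW//; apply/cvgrPdist_le => e e0; near=> y.
  rewrite prim0 ?subrr ?normr0 ?ltW//; near: y; exact: lt_nbhsl.
- by apply: is_derive1_continuous; exact: prim_derive.
- rewrite /continuous_at prim0//.
  exact: (parameterized_integral_cvg_left ltr01 (continuous_integrable f 0 1 cf)).
Unshelve. all: by end_near. Qed.

Lemma prim_norm_le f B x : continuous f -> 0 <= x ->
  (forall r, 0 <= r <= x -> `|f r| <= B) -> `|prim f x| <= B * x.
Proof.
move=> cf x0 fB; rewrite ler_norml; apply/andP; split.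
  have := derive_mono (fun y => prim f y + B * y) (fun y => f y + B) 0 x.
  rewrite prim0// mulr0 addr0 -lerBlDr add0r; apply => //.
  - apply: continuous_subspaceT => y; apply: cvgD; first exact: prim_continuous.
    by apply: cvgM; [exact: cvg_cst|exact: cvg_id].
  - move=> y /andP[y0 _]; have ? := @prim_derive f y cf y0.
    derE.
    by rewrite mul0r add0r mulr1.
  - move=> y /andP[y0 yx]; have := fB y; rewrite (ltW y0) (ltW yx) => /(_ isT).
    by rewrite ler_norml => /andP[+ _]; lra.
have := derive_mono (fun y => B * y - prim f y) (fun y => B - f y) 0 x.
rewrite prim0// mulr0 subr0 subr_ge0; apply => //.
- apply: continuous_subspaceT => y; apply: cvgB; last exact: prim_continuous.
  by apply: cvgM; [exact: cvg_cst|exact: cvg_id].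
- move=> y /andP[y0 _]; have ? := @prim_derive f y cf y0.
  derE.
  by rewrite mul0r add0r mulr1.
- move=> y /andP[y0 yx]; have := fB y; rewrite (ltW y0) (ltW yx) => /(_ isT).
  by rewrite ler_norml => /andP[_]; lra.
Qed.

Lemma primB f g x : continuous f -> continuous g ->
  prim (fun r => f r - g r) x = prim f x - prim g x.
Proof.
by move=> cf cg; rewrite /prim RintegralB//; exact: continuous_integrable.
Qed.

(** Cutting the power off at 0 makes the weight continuous on the whole line when [p > 0]. *)
Definition wpow (p x : R) : R := if 0 < x then x `^ p else 0.

Lemma wpow_gt0 p x : 0 < x -> wpow p x = x `^ p.
Proof. by rewrite /wpow => ->. Qed.

Lemma wpow_ge0 p x : 0 <= wpow p x.
Proof. by rewrite /wpow; case: ifP => // _; exact: powR_ge0. Qed.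

Lemma wpow_le p x y : 0 <= p -> x <= y -> wpow p x <= wpow p y.
Proof.
move=> p0 xy; rewrite {1}/wpow; case: ifPn => [x0|_]; last exact: wpow_ge0.
have y0 := lt_le_trans x0 xy; rewrite wpow_gt0//.
by apply: ge0_ler_powR => //; rewrite nnegrE ltW.
Qed.

Lemma powR_derive p x : 0 < x ->
  is_derive x 1 (fun y => y `^ p) (p * x `^ (p - 1)).
Proof. by move=> x0; apply: is_derive1_powR. Qed.

Lemma powR_continuous p x : 0 < x -> {for x, continuous (fun y => y `^ p)}.
Proof. by move=> x0; exact: is_derive1_continuous (powR_derive p x x0). Qed.

Lemma near_eq_continuous f g x : {near x, f =1 g} ->
  {for x, continuous g} -> {for x, continuous f}.
Proof.
move=> fg cg; have fgx : f x = g x by apply: nbhs_singleton fg.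
rewrite /prop_for /continuous_at fgx; apply: cvg_trans cg; apply: near_eq_cvg.
by near=> y; apply/esym; near: y.
Unshelve. all: by end_near. Qed.

Lemma near_gt x c : c < x -> \forall y \near x, c < y.
Proof. exact: lt_nbhsr. Qed.

Lemma wpow_continuous p : 0 < p -> continuous (wpow p).
Proof.
move=> p0 x; have [x0|x0|->] := ltgtP x 0.
- apply: (@near_eq_continuous _ (cst 0)); last exact: cst_continuous.
  by near=> y; rewrite /wpow ltNge ltW//; near: y; exact: lt_nbhsl.
- apply: near_eq_continuous (powR_continuous p x x0).
  by near=> y; rewrite wpow_gt0//; near: y; exact: lt_nbhsr.
- rewrite /continuous_at {2}/wpow ltxx; apply/cvgrPdist_lt => e e0.
  near=> y; rewrite sub0r normrN ger0_norm ?wpow_ge0// /wpow.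
  case: ifPn => // y0; rewrite -ltr_ln ?posrE ?powR_gt0// ln_powR mulrC -ltr_pdivlMr//.
  rewrite -ltr_expR lnK ?posrE//; near: y; apply: lt_nbhsl; exact: expR_gt0.
Unshelve. all: by end_near. Qed.

(* [prim (wav p f)] solves [w'' + (p / x) w' = f], [w 0 = w' 0 = 0]. *)
Definition wav p f s : R :=
  if 0 < s then prim (fun r => wpow p r * f r) s / s `^ p else 0.

Lemma wav_bound p f s B : 0 < p -> continuous f -> 0 <= s ->
  (forall r, 0 <= r <= s -> `|f r| <= B) -> `|wav p f s| <= B * s.
Proof.
move=> p0 cf s0 fB; have B0 : 0 <= B.
  by apply: le_trans (fB 0 _); rewrite ?lexx.
rewrite /wav; case: ifPn => [sp|_]; last by rewrite normr0 mulr_ge0.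
have sp0 : 0 < s `^ p by exact: powR_gt0.
rewrite normrM normfV (gtr0_norm sp0) ler_pdivrMr// -mulrA (mulrC s) mulrA.
apply: prim_norm_le => //.
  by apply: contM => //; exact: wpow_continuous.
move=> r rs; rewrite normrM (ger0_norm (wpow_ge0 _ _)) mulrC ler_pM ?wpow_ge0//.
  exact: fB.
rewrite -(wpow_gt0 p s)//; apply: wpow_le; [exact: ltW|by case/andP: rs].
Qed.

Lemma wav_continuous p f : 0 < p -> continuous f -> continuous (wav p f).
Proof.
move=> p0 cf; have cwf : continuous (fun r => wpow p r * f r).
  by apply: contM => //; exact: wpow_continuous.
move=> x; have [x0|x0|->] := ltgtP x 0.
- apply: (@near_eq_continuous _ (cst 0)); last exact: cst_continuous.
  by near=> y; rewrite /wav ltNge ltW//; near: y; exact: lt_nbhsl.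
- apply: (@near_eq_continuous _
    (fun s => prim (fun r => wpow p r * f r) s / s `^ p)).
    by near=> y; rewrite /wav ifT//; near: y; exact: lt_nbhsr.
  apply: cvgM; first exact: prim_continuous.
  by apply: cvgV; [rewrite gt_eqF// powR_gt0|exact: powR_continuous].
- rewrite /continuous_at {2}/wav ltxx.
  have [d d0 fB] : exists2 d, 0 < d & forall r, 0 <= r <= d -> `|f r| <= `|f 0| + 1.
    have /cvgrPdist_le/(_ 1 ltr01)/nbhs_ballP[d /= d0 Hd] := cf 0.
    exists (d / 2); first by rewrite divr_gt0.
    move=> r /andP[r0 rd]; have : `|f 0 - f r| <= 1.
      by apply: Hd; rewrite /ball/= sub0r normrN ger0_norm//; lra.
    by have := ler_normB (f 0) (f 0 - f r); rewrite opprB addrC subrK; lra.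
  apply/cvgrPdist_lt => e e0; near=> y; rewrite sub0r normrN.
  have [y0|y0] := leP 0 y; last by rewrite /wav (ltNge 0 y) (ltW y0)/= normr0.
  apply: (@le_lt_trans _ _ ((`|f 0| + 1) * y)).
    apply: wav_bound => // r /andP[r0 ry]; apply: fB; rewrite r0/= (le_trans ry)//.
    by apply/ltW; near: y; exact: lt_nbhsl.
  rewrite mulrC -ltr_pdivlMr ?ltr_wpDl//.
  by near: y; apply: lt_nbhsl; rewrite divr_gt0 ?ltr_wpDl.
Unshelve. all: by end_near. Qed.

End Primitive.

(** * Picard iteration for the singular radial equation *)

Section RadialODE.
Context {R : realType}.
Implicit Types (f g V : R -> R) (a b c x y r s t e p B C D M : R) (k m n : nat).

(** The intervals of centre [u k] and radius [C / 2 ^+ k] are nested. The limit is the supremum of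
    their left ends, and it comes with the rate of convergence. *)
Lemma halving_cvg (u : nat -> R) C :
  (forall k, `|u k.+1 - u k| <= C / 2 ^+ k.+1) ->
  exists l, forall k, `|l - u k| <= C / 2 ^+ k.
Proof.
move=> H.
have E k : C / 2 ^+ k = C / 2 ^+ k.+1 + C / 2 ^+ k.+1.
  by rewrite exprS invfM; field; rewrite expf_neq0.
have Hk k := H k; pose a k := u k - C / 2 ^+ k; pose b k := u k + C / 2 ^+ k.
have a_nd k m : (k <= m)%N -> a k <= a m.
  elim: m => [|m IH]; first by rewrite leqn0 => /eqP ->.
  rewrite leq_eqVlt ltnS => /predU1P[-> //|/IH]/le_trans; apply.
  by rewrite /a (E m); have := H m; rewrite ler_norml => /andP[]; lra.
have b_ni k m : (k <= m)%N -> b m <= b k.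
  elim: m => [|m IH]; first by rewrite leqn0 => /eqP ->.
  rewrite leq_eqVlt ltnS => /predU1P[-> //|/IH]; apply: le_trans.
  by rewrite /b (E m); have := H m; rewrite ler_norml => /andP[]; lra.
have C0 k : 0 <= C / 2 ^+ k.
  rewrite mulr_ge0 ?invr_ge0 ?exprn_ge0//.
  by have := le_trans (normr_ge0 _) (H 0%N); rewrite expr1; lra.
have ab k m : a k <= b m.
  have [km|mk] := leqP k m.
    by apply: le_trans (a_nd _ _ km) _; rewrite /a /b; have := C0 m; lra.
  by apply: le_trans (b_ni _ _ (ltnW mk)); rewrite /a /b; have := C0 k; lra.
have hs : has_sup (range a).
  by split; [exists (a 0%N); exists 0%N|exists (b 0%N) => _ [k _ <-]].
exists (sup (range a)) => k.
have h1 : a k <= sup (range a) by apply: sup_upper_bound => //; exists k.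
have h2 : sup (range a) <= b k.
  by apply: ge_sup; [exists (a 0%N); exists 0%N|move=> _ [m _ <-]].
by rewrite ler_norml; move: h1 h2; rewrite /a /b => h1 h2; apply/andP; split; lra.
Qed.

Definition rad p f x := prim (wav p f) x.

Lemma rad_continuous p f : 0 < p -> continuous f -> continuous (rad p f).
Proof. by move=> p0 cf; apply: prim_continuous; exact: wav_continuous. Qed.

Lemma rad0 p f x : x <= 0 -> rad p f x = 0.
Proof. exact: prim0. Qed.

Lemma wavB p f g s : 0 < p -> continuous f -> continuous g ->
  wav p (fun r => f r - g r) s = wav p f s - wav p g s.
Proof.
move=> p0 cf cg; rewrite /wav; case: ifPn => _; last by rewrite subr0.
rewrite -mulrBl -primB; do ?[exact: wpow_continuous|apply: contM => //].
by congr (prim _ _ / _); apply/funext => r; rewrite mulrBr.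
Qed.

Lemma radB p f g x : 0 < p -> continuous f -> continuous g ->
  rad p (fun r => f r - g r) x = rad p f x - rad p g x.
Proof.
move=> p0 cf cg; rewrite /rad -primB; do ?exact: wav_continuous.
by congr (prim _ x); apply/funext => s; rewrite wavB.
Qed.

(** Relative to the weight [expR (M * x ^+ 2)] a Picard step contracts by 1/2, whatever the length
    of the interval: [wav_bound] gains a factor [s], and [M * s * expR (M * s ^+ 2)] is half the
    derivative of the weight. *)
Lemma rad_bound p f D M X : 0 < p -> 0 < M -> continuous f -> 0 <= D ->
  (forall r, 0 <= r <= X -> `|f r| <= M * (D * expR (M * r ^+ 2))) ->
  forall x, 0 <= x <= X -> `|rad p f x| <= D / 2 * expR (M * x ^+ 2).
Proof.
move=> p0 M0 cf D0 fB x /andP[x0 xX].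
have wB s : 0 <= s <= X -> `|wav p f s| <= M * (D * expR (M * s ^+ 2)) * s.
  move=> /andP[s0 sX]; apply: wav_bound => // r /andP[r0 rs].
  apply: le_trans (fB r _) _; first by rewrite r0 (le_trans rs).
  rewrite ler_wpM2l ?(ltW M0)// ler_wpM2l// ler_expR ler_wpM2l ?(ltW M0)//.
  by rewrite ler_pXn2r ?nnegrE// (le_trans r0).
have dF y : is_derive y 1 (fun y => D / 2 * expR (M * y ^+ 2))
    (M * (D * expR (M * y ^+ 2)) * y).
  by derE; rewrite /=; field.
have dR y : 0 < y -> is_derive y 1 (rad p f) (wav p f y).
  by move=> y0; apply: prim_derive => //; exact: wav_continuous.
pose F y := D / 2 * expR (M * y ^+ 2); pose F' y := M * (D * expR (M * y ^+ 2)) * y.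
have F0 : 0 <= F 0 by rewrite mulr_ge0 ?divr_ge0 ?expR_ge0.
have cF : continuous F by move=> y; exact: is_derive1_continuous (dF y).
have wB' y : 0 < y < x -> - F' y <= wav p f y <= F' y.
  by move=> /andP[y0 yx]; rewrite -ler_norml; apply: wB; rewrite (ltW y0) (le_trans (ltW yx)).
pose G1 y := rad p f y + F y; pose G2 y := F y - rad p f y.
have h1 : G1 0 <= G1 x.
  refine (derive_mono G1 (fun y => wav p f y + F' y) 0 x _ _ _ x0).
  - by apply: continuous_subspaceT => y; apply: cvgD; [exact: rad_continuous|exact: cF].
  - by move=> y /andP[y0 _]; exact: (derD _ _ _ _ _ (dR y y0) (dF y)).
  - by move=> y /wB' /andP[+ _]; lra.
have h2 : G2 0 <= G2 x.
  refine (derive_mono G2 (fun y => F' y - wav p f y) 0 x _ _ _ x0).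
  - by apply: continuous_subspaceT => y; apply: cvgB; [exact: cF|exact: rad_continuous].
  - by move=> y /andP[y0 _]; exact: (derB _ _ _ _ _ (dF y) (dR y y0)).
  - by move=> y /wB' /andP[_ +]; lra.
by move: h1 h2; rewrite /G1 /G2 ler_norml rad0// -/(F x) => h1 h2; apply/andP; split; lra.
Qed.

Lemma rad_ge0 p f x : 0 < p -> continuous f -> (forall r, 0 <= f r) -> 0 <= rad p f x.
Proof.
move=> p0 cf f0; apply: Rintegral_ge0 => s _; rewrite /wav; case: ifPn => // _.
rewrite divr_ge0 ?powR_ge0//; apply: Rintegral_ge0 => r _.
by rewrite mulr_ge0 ?wpow_ge0.
Qed.

Fixpoint picard p V k : R -> R :=
  if k is k'.+1 then fun x => 1 + rad p (fun r => V r * picard p V k' r) x else cst 1.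

Lemma picard_continuous p V k : 0 < p -> continuous V -> continuous (picard p V k).
Proof.
move=> p0 cV; elim: k => [|k IH] x; first exact: cvg_cst.
apply: cvgD; first exact: cvg_cst.
by apply: rad_continuous => //; exact: contM.
Qed.

Lemma picard_step p V M k x : 0 < p -> 0 < M -> continuous V ->
  (forall r, `|V r| <= M) -> 0 <= x ->
  `|picard p V k.+1 x - picard p V k x| <= expR (M * x ^+ 2) / 2 ^+ k.+1.
Proof.
move=> p0 M0 cV VM; elim: k x => [|k IH] x x0.
  rewrite /= [1 + _]addrC addrK.
  rewrite expr1 mulrC -div1r.
  apply: (@rad_bound _ _ 1 M x) => //; last by rewrite x0 lexx.
    by apply: contM => //; exact: cst_continuous.
  move=> r /andP[r0 _]; rewrite mulr1 mul1r (le_trans (VM r))// ler_peMr ?(ltW M0)//.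
  by rewrite -expR0 ler_expR mulr_ge0 ?(ltW M0)// exprn_ge0.
have cp j : continuous (fun r => V r * picard p V j r).
  by apply: contM => //; exact: picard_continuous.
rewrite [X in X - _]/= [X in _ - X]/= opprD addrACA subrr add0r -radB//; last exact: (cp k.+1).
have -> : expR (M * x ^+ 2) / 2 ^+ k.+2 = (2 ^+ k.+1)^-1 / 2 * expR (M * x ^+ 2).
  by rewrite [2 ^+ k.+2]exprS invfM; ring.
apply: (@rad_bound _ _ _ _ x) => //; last by rewrite x0 lexx.
- exact: (contD _ _ (cp k.+1) (contN _ (cp k))).
- move=> r /andP[r0 _]; rewrite -mulrBr normrM ler_pM// mulrC.
  exact: IH.
Qed.


(** The lower bound for nonnegative [V] provides the starting point of the shooting, at eigenvalue
    0. *)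
Lemma picard_limit p V M : 0 < p -> 0 < M -> continuous V ->
  (forall r, `|V r| <= M) ->
  exists h : R -> R, [/\ continuous h, forall x, h x = 1 + rad p (fun r => V r * h r) x
    & (forall r, 0 <= V r) -> forall x, 1 <= h x].
Proof.
move=> p0 M0 cV VM.
have step x : exists l, forall k, `|l - picard p V k x| <= expR (M * x ^+ 2) / 2 ^+ k.
  apply: halving_cvg => k; have [x0|x0] := leP 0 x; first exact: picard_step.
  suff E j : picard p V j x = 1.
    by rewrite !E subrr normr0 divr_ge0 ?expR_ge0// exprn_ge0.
  by case: j => [//|j] /=; rewrite rad0 ?addr0// ltW.
pose h x := projT1 (cid (step x)).
have hP x k : `|h x - picard p V k x| <= expR (M * x ^+ 2) / 2 ^+ k.
  exact: (projT2 (cid (step x))).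
have small C e : 0 < e -> exists k, C / 2 ^+ k < e.
  move=> e0; have [k Hk] : exists k, C / e < 2 ^+ k.
    exists (Num.truncn `|C / e|).+1; rewrite -natrX.
    apply: le_lt_trans (ler_norm _) _; apply: lt_trans (truncnS_gt _) _.
    by rewrite ltr_nat ltn_expl.
  by exists k; rewrite ltr_pdivrMr ?exprn_gt0// mulrC -ltr_pdivrMr.
have ch : continuous h.
  move=> x; apply/cvgrPdist_lt => e e0.
  (* One [k] serves all points within distance 1 of [x], since the error bound increases with the
     absolute value. *)
  have [k Hk] := small (expR (M * (`|x| + 1) ^+ 2)) (e / 3) (ltac:(by rewrite divr_gt0)).
  have hB y : `|y| <= `|x| + 1 -> `|h y - picard p V k y| < e / 3.
    move=> yx; apply: le_lt_trans (hP y k) _; apply: le_lt_trans Hk.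
    rewrite ler_wpM2r ?invr_ge0 ?exprn_ge0// ler_expR ler_wpM2l ?(ltW M0)//.
    by rewrite -[y ^+ 2]real_normK ?num_real// ler_pXn2r ?nnegrE// addr_ge0.
  have /cvgrPdist_lt /(_ (e / 3) (ltac:(by rewrite divr_gt0))) H := picard_continuous p V k p0 cV x.
  near=> y.
  have yx : `|y| <= `|x| + 1.
    have : `|x - y| < 1 by near: y; exact: near_dist.
    by have := ler_normB x (x - y); rewrite opprB addrC subrK; lra.
  have h1 := hB x (ltac:(lra)); have h2 := hB y yx.
  have h3 : `|picard p V k x - picard p V k y| < e / 3 by near: y.
  rewrite distrC in h2.
  have -> : h x - h y = (h x - picard p V k x) + (picard p V k x - picard p V k y)
    + (picard p V k y - h y) by ring.
  by apply: le_lt_trans (ler_normD _ _) _; apply: le_lt_trans (lerD (ler_normD _ _) (lexx _)) _; lra.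
exists h; split => //.
  move=> x; apply/eqP; rewrite -subr_eq0 -normr_le0; apply/ler_addgt0Pl => e e0; rewrite addr0.
  have cVh : continuous (fun r => V r * h r) by exact: contM.
  have [k Hk] := small (expR (M * x ^+ 2)) (e / 2) (ltac:(by rewrite divr_gt0)).
  have cVk : continuous (fun r => V r * picard p V k r).
    by apply: contM => //; exact: picard_continuous.
  have h1 : `|h x - picard p V k.+1 x| <= e / 2.
    apply: le_trans (hP x k.+1) _; apply: le_trans (ltW Hk).
    rewrite ler_wpM2l ?expR_ge0// lef_pV2 ?posrE ?exprn_gt0//.
    by rewrite ler_eXn2l ?ltr1n.
  have h2 : `|rad p (fun r => V r * picard p V k r) x - rad p (fun r => V r * h r) x| <= e / 2.
    have [x0|x0] := leP 0 x; last by rewrite !rad0 ?(ltW x0)// subrr normr0 ltW// divr_gt0.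
    rewrite -radB//; apply: le_trans (ltW Hk).
    apply: (@le_trans _ _ ((2 ^+ k)^-1 / 2 * expR (M * x ^+ 2))).
      apply: (@rad_bound _ _ _ _ x) => //; last by rewrite x0 lexx.
      - by move=> y; apply: cvgB; [exact: cVk|exact: cVh].
      - move=> r _; rewrite -mulrBr normrM ler_pM// mulrC distrC; exact: hP.
    rewrite mulrC ler_wpM2l ?expR_ge0// ler_pdivrMr// ler_peMr// ?invr_ge0 ?exprn_ge0// ler1n//.
  have -> : h x - (1 + rad p (fun r => V r * h r) x) =
      (h x - picard p V k.+1 x) + (rad p (fun r => V r * picard p V k r) x - rad p (fun r => V r * h r) x).
    rewrite [picard _ _ k.+1 _]/=; move: (h x) (rad p _ x) (rad p _ x) => u v w.
    by ring.
  by apply: le_trans (ler_normD _ _) _; lra.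
move=> V0 x.
have P1 k y : 1 <= picard p V k y.
  elim: k y => [//|k IH] y /=; rewrite lerDl; apply: rad_ge0 => //.
    by apply: contM => //; exact: picard_continuous.
  by move=> r; rewrite mulr_ge0// (le_trans _ (IH r)).
apply/ler_addgt0Pl => e e0.
have [k Hk] := small (expR (M * x ^+ 2)) e e0.
have := le_lt_trans (hP x k) Hk; have := P1 k x.
by rewrite ltr_norml => h1 /andP[]; lra.
Unshelve. all: by end_near. Qed.

(** Absorption instead of iteration: at the point [c] where [|d|] divided by the weight is largest,
    [rad_bound] makes the integral term at most half of [|d c|]. *)
Lemma rad_gronwall p V d f M X e : 0 < p -> 0 < M -> continuous V -> continuous d ->
  (forall r, `|V r| <= M) ->
  (forall x, d x = f x + rad p (fun r => V r * d r) x) ->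
  (forall x, 0 <= x <= X -> `|f x| <= e) ->
  forall x, 0 <= x <= X -> `|d x| <= 2 * e * expR (M * x ^+ 2).
Proof.
move=> p0 M0 cV cd VM dE fe x0 x0X.
have X0 : 0 <= X by case/andP: x0X; exact: le_trans.
have e0 : 0 <= e by apply: le_trans (fe _ x0X).
pose w x := `|d x| * expR (- (M * x ^+ 2)).
have cw : continuous w.
  by rewrite /w; cont.
have [c cX wc] := EVT_max X0 (continuous_subspaceT cw).
have wle y : 0 <= y <= X -> `|d y| <= w c * expR (M * y ^+ 2).
  move=> yX; rewrite -ler_pdivrMr ?expR_gt0// -expRN; apply: wc.
  by rewrite in_itv.
have cX' : 0 <= c <= X by move: cX; rewrite in_itv.
have w0 : 0 <= w c by rewrite mulr_ge0 ?expR_ge0.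
suff wce : w c <= 2 * e.
  by apply: le_trans (wle _ x0X) _; rewrite ler_wpM2r ?expR_ge0.
have h := @rad_bound p (fun r => V r * d r) (w c) M X p0 M0 (contM _ _ cV cd) w0 _ c cX'.
have {h} : `|rad p (fun r => V r * d r) c| <= w c / 2 * expR (M * c ^+ 2).
  by apply: h => r rX; rewrite normrM ler_pM//; exact: wle.
have := fe _ cX'; have := ler_normD (f c) (rad p (fun r => V r * d r) c); rewrite -dE => h1 h2 h3.
have E1 : 1 <= expR (M * c ^+ 2) by rewrite -expR0 ler_expR mulr_ge0 ?(ltW M0)// exprn_even_ge0.
have E2 : `|d c| = w c * expR (M * c ^+ 2) by rewrite /w -mulrA -expRD addNr expR0 mulr1.
have h4 : w c / 2 * expR (M * c ^+ 2) <= e by lra.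
have : w c / 2 <= w c / 2 * expR (M * c ^+ 2) by rewrite ler_peMr ?divr_ge0.
by lra.
Qed.

End RadialODE.

(* Keeps unification from comparing integrals by unfolding. *)
Opaque rad.

(** * Wronskian, bound on the lowest eigenvalue, and shooting *)

Section GroundState.
Context {R : realType}.
Implicit Types (f g h V W : R -> R) (a b c x y r s t e p B C D M L lam mu Lam : R).

(* Integral form of [h'' + (p / x) h' = V h], [h 0 = 1], [h' 0 = 0]. With
   [p = 2 nu + 1] it makes [g = x^(nu + 1/2) h] a solution of
   [- g'' + (nu^2 - 1/4) / x^2 g + V g = 0]. *)
Definition radial_solution p V h : Prop :=
  continuous h /\ forall x, h x = 1 + rad p (fun r => V r * h r) x.

(** For a solution this is [x^p h'], whose derivative [x^p V h] has no drift term. *)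
Definition flux p V h : R -> R := prim (fun r => wpow p r * (V r * h r)).

Section Properties.
Variables (p : R) (V h : R -> R).
Hypotheses (p0 : 0 < p) (cV : continuous V) (hV : radial_solution p V h).

Lemma radial_solution_continuous : continuous h.
Proof. by case: hV. Qed.

Lemma radial_solution0 : h 0 = 1.
Proof. by case: hV => _ ->; rewrite rad0 ?addr0. Qed.

Let cVh : continuous (fun r => V r * h r).
Proof. by apply: contM => //; case: hV. Qed.

Lemma radial_solution_derive x : 0 < x -> is_derive x 1 h (flux p V h x / x `^ p).
Proof.
move=> x0; have /funext hE := hV.2.
have := prim_derive _ x (wav_continuous p _ p0 cVh) x0.
rewrite /wav x0 -/(flux p V h) => dw.
rewrite [X in is_derive _ _ X _]hE; apply: der_eq (derD _ _ _ _ _ (der_cst x 1) dw) _.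
by rewrite add0r.
Qed.

Lemma flux_continuous : continuous (flux p V h).
Proof. by apply: prim_continuous; apply: contM => //; exact: wpow_continuous. Qed.

Lemma flux_derive x : 0 < x -> is_derive x 1 (flux p V h) (x `^ p * (V x * h x)).
Proof.
move=> x0; rewrite -(wpow_gt0 p x x0).
apply: prim_derive => //; apply: contM => //; exact: wpow_continuous.
Qed.

Lemma flux0 : flux p V h 0 = 0.
Proof. exact: prim0. Qed.

(* The products of the two derivatives cancel. *)
Lemma wronskian_derive (k K : R -> R) x k1 K1 : 0 < x ->
  is_derive x 1 k k1 -> is_derive x 1 K K1 -> K x = x `^ p * k1 ->
  is_derive x 1 (fun y => flux p V h y * k y - h y * K y)
    (x `^ p * (V x * h x) * k x - h x * K1).
Proof.
move=> x0 dk dK Kx; have dh := radial_solution_derive x x0.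
have dF := flux_derive x x0; derE; rewrite Kx; field.
by rewrite gt_eqF// powR_gt0.
Qed.

End Properties.

(** The comparison function [k] is the oscillator ground state [expR (- (b / 2 * x ^+ 2))], of
    energy [b * (p + 1)], times [1 - x ^+ 2 / d ^+ 2] to make it vanish at [d]; the truncation
    accounts for [2 * (p + 1) / d ^+ 2]. It is a subsolution. If [h] stayed positive on [[0, d]],
    the Wronskian [G] would be nondecreasing and yet go from 0 at 0 to a negative value at [d]. *)
Lemma radial_solution_zero p W h b d : 0 < p -> 0 < b -> 0 < d -> continuous W ->
  (p + 1) / 2 <= b * d ^+ 2 ->
  (forall x, 0 <= x <= d -> W x <= (b * x) ^+ 2) ->
  radial_solution p (fun r => W r - (b * (p + 1) + 2 * (p + 1) / d ^+ 2)) h ->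
  exists2 x, 0 <= x <= d & h x <= 0.
Proof.
move=> p0 b0 d0 cW bd Wb; set Lam := b * (p + 1) + _; set V := fun r => _ => hV.
have cV : continuous V by rewrite /V; cont.
apply: contrapT => /forall2NP hn.
have hp x : 0 <= x <= d -> 0 < h x.
  by move=> xd; case: (hn x) => [//|/negP]; rewrite -ltNge.
pose k x := expR (- (b / 2 * x ^+ 2)) * (1 - x ^+ 2 / d ^+ 2).
(* [m] is [k' / x], so that [K] is [x^p k'] for [x > 0], and [K1] is its derivative. *)
pose m x := - (expR (- (b / 2 * x ^+ 2)) * (b * (1 - x ^+ 2 / d ^+ 2) + 2 / d ^+ 2)).
pose K x := wpow (p + 1) x * m x.
have cK : continuous K.
  rewrite /K /m; cont; apply: wpow_continuous; exact: addr_gt0.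
have dk x : is_derive x 1 k (x * m x).
  by rewrite /k /m; derE; rewrite /=; field; rewrite gt_eqF.
pose K1 x := x `^ p * (expR (- (b / 2 * x ^+ 2)) * (- (p + 1) * (b * (1 - x ^+ 2 / d ^+ 2) + 2 / d ^+ 2)
   + x ^+ 2 * (b ^+ 2 * (1 - x ^+ 2 / d ^+ 2) + 4 * b / d ^+ 2))).
have dK x : 0 < x -> is_derive x 1 K (K1 x).
  move=> x0; have dp : is_derive x 1 (wpow (p + 1)) ((p + 1) * x `^ p).
    have := powR_derive (p + 1) x x0; rewrite addrK; apply: der_near.
    by near=> y; rewrite wpow_gt0//; near: y; exact: lt_nbhsr.
  rewrite /K /m /K1; derE; rewrite wpow_gt0// powRD ?powRr1 ?(ltW x0)//.
    by rewrite /=; field; rewrite gt_eqF.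
  by rewrite (gt_eqF x0) implybT.
pose G y := h y * K y - flux p V h y * k y.
have ch := radial_solution_continuous _ _ _ hV.
have GE : G 0 <= G d.
  refine (derive_mono G (fun y => - (y `^ p * (V y * h y) * k y - h y * K1 y)) 0 d _ _ _ (ltW d0)).
  - apply: continuous_subspaceT; rewrite /G /k; cont.
    by apply: flux_continuous => //.
  - move=> y /andP[y0 yd].
    have := derN _ _ _ (wronskian_derive _ _ _ p0 cV hV k K y _ _ y0 (dk y) (dK y y0) _).
    rewrite /K wpow_gt0// powRD ?(gt_eqF y0) ?implybT// powRr1 ?(ltW y0)// mulrA => /(_ erefl).
    by congr (is_derive _ _ _ _); apply/funext => z; rewrite /G opprB.
  - move=> y /andP[y0 yd]; have yd' : 0 <= y <= d by rewrite !ltW.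
    rewrite [X in 0 <= X](_ : _ = y `^ p * h y * expR (- (b / 2 * y ^+ 2)) *
        ((- (p + 1) * (b * (1 - y ^+ 2 / d ^+ 2) + 2 / d ^+ 2)
        + y ^+ 2 * (b ^+ 2 * (1 - y ^+ 2 / d ^+ 2) + 4 * b / d ^+ 2)) -
        (1 - y ^+ 2 / d ^+ 2) * V y)); last by rewrite /K1 /k; ring.
    rewrite mulr_ge0 ?mulr_ge0 ?powR_ge0 ?expR_ge0 ?(ltW (hp _ yd'))// subr_ge0.
    have yy : 0 <= 1 - y ^+ 2 / d ^+ 2.
      by rewrite subr_ge0 ler_pdivrMr ?exprn_gt0// mul1r ler_pXn2r ?nnegrE ?ltW.
    apply: (@le_trans _ _ ((1 - y ^+ 2 / d ^+ 2) * ((b * y) ^+ 2 - Lam))).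
      by rewrite ler_wpM2l// lerD2r Wb.
    (* The value of [Lam] is chosen so that everything cancels except a multiple of
       [y ^+ 2 / d ^+ 2], whose sign is given by [bd]. *)
    rewrite -subr_ge0 [X in 0 <= X](_ : _ = y ^+ 2 / d ^+ 2 * (4 * b - 2 * (p + 1) / d ^+ 2)).
      rewrite mulr_ge0 ?divr_ge0 ?exprn_even_ge0// subr_ge0 ler_pdivrMr ?exprn_gt0//.
      by rewrite -mulrA; lra.
    by rewrite /Lam; field; rewrite gt_eqF.
have dd : 0 <= d <= d by rewrite lexx ltW.
have : G d < 0.
  rewrite /G /k divff ?expf_neq0 ?gt_eqF// subrr mulr0 mulr0 subr0.
  rewrite pmulr_rlt0 ?hp// /K pmulr_rlt0 ?wpow_gt0 ?powR_gt0// /m oppr_lt0.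
  by rewrite mulr_gt0 ?expR_gt0// divff ?expf_neq0 ?gt_eqF// subrr mulr0 add0r divr_gt0 ?exprn_gt0.
apply/negP; rewrite -leNgt; apply: le_trans GE.
by rewrite /G flux0 mul0r subr0 /K /wpow ltxx mul0r mulr0.
Unshelve. all: by end_near. Qed.

(** Shooting: [lam] is the supremum of the parameters for which the solution is positive on
    [[0, L]]. By continuity in the parameter the solution at [lam] is nonnegative, and by maximality
    it has a zero [z]. That it vanishes at [L] is not deduced from uniqueness at a double zero but
    from Sturm comparison: its quotient by a positive solution with a parameter at most [lam] is
    nonincreasing after [z]. *)
Lemma ground_state p W B L Lam : 0 < p -> 0 < L -> 0 <= Lam -> continuous W ->
  (forall r, 0 <= W r <= B) ->
  (forall h, radial_solution p (fun r => W r - Lam) h -> exists2 x, 0 <= x <= L & h x <= 0) ->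
  exists lam h, [/\ 0 <= lam <= Lam, radial_solution p (fun r => W r - lam) h,
    forall x, 0 <= x <= L -> 0 <= h x & h L = 0].
Proof.
move=> p0 L0 Lam0 cW WB HLam.
have B0 : 0 <= B by have /andP[] := WB 0; exact: le_trans.
pose M := B + Lam + 1; have M0 : 0 < M by rewrite /M; lra.
have cV lam : continuous (fun r => W r - lam) by cont.
have VM lam r : 0 <= lam <= Lam -> `|W r - lam| <= M.
  by have := WB r; rewrite ler_norml /M => /andP[? ?] /andP[? ?]; apply/andP; split; lra.
have ex lam : exists h, 0 <= lam <= Lam -> radial_solution p (fun r => W r - lam) h /\
    ((forall r, 0 <= W r - lam) -> forall x, 1 <= h x).
  (* Outside [[0, Lam]] the value is junk and only serves to make [hs] total. *)
  case: (boolP (0 <= lam <= Lam)) => [lamL|_]; last by exists (cst 0).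
  have [h [h1 h2 h3]] := @picard_limit R p (fun r => W r - lam) M p0 M0 (cV lam) (fun r => VM lam r lamL).
  by exists h.
pose hs lam := projT1 (cid (ex lam)).
have hsP lam : 0 <= lam <= Lam -> radial_solution p (fun r => W r - lam) (hs lam).
  by move=> h; case: (projT2 (cid (ex lam)) h).
have hs0 x : 1 <= hs 0 x.
  have [|_] := projT2 (cid (ex 0)); first by rewrite lexx.
  by apply => r; rewrite subr0; case/andP: (WB r).
have chs lam : 0 <= lam <= Lam -> continuous (hs lam) by move=> /hsP[].
(* The difference [d] of two solutions solves the equation for [lam] with source
   [(mu - lam) * hs mu], to which Gronwall applies. The constant may depend on [mu], because the
   bound is used only around the supremum. *)
have lip mu : 0 <= mu <= Lam -> exists2 C, 0 < C & forall lam x, 0 <= lam <= Lam -> 0 <= x <= L ->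
    `|hs lam x - hs mu x| <= C * `|lam - mu|.
  move=> muL.
  have [c cL Hc] := EVT_max (ltW L0) (continuous_subspaceT (cont_norm _ (chs _ muL))).
  pose D : R := 2 * (`|hs mu c| * L * L) * expR (M * L ^+ 2).
  exists (D + 1).
    by rewrite ltr_wpDl// !mulr_ge0// ?expR_ge0// ltW.
  move=> lam x lamL xL.
  pose d y := hs lam y - hs mu y.
  have cd : continuous d by rewrite /d; apply: contD; [exact: chs|apply: contN; exact: chs].
  pose f y := rad p (fun r => (mu - lam) * hs mu r) y.
  have cf : continuous (fun r => (mu - lam) * hs mu r).
    by apply: contM; [exact: cont_cst|exact: chs].
  have cVd : continuous (fun r => (W r - lam) * d r) by apply: contM.
  have dE y : d y = f y + rad p (fun r => (W r - lam) * d r) y.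
    have cl : continuous (fun r => (W r - lam) * hs lam r) by apply: contM; [exact: cV|exact: chs].
    have cm : continuous (fun r => (W r - mu) * hs mu r) by apply: contM; [exact: cV|exact: chs].
    have e1 := radB p _ _ y p0 cl cm.
    have e2 := radB p _ _ y p0 (contD _ _ cl (contN _ cm)) cVd.
    have ef : f y = rad p (fun r => (W r - lam) * hs lam r - (W r - mu) * hs mu r
        - (W r - lam) * d r) y.
      by rewrite /f; congr (rad p _ y); apply/funext => r; rewrite /d; ring.
    rewrite ef e2 e1 subrK [LHS]/d (hsP lam lamL).2 (hsP mu muL).2.
    by move: (rad p _ y) (rad p _ y) => u v; ring.
  have fB y : 0 <= y <= L -> `|f y| <= `|mu - lam| * `|hs mu c| * L * L.
    move=> /andP[y0 yL]; apply: (@le_trans _ _ (`|mu - lam| * `|hs mu c| * L * y)).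
      apply: prim_norm_le => //; first exact: wav_continuous.
      move=> s /andP[s0 sy]; apply: (@le_trans _ _ (`|mu - lam| * `|hs mu c| * s)).
        apply: wav_bound => // r /andP[r0 rs]; rewrite normrM ler_wpM2l//.
        by apply: Hc; rewrite in_itv/= r0 (le_trans rs)// (le_trans sy).
      by rewrite ler_wpM2l ?mulr_ge0// (le_trans sy).
    by rewrite ler_wpM2l// !mulr_ge0// ltW.
  have H := @rad_gronwall R p _ d f M L _ p0 M0 (cV lam) cd (fun r => VM lam r lamL) dE fB x xL.
  apply: le_trans H _; apply: (@le_trans _ _ (D * `|lam - mu|)); last first.
    by rewrite ler_wpM2r// lerDl.
  rewrite /D (distrC mu) [X in X <= _](_ : _ = 2 * (`|hs mu c| * L * L) * expR (M * x ^+ 2) * `|lam - mu|); last first.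
    by move: `|lam - mu| `|hs mu c| => u v; ring.
  apply: ler_wpM2r => //; apply: ler_wpM2l; first by rewrite !mulr_ge0// ltW.
  by rewrite ler_expR ler_wpM2l ?(ltW M0)// ler_pXn2r ?nnegrE ?(ltW L0)//; case/andP: xL.
pose A := [set lam | 0 <= lam <= Lam /\ forall x, 0 <= x <= L -> 0 < hs lam x].
have A0 : A 0 by split; [rewrite lexx|move=> x _; apply: lt_le_trans (hs0 x)].
have hsA : has_sup A by split; [exists 0|exists Lam => lam [/andP[]]].
pose lam := sup A.
have lamL : 0 <= lam <= Lam.
  rewrite sup_upper_bound//=; apply: ge_sup; first by exists 0.
  by move=> y [/andP[]].
have [C C0 HC] := lip lam lamL.
have h_ge0 x : 0 <= x <= L -> 0 <= hs lam x.
  move=> xL; rewrite leNgt; apply/negP => hx.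
  have [mu [muL Hmu] mul] := @sup_adherent R A (- hs lam x / C) (ltac:(by rewrite divr_gt0// oppr_gt0)) hsA.
  have mu_le : mu <= lam by apply: sup_upper_bound.
  have := HC mu x muL xL; have := Hmu x xL.
  rewrite (_ : `|mu - lam| = lam - mu); last by rewrite ler0_norm ?subr_le0// opprB.
  move=> h1; have h2 : C * (lam - mu) < - hs lam x.
    by rewrite mulrC -ltr_pdivlMr//; move: mul; rewrite -/lam; lra.
  by rewrite ler_norml => /andP[]; lra.
have [z zL hz] : exists2 z, 0 <= z <= L & hs lam z = 0.
  have [c cL Hc] := EVT_min (ltW L0) (continuous_subspaceT (chs _ lamL)).
  have cL' : 0 <= c <= L by move: cL; rewrite in_itv.
  exists c => //; apply: le_anti; rewrite h_ge0// andbT leNgt; apply/negP => hc.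
  have lamLt : lam < Lam.
    rewrite lt_neqAle (andP lamL).2 andbT; apply/eqP => E.
    have := hsP _ lamL; rewrite {1}E => /HLam[x xL]; rewrite leNgt => /negP; apply.
    by apply: lt_le_trans hc _; apply: Hc; rewrite in_itv.
  (* With this increment the Lipschitz bound costs at most half of the minimum [hs lam c], so [mu]
     would still be in [A]. *)
  pose mu := Num.min Lam (lam + hs lam c / (2 * C)).
  have lmu : lam < mu by rewrite lt_min lamLt ltrDl divr_gt0// mulr_gt0.
  have muL : 0 <= mu <= Lam.
    by rewrite ge_min lexx andbT (le_trans _ (ltW lmu))//; case/andP: lamL.
  have : A mu.
    split=> // x xL; have := HC mu x muL xL; have := Hc x; rewrite in_itv/= xL => /(_ isT).
    rewrite (_ : `|mu - lam| = mu - lam); last by rewrite gtr0_norm ?subr_gt0.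
    move=> h1.
    have : C * (mu - lam) <= hs lam c / 2.
      rewrite mulrC -ler_pdivlMr// lerBlDl ge_min; apply/orP; right.
      by rewrite -mulrA -invfM.
    by rewrite ler_norml => h2 /andP[]; lra.
  by move=> /(sup_upper_bound hsA); rewrite -/lam leNgt lmu.
exists lam, (hs lam); split => //; first exact: hsP.
(* The positive solution for the Sturm comparison. The Wronskian [G] has derivative [u^p (lam - mu)]
   times the product of the two solutions, so it is nonnegative, and it is the numerator in the
   derivative of [q]. *)
have [mu [muL Hmu] mul] : exists2 mu, A mu & mu <= lam.
  by exists 0 => //; case/andP: lamL.
have z0 : 0 < z.
  rewrite lt_neqAle (andP zL).1 andbT; apply/eqP => z0.
  by move: hz; rewrite -z0 (radial_solution0 _ _ _ (hsP _ lamL)) => /eqP; rewrite oner_eq0.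
have Hmu' y : 0 <= y <= L -> hs mu y != 0 by move=> /Hmu; rewrite lt0r => /andP[].
pose F := flux p (fun r => W r - lam) (hs lam).
pose K := flux p (fun r => W r - mu) (hs mu).
pose G y := hs lam y * K y - F y * hs mu y.
have dG y : 0 < y ->
    is_derive y 1 G (- (y `^ p * ((W y - lam) * hs lam y) * hs mu y - hs lam y * (y `^ p * ((W y - mu) * hs mu y)))).
  move=> y0; have dK := flux_derive _ _ _ p0 (cV mu) (hsP mu muL) y y0.
  have dk := radial_solution_derive _ _ _ p0 (cV mu) (hsP mu muL) y y0.
  have := derN _ _ _ (wronskian_derive _ _ _ p0 (cV lam) (hsP _ lamL) _ _ y _ _ y0 dk dK _).
  rewrite mulrC divfK ?gt_eqF ?powR_gt0// => /(_ erefl).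
  by congr (is_derive _ _ _ _); apply/funext => u; rewrite /G opprB.
have cG : continuous G.
  by rewrite /G; cont; do ?[exact: chs]; apply: flux_continuous => //; exact: hsP.
have G0 y : 0 <= y <= L -> 0 <= G y.
  move=> /andP[y0 yL]; have <- : G 0 = 0 by rewrite /G /K /F !flux0 mul0r mulr0 subr0.
  refine (derive_mono G _ 0 y (continuous_subspaceT cG) (fun u uy => dG u (andP uy).1) _ y0).
  move=> u /andP[u0 uy]; have uL : 0 <= u <= L by rewrite (ltW u0)/= ltW// (lt_le_trans uy).
  rewrite [X in 0 <= X](_ : _ = u `^ p * (lam - mu) * hs lam u * hs mu u); last by ring.
  by rewrite !mulr_ge0 ?powR_ge0 ?subr_ge0 ?h_ge0// ltW// Hmu.
pose q y := - (hs lam y / hs mu y).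
have : q z <= q L.
  refine (derive_mono q (fun y => G y / y `^ p / hs mu y ^+ 2) z L _ _ _ (andP zL).2).
  - apply: continuous_in_subspaceT => y; rewrite inE/= in_itv/= => /andP[zy yL].
    apply: cvgN; apply: cvgM; first exact: chs.
    apply: cvgV; last exact: chs.
    by apply: Hmu'; rewrite yL (le_trans (ltW z0)).
  - move=> y /andP[zy yL]; have y0 := lt_trans z0 zy.
    have n0 : hs mu y != 0 by apply: Hmu'; rewrite !ltW.
    have dk := radial_solution_derive _ _ _ p0 (cV mu) (hsP mu muL) y y0.
    have dh := radial_solution_derive _ _ _ p0 (cV lam) (hsP lam lamL) y y0.
    have dV := derV _ _ _ n0 dk.
    rewrite /q; derE; rewrite /G -/K -/F; field; rewrite n0 gt_eqF// powR_gt0//.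
  - move=> y /andP[zy yL]; have y0 := lt_trans z0 zy.
    by rewrite !divr_ge0 ?powR_ge0 ?exprn_even_ge0// G0// !ltW.
have LL : 0 <= L <= L by rewrite lexx ltW.
rewrite /q hz mul0r oppr0 lerNr oppr0 pmulr_lle0 ?invr_gt0 ?Hmu// => h.
by apply: le_anti; rewrite h h_ge0.
Qed.

End GroundState.

(** * Agmon decay by comparison with a supersolution *)

Section Decay.
Context {R : realType}.
Implicit Types (f g h V W : R -> R) (a b c x y r s t e p B C D M L lam mu Lam : R).

(** A positive flux at [L] would persist on an interval before [L], where [h] would increase up to 0
    and hence be negative. *)
Lemma flux_end_le0 p V h L : 0 < p -> continuous V -> radial_solution p V h -> 0 < L ->
  (forall x, 0 <= x <= L -> 0 <= h x) -> h L = 0 -> flux p V h L <= 0.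
Proof.
move=> p0 cV hV L0 h0 hL; rewrite leNgt; apply/negP => FL.
have /cvgrPdist_lt/(_ _ FL)/nbhs_ballP[d /= d0 Hd] := flux_continuous p V h p0 cV hV L.
pose c := L - Num.min L d / 2.
have m0 : 0 < Num.min L d by rewrite lt_min L0.
have [mL md] : Num.min L d <= L /\ Num.min L d <= d by rewrite !ge_min !lexx orbT.
have cL : c < L by rewrite /c; lra.
have c0 : 0 < c by rewrite /c; lra.
have [u] := @MVT R h (fun x => flux p V h x / x `^ p) c L cL
  (fun x xc => radial_solution_derive _ _ _ p0 cV hV x (lt_trans c0 (andP (xc : c < x < L)).1))
  (continuous_subspaceT (radial_solution_continuous _ _ _ hV)).
rewrite in_itv/= hL sub0r => /andP[cu uL] E.
have Fu : 0 < flux p V h u.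
  have : `|flux p V h L - flux p V h u| < flux p V h L.
    by apply: Hd; rewrite /ball/= ger0_norm ?subr_ge0 ?(ltW uL)//; move: cu; rewrite /c; lra.
  by rewrite ltr_norml => /andP[_]; lra.
have hc := h0 c (ltac:(by rewrite !ltW)).
suff : 0 < - h c by lra.
by rewrite E mulr_gt0 ?subr_gt0// divr_gt0// powR_gt0// (lt_trans c0).
Qed.

(* [exp (- prim Q)] is a supersolution on ]x0, L[ as soon as [Q ^+ 2 - Q' <= V]. *)
Lemma radial_solution_decay p V h (Q dQ : R -> R) x0 L : 0 < p -> continuous V ->
  radial_solution p V h -> 0 < x0 -> continuous Q ->
  (forall x, x0 < x < L -> is_derive x 1 Q (dQ x)) ->
  (forall x, x0 < x < L -> 0 <= Q x /\ Q x ^+ 2 - dQ x <= V x) ->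
  (forall x, 0 <= x <= L -> 0 <= h x) -> h L = 0 ->
  forall x y, x0 <= x -> x <= y -> y <= L ->
    h y <= h x * expR (- (prim Q y - prim Q x)).
Proof.
move=> p0 cV hV x00 cQ dQP QV h0 hL x y x0x xy yL.
have L0 : 0 < L by apply: lt_le_trans yL; apply: lt_le_trans xy; exact: lt_le_trans x0x.
have ch := radial_solution_continuous _ _ _ hV.
have cF := flux_continuous p V h p0 cV hV.
have cP := prim_continuous _ cQ.
pose S y := expR (- prim Q y); pose K y := - (wpow p y * Q y * S y).
have cS : continuous S by rewrite /S; cont.
have cK : continuous K by rewrite /K; cont; exact: wpow_continuous.
have dS (u : R) : 0 < u -> is_derive u 1 S (- Q u * S u).
  by move=> u0; have dP := prim_derive Q u cQ u0; rewrite /S; derE; rewrite mulrC.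
pose G y := flux p V h y * S y - h y * K y.
have cG : continuous G by rewrite /G; cont.
(* [G] is nondecreasing on [[x0, L]], and at [L], where [h] vanishes, it reduces to the flux times
   [S], which is nonpositive. *)
have G_le0 (u : R) : x0 <= u -> u <= L -> G u <= 0.
  move=> x0u uL; apply: (@le_trans _ _ (G L)); last first.
    by rewrite /G hL mul0r subr0 mulr_le0_ge0 ?expR_ge0// flux_end_le0.
  pose K1 u := - ((p * u `^ (p - 1) * Q u + u `^ p * dQ u) * S u - u `^ p * Q u ^+ 2 * S u).
  refine (derive_mono G (fun u => u `^ p * (V u * h u) * S u - h u * K1 u) u L
    (continuous_subspaceT cG) _ _ uL).
    move=> t /andP[ut tL]; have x0t := le_lt_trans x0u ut; have t0 := lt_trans x00 x0t.
    have dQt : is_derive t 1 Q (dQ t) by apply: dQP; rewrite x0t.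
    have dw : is_derive t 1 (wpow p) (p * t `^ (p - 1)).
      apply: der_near (powR_derive p t t0); near=> z; rewrite wpow_gt0//.
      by near: z; exact: lt_nbhsr.
    have dSt := dS t t0.
    apply: (wronskian_derive _ _ _ p0 cV hV S K t _ _ t0 dSt).
      by rewrite /K /K1; derE; rewrite wpow_gt0//; ring.
    by rewrite /K wpow_gt0//; ring.
  move=> t /andP[ut tL]; have x0t := le_lt_trans x0u ut; have t0 := lt_trans x00 x0t.
  have [Q0 QQ] : 0 <= Q t /\ Q t ^+ 2 - dQ t <= V t by apply: QV; rewrite x0t.
  rewrite [X in 0 <= X](_ : _ = h t * S t * (t `^ p * (V t - (Q t ^+ 2 - dQ t)) +
    p * t `^ (p - 1) * Q t)); last by rewrite /K1; ring.
  rewrite !mulr_ge0 ?expR_ge0 ?h0 ?(ltW t0) ?(ltW tL)// addr_ge0//.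
    by rewrite mulr_ge0 ?powR_ge0 ?subr_ge0.
  by rewrite !mulr_ge0 ?powR_ge0 ?(ltW p0).
(* [q] is [- h / S], and the sign of [G] says that [h / S] is nonincreasing. *)
pose q u := - (h u * expR (prim Q u)).
have cq : continuous q by rewrite /q; cont.
have : q x <= q y.
  refine (derive_mono q (fun u => - (G u / (u `^ p) * expR (prim Q u) * expR (prim Q u))) x y
    (continuous_subspaceT cq) _ _ xy).
    move=> t /andP[xt ty]; have t0 := lt_trans x00 (le_lt_trans x0x xt).
    have dP := prim_derive Q t cQ t0.
    have dh := radial_solution_derive _ _ _ p0 cV hV t t0.
    have pt : t `^ p != 0 by rewrite gt_eqF// powR_gt0.
    rewrite /q; derE; rewrite /G /K /S wpow_gt0// expRN.
    by field; rewrite pt gt_eqF// expR_gt0.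
  move=> t /andP[xt ty]; rewrite oppr_ge0 !mulr_le0_ge0 ?expR_ge0 ?invr_ge0 ?powR_ge0//.
  by apply: G_le0; [exact: ltW (le_lt_trans x0x xt)|exact: ltW (lt_le_trans ty yL)].
rewrite /q lerN2 -ler_pdivlMr ?expR_gt0// => /le_trans; apply.
by rewrite -mulrA -expRN -expRD opprB.
Unshelve. all: by end_near. Qed.

End Decay.

(** * A class of smooth functions closed under derivation, and tensor products *)

Section Smooth.
Context {R : realType}.
Implicit Types (f g : R -> R) (a b c x y r s k e C D L : R) (j n m : nat).

(* On [1/k, +oo[ a cut-off that is flat at [1/k]; negative powers of [k x - 1] and
   real powers of [x] are included to get a family closed under derivation. *)
Definition flat k j r x : R :=
  if 1 < k * x then (k * x - 1) ^- j * expR (- (k * x - 1)^-1) * x `^ r else 0.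

Inductive smooth : (R -> R) -> Prop :=
| smooth_cst c : smooth (fun=> c)
| smooth_id : smooth (fun x => x)
| smoothD f g : smooth f -> smooth g -> smooth (fun x => f x + g x)
| smoothM f g : smooth f -> smooth g -> smooth (fun x => f x * g x)
| smooth_refl L f : smooth f -> smooth (fun x => f (L - x))
| smooth_flat k j r : 0 < k -> smooth (flat k j r)
| smooth_sin c : smooth (fun x => sin (c * x))
| smooth_cos c : smooth (fun x => cos (c * x)).

(** With [y = z^-1] this is [y ^+ j <= j! * expR y], a single term of the exponential series. *)
Lemma expRN_inv_le j (z : R) : 0 < z -> z ^- j * expR (- z^-1) <= j`!%:R.
Proof.
move=> z0; rewrite expRN -exprVn ler_pdivrMr ?expR_gt0// -ler_pdivrMl ?ltr0n ?fact_gt0//.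
rewrite mulrC; case: j => [|j].
  by rewrite expr0 fact0 divr1 -expR0 ler_expR invr_ge0 ltW.
apply: le_trans (@expR_ge1Dxn R z^-1 j _); last by rewrite invr_ge0 ltW.
by rewrite lerDr.
Qed.

Lemma is_derive_quadratic f a C d : 0 < d -> f a = 0 ->
  (forall x, `|x - a| < d -> `|f x| <= C * (x - a) ^+ 2) -> is_derive a 1 f 0.
Proof.
move=> d0 fa Hf; apply/is_derive1_caratheodory; exists (fun x => f x / (x - a)); split.
- move=> x; rewrite fa subr0; have [->|xa] := eqVneq x a; first by rewrite fa !mul0r.
  by rewrite divfK// subr_eq0.
- rewrite /prop_for /continuous_at fa mul0r; apply/cvgrPdist_lt => e e0; near=> x.
  rewrite sub0r normrN normrM normfV.
  have [->|xa] := eqVneq x a; first by rewrite fa normr0 mul0r.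
  have xa0 : 0 < `|x - a| by rewrite normr_gt0 subr_eq0.
  rewrite ltr_pdivrMr//; apply: le_lt_trans (Hf x _) _.
    by rewrite distrC; near: x; exact: near_dist.
  rewrite -real_normK ?num_real// expr2 mulrA ltr_pM2r//.
  apply: (@le_lt_trans _ _ ((`|C| + 1) * `|x - a|)).
    by rewrite ler_wpM2r// (le_trans (ler_norm _))// lerDl.
  rewrite -ltr_pdivlMl ?ltr_wpDl// mulrC distrC.
  by near: x; apply: near_dist; rewrite divr_gt0// ltr_wpDl.
- by rewrite fa mul0r.
Unshelve. all: by end_near. Qed.

Lemma flat_derive k j r x : 0 < k ->
  is_derive x 1 (flat k j r)
    (- j%:R * k * flat k j.+1 r x + k * flat k j.+2 r x + r * flat k j (r - 1) x).
Proof.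
move=> k0; have [xk|xk|xk] := ltgtP (k * x) 1.
- rewrite /flat !ltNge !(ltW xk)/= !mulr0 !addr0.
  apply: der_near (der_cst x 0); near=> y; rewrite ifF//; apply/negbTE; rewrite -leNgt.
  rewrite mulrC -ler_pdivlMr//; apply/ltW; near: y; apply: lt_nbhsl.
  by rewrite ltr_pdivlMr// mulrC.
- have x0 : 0 < x by rewrite -(pmulr_rgt0 _ k0) (lt_trans ltr01).
  have z0 : k * x - 1 != 0 by rewrite subr_eq0 gt_eqF.
  apply: (der_near _ (fun y => ((k * y - 1)^-1) ^+ j * expR (- (k * y - 1)^-1) * y `^ r)).
    near=> y; rewrite /flat exprVn ifT// mulrC -ltr_pdivrMr//.
    by near: y; apply: lt_nbhsr; rewrite ltr_pdivrMr// mulrC.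
  have dz : is_derive x 1 (fun y => k * y - 1) k by derE; ring.
  have dV := derV (fun y => k * y - 1) _ _ z0 dz; have dp := powR_derive r x x0.
  rewrite /flat xk; derE; rewrite -!exprVn powRB ?(gt_eqF x0) ?implybT// powRr1 ?(ltW x0)//.
  case: j => [|j] /=; first by rewrite !expr0 !expr1; field; rewrite gt_eqF.
  by rewrite !exprS; field; rewrite z0 gt_eqF.
(* At the edge [k * x = 1] the exponential beats two more negative powers, so the function is
   quadratically small there and its derivative is 0. *)
- have x0 : 0 < x by rewrite -(pmulr_rgt0 _ k0) xk.
  have flat0 i s : flat k i s x = 0 by rewrite /flat xk ltxx.
  rewrite !flat0 !mulr0 !addr0.
  have /cvgrPdist_lt/(_ 1 ltr01)/nbhs_ballP[d /= d0 Hd] := powR_continuous r x x0.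
  apply: (is_derive_quadratic _ _ (j.+2`!%:R * k ^+ 2 * (x `^ r + 1)) d) => // y yd.
  have [y1|y1] := ltP 1 (k * y); last first.
    by rewrite /flat ltNge y1/= normr0; nneg.
  have z0 : 0 < k * y - 1 by rewrite subr_gt0.
  have zE : k * y - 1 = k * (y - x) by rewrite mulrBr xk.
  have yr : y `^ r <= x `^ r + 1.
    have : `|x `^ r - y `^ r| < 1 by apply: Hd; rewrite /ball/= distrC.
    by rewrite ltr_norml => /andP[]; lra.
  rewrite /flat y1 ger0_norm; last by nneg.
  rewrite [leRHS](_ : _ = j.+2`!%:R * (k * y - 1) ^+ 2 * (x `^ r + 1)); last by rewrite zE; ring.
  apply: ler_pM => //; try nneg.
  rewrite -ler_pdivrMr ?exprn_gt0//; apply: le_trans (expRN_inv_le j.+2 _ z0).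
  by rewrite -!exprVn !exprS le_eqVlt; apply/orP; left; apply/eqP; rewrite expr0; ring.
Unshelve. all: by end_near. Qed.

Lemma smooth_derive f : smooth f ->
  exists2 g, smooth g & forall x, is_derive x 1 f (g x).
Proof.
elim=> {f} [c||f g sf [f1 sf1 df] sg [g1 sg1 dg]|f g sf [f1 sf1 df] sg [g1 sg1 dg]
    |L f sf [f1 sf1 df]|k j r k0|c|c].
- by exists (fun=> 0); [exact: smooth_cst|move=> x; exact: der_cst].
- by exists (fun=> 1); [exact: smooth_cst|move=> x; exact: der_id].
- exists (fun x => f1 x + g1 x); first exact: smoothD.
  by move=> x; exact: derD (df x) (dg x).
- exists (fun x => f1 x * g x + f x * g1 x); first by apply: smoothD; exact: smoothM.
  by move=> x; exact: derM (df x) (dg x).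
- exists (fun x => -1 * f1 (L - x)).
    by apply: smoothM; [exact: smooth_cst|exact: smooth_refl].
  move=> x; have dL : is_derive x 1 (fun y => L - y) (- 1) by derE; ring.
  by apply: der_eq (der_comp (fun y => L - y) _ _ _ _ dL (df _)) _; rewrite mulrC.
- exists (fun x => - j%:R * k * flat k j.+1 r x + k * flat k j.+2 r x + r * flat k j (r - 1) x).
    by do ![apply: smoothD|apply: smoothM|exact: smooth_cst|exact: smooth_flat].
  by move=> x; exact: flat_derive.
- exists (fun x => c * cos (c * x)).
    by apply: smoothM; [exact: smooth_cst|exact: smooth_cos].
  move=> x; have dc : is_derive x 1 (fun y => c * y) c by derE; ring.
  by apply: der_eq (der_comp _ _ _ _ _ dc (is_derive_sin _)) _; rewrite mulrC.
- exists (fun x => - c * sin (c * x)).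
    by apply: smoothM; [exact: smooth_cst|exact: smooth_sin].
  move=> x; have dc : is_derive x 1 (fun y => c * y) c by derE; ring.
  by apply: der_eq (der_comp _ _ _ _ _ dc (is_derive_cos _)) _; rewrite mulrC mulrN mulNr.
Qed.

Lemma smooth_continuous f : smooth f -> continuous f.
Proof.
by move=> /smooth_derive[g _ df] x; exact: is_derive1_continuous (df x).
Qed.



Lemma is_derive_fst (u : R * R -> R) (x y l : R) :
  is_derive x 1 (fun s => u (s, y)) l -> is_derive (x, y) (1, 0) u l.
Proof.
have E : (fun h : R => h^-1 *: ((u \o shift (x, y)) (h *: (1, 0)) - u (x, y))) =
    (fun h : R => h^-1 *: (((fun s => u (s, y)) \o shift x) (h *: (1 : R)) - u (x, y))).
  apply/funext => h /=; congr (_ *: (u _ - _)).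
  by apply: injective_projections => //=; rewrite scaler0 add0r.
case=> dx dE; split.
  by rewrite /derivable E.
by rewrite /derive E.
Qed.

Lemma is_derive_snd (u : R * R -> R) (x y l : R) :
  is_derive y 1 (fun s => u (x, s)) l -> is_derive (x, y) (0, 1) u l.
Proof.
have E : (fun h : R => h^-1 *: ((u \o shift (x, y)) (h *: (0, 1)) - u (x, y))) =
    (fun h : R => h^-1 *: (((fun s => u (x, s)) \o shift y) (h *: (1 : R)) - u (x, y))).
  apply/funext => h /=; congr (_ *: (u _ - _)).
  by apply: injective_projections => //=; rewrite scaler0 add0r.
case=> dx dE; split.
  by rewrite /derivable E.
by rewrite /derive E.
Qed.


Definition tensor f g : R * R -> R := fun p => f p.1 * g p.2.

Lemma tensor_continuous f g : continuous f -> continuous g -> continuous (tensor f g).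
Proof.
move=> cf cg p; apply: cvgM.
  by apply: continuous_comp; [exact: cvg_fst|exact: cf].
by apply: continuous_comp; [exact: cvg_snd|exact: cg].
Qed.

Lemma tensor_derive_fst f g (f1 : R) (p : R * R) : is_derive p.1 1 f f1 ->
  is_derive p (1, 0) (tensor f g) (f1 * g p.2).
Proof.
case: p => x y /= df; apply: is_derive_fst; rewrite /tensor /=.
by derE; rewrite mulr0 addr0.
Qed.

Lemma tensor_derive_snd f g (g1 : R) (p : R * R) : is_derive p.2 1 g g1 ->
  is_derive p (0, 1) (tensor f g) (f p.1 * g1).
Proof.
case: p => x y /= df; apply: is_derive_snd; rewrite /tensor /=.
by derE; rewrite mul0r add0r.
Qed.

Lemma tensor_Ck n f g : smooth f -> smooth g -> Ck n (tensor f g).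
Proof.
elim: n f g => [|n IH] f g sf sg /=.
  by split=> //; apply: tensor_continuous; exact: smooth_continuous.
split; first by apply: tensor_continuous; exact: smooth_continuous.
have [f1 sf1 df] := smooth_derive f sf; have [g1 sg1 dg] := smooth_derive g sg.
have df' p := tensor_derive_fst f g _ p (df p.1).
have dg' p := tensor_derive_snd f g _ p (dg p.2).
split.
- by move=> p; have [] := df' p.
- by move=> p; have [] := dg' p.
- rewrite (_ : pdx _ = tensor f1 g); first exact: IH.
  by apply/funext => p; have [] := df' p.
- rewrite (_ : pdy _ = tensor f g1); first exact: IH.
  by apply/funext => p; have [] := dg' p.
Qed.

End Smooth.

(** * Bernstein polynomials *)

Section Bernstein.
Context {R : realType}.
Implicit Types (f g : nat -> R) (a b c x y r s e C D L : R) (j k n m : nat).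

(* Bernstein polynomial of degree [n] with values [f 0, ..., f n], by de Casteljau's recursion *)
Fixpoint bern n f x : R :=
  if n is m.+1 then x * bern m (fun k => f k.+1) x + (1 - x) * bern m f x else f 0%N.

Lemma eq_bern n f g x : f =1 g -> bern n f x = bern n g x.
Proof. by move=> /funext ->. Qed.

Lemma bernB n f g x : bern n (fun k => f k - g k) x = bern n f x - bern n g x.
Proof. by elim: n f g => [//|n IH] f g /=; rewrite !IH; ring. Qed.

Lemma bernD n f g x : bern n (fun k => f k + g k) x = bern n f x + bern n g x.
Proof. by elim: n f g => [//|n IH] f g /=; rewrite !IH; ring. Qed.

Lemma bernZ n c f x : bern n (fun k => c * f k) x = c * bern n f x.
Proof. by elim: n f => [//|n IH] f /=; rewrite !IH; ring. Qed.

Lemma bern_cst n c x : bern n (fun=> c) x = c.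
Proof. by elim: n => [//|n IH] /=; rewrite !IH; ring. Qed.

Lemma bern_le n f g x : 0 <= x <= 1 -> (forall k, (k <= n)%N -> f k <= g k) ->
  bern n f x <= bern n g x.
Proof.
move=> /andP[x0 x1]; elim: n f g => [|n IH] f g fg /=; first exact: fg.
apply: lerD; apply: ler_wpM2l; rewrite ?subr_ge0//; apply: IH => k kn; apply: fg => //.
exact: leq_trans (leqnSn _).
Qed.

Lemma bern_norm n f x C : 0 <= x <= 1 -> (forall k, (k <= n)%N -> `|f k| <= C) ->
  `|bern n f x| <= C.
Proof.
move=> x01 fC; rewrite ler_norml -{1}(bern_cst n (- C) x) -{2}(bern_cst n C x).
by apply/andP; split; apply: bern_le => // k /fC; rewrite ler_norml => /andP[].
Qed.

(** The second moment about [c] of a binomial variable with parameters [n] and [x]. *)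
Lemma bern_variance n x c :
  bern n (fun k => (k%:R - c) ^+ 2) x = (n%:R * x - c) ^+ 2 + n%:R * x * (1 - x).
Proof.
elim: n c => [|n IH] c /=; first by ring.
rewrite IH (eq_bern n _ (fun k => (k%:R - (c - 1)) ^+ 2)); last first.
  by move=> k; rewrite -natr1; ring.
by rewrite IH -natr1; ring.
Qed.

Lemma bern1 n f : bern n f 1 = f n.
Proof. by elim: n f => [//|n IH] f /=; rewrite IH subrr mul0r addr0 mul1r. Qed.

Lemma bern_derive n f x :
  is_derive x 1 (bern n.+1 f) (n.+1%:R * bern n (fun k => f k.+1 - f k) x).
Proof.
elim: n f => [|n IH] f.
  by rewrite /bern; derE; ring.
have d1 := IH (fun k => f k.+1); have d2 := IH f.
rewrite -[bern n.+2 f]/(fun x => x * bern n.+1 (fun k => f k.+1) x + (1 - x) * bern n.+1 f x).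
derE; rewrite -(natr1 n.+1) bernB [bern n.+1 (fun k => _) x in RHS]/=.
by rewrite !bernB /=; ring.
Qed.

(** Bernstein's theorem by a Chebyshev argument, with nodes allowed to move by one mesh, because the
    nodes that arise for the derivative are mean value points. *)
Lemma bern_approx n (F : R -> R) (xi : nat -> R) L C d e x : 0 <= x <= 1 -> 0 < d -> 0 < L ->
  (forall k, (k <= n)%N -> `|F (xi k)| <= C) -> `|F (L * x)| <= C ->
  (forall u, `|u - L * x| < d -> `|F u - F (L * x)| <= e) ->
  (forall k, (k <= n)%N -> `|xi k - L * (k%:R / n.+1%:R)| <= L / n.+1%:R) ->
  `|bern n (fun k => F (xi k)) x - F (L * x)| <= e + 8 * C * L ^+ 2 / d ^+ 2 / n.+1%:R.
Proof.
move=> x01 d0 L0 FC FxC Fe xik.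
have C0 : 0 <= C by exact: le_trans FxC.
have e0 : 0 <= e by apply: le_trans (Fe (L * x) _); rewrite ?subrr ?normr0.
have n0 : 0 < n.+1%:R :> R by rewrite ltr0n.
have n1 : 1 <= n.+1%:R :> R by rewrite ler1n.
(* Either the node is within [d] of [L * x], or the quadratic term exceeds [2 * C]. The two squares
   come from [(A + B)^2 <= 2 A^2 + 2 B^2], where [A] is the displacement of the node and [B] its
   distance to [L * x] before displacement. *)
pose g k : R := e + 2 * C / d ^+ 2 * (2 * (L / n.+1%:R) ^+ 2 + 2 * (L / n.+1%:R) ^+ 2 * (k%:R - n.+1%:R * x) ^+ 2).
have gP k : (k <= n)%N -> `|F (xi k) - F (L * x)| <= g k.
  move=> kn; have [xd|xd] := ltP `|xi k - L * x| d.
    apply: le_trans (Fe _ xd) _; rewrite /g lerDl.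
    by nneg.
  apply: (@le_trans _ _ (2 * C)).
    by apply: le_trans (ler_normB _ _) _; have := FC k kn; lra.
  apply: (@le_trans _ _ (2 * C / d ^+ 2 * (xi k - L * x) ^+ 2)).
    rewrite -mulrA ler_peMr ?mulr_ge0// mulrC ler_pdivlMr ?exprn_gt0// mul1r.
    by rewrite -[leRHS]real_normK ?num_real// ler_pXn2r ?nnegrE ?(ltW d0).
  rewrite /g -[leLHS]add0r lerD// ler_wpM2l//.
    by nneg.
  set A := xi k - L * (k%:R / n.+1%:R); set B := L / n.+1%:R * (k%:R - n.+1%:R * x).
  have -> : xi k - L * x = A + B by rewrite /A /B; field; rewrite gt_eqF.
  have AL : A ^+ 2 <= (L / n.+1%:R) ^+ 2.
    rewrite -[leLHS]real_normK ?num_real// ler_pXn2r ?nnegrE ?divr_ge0 ?(ltW L0)//.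
    exact: xik.
  rewrite (_ : 2 * (L / n.+1%:R) ^+ 2 * (k%:R - n.+1%:R * x) ^+ 2 = 2 * B ^+ 2); last first.
    by rewrite /B; move: (L / _) (k%:R - _) => u v; ring.
  by have := sqr_ge0 (A - B); clearbody A B; move: AL; set u := (L / _) ^+ 2; clearbody u; rewrite sqrrB sqrrD; lra.
rewrite -[X in _ - X](bern_cst n (F (L * x)) x) -bernB.
apply: (@le_trans _ _ (bern n g x)).
  rewrite ler_norml; apply/andP; split.
    rewrite -[leLHS]mulN1r -bernZ; apply: bern_le => // k /gP.
    by rewrite mulN1r ler_norml => /andP[].
  by apply: bern_le => // k /gP; rewrite ler_norml => /andP[].
rewrite /g bernD bern_cst bernZ bernD bern_cst bernZ bern_variance lerD2l.
have /andP[x0 x1] := x01.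
have xx : (n%:R * x - n.+1%:R * x) ^+ 2 + n%:R * x * (1 - x) <= n.+1%:R.
  rewrite -natr1 mulrDl mul1r opprD addrA subrr add0r sqrrN addrC lerD//.
    rewrite -mulrA ler_piMr// mulr_ile1 ?subr_ge0//; lra.
  by rewrite expr_le1.
rewrite (_ : 8 * C * L ^+ 2 / d ^+ 2 / n.+1%:R = 2 * C / d ^+ 2 * (4 * L ^+ 2 / n.+1%:R)); last first.
  by field; rewrite !gt_eqF.
apply: ler_wpM2l; first by nneg.
apply: (@le_trans _ _ (2 * (L / n.+1%:R) ^+ 2 + 2 * (L / n.+1%:R) ^+ 2 * n.+1%:R)).
  by rewrite lerD2l; apply: ler_wpM2l => //; nneg.
rewrite (_ : _ + _ = 2 * L ^+ 2 / n.+1%:R * (1 / n.+1%:R + 1)); last by field; rewrite gt_eqF.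
rewrite (_ : 4 * L ^+ 2 / n.+1%:R = 2 * L ^+ 2 / n.+1%:R * 2); last by field; rewrite gt_eqF.
apply: ler_wpM2l; first by nneg.
by rewrite [X in _ <= X](_ : _ = 1 + 1)// lerD2r ler_pdivrMr// mul1r.
Qed.


End Bernstein.

(** * Smooth approximation of a function together with its derivative *)

Section C1Approximation.
Context {R : realType}.

Lemma smooth_bern n (f : nat -> R) c : smooth (fun x => bern n f (c * x)).
Proof.
elim: n f => [|n IH] f /=; first exact: smooth_cst.
have sx : smooth (fun x => c * x) by apply: smoothM; [exact: smooth_cst|exact: smooth_id].
apply: smoothD; apply: smoothM => //.
rewrite (_ : (fun x => 1 - c * x) = (fun x => 1 + -1 * (c * x))); last first.
  by apply/funext => x; rewrite mulN1r.
by apply: smoothD; [exact: smooth_cst|apply: smoothM => //; exact: smooth_cst].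
Qed.

(** The derivative of a Bernstein polynomial is the Bernstein polynomial of the divided differences,
    which by the mean value theorem are values of [h1]. This bounds the derivatives by the maximum
    of [|h1|] and makes them converge. Bernstein polynomials also take the exact value at [L], which
    preserves the boundary condition. *)
Lemma C1_approx (h h1 : R -> R) (L : R) : 0 < L -> continuous h -> continuous h1 ->
  (forall x : R, 0 < x -> is_derive x 1 h (h1 x)) ->
  exists (H H1 : nat -> R -> R) (C : R), [/\ forall n, smooth (H n),
    forall n (x : R), is_derive x 1 (H n) (H1 n x),
    forall n x, 0 <= x <= L -> `|H1 n x| <= C,
    forall n, H n L = h L &
    forall x, 0 <= x <= L -> H n x @[n --> \oo] --> h x /\ H1 n x @[n --> \oo] --> h1 x].
Proof.
move=> L0 ch ch1 dh.
pose P n (k : nat) : R := L * (k%:R / n.+1%:R).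
have n0 (n : nat) : 0 < n.+1%:R :> R by rewrite ltr0n.
have P_ge0 n k : 0 <= P n k by rewrite /P; nneg.
have P_le n k : (k <= n.+1)%N -> P n k <= L.
  by move=> kn; rewrite /P ler_piMr ?(ltW L0)// ler_pdivrMr// mul1r ler_nat.
have PS n k : P n k.+1 - P n k = L / n.+1%:R.
  by rewrite /P -natr1; field; rewrite gt_eqF.
have PS_lt n k : P n k < P n k.+1 by rewrite -subr_gt0 PS divr_gt0.
have mvt n k : exists2 c, P n k < c < P n k.+1 & h (P n k.+1) - h (P n k) = h1 c * (L / n.+1%:R).
  have [c cP E] : exists2 c, c \in `]P n k, P n k.+1[ &
      h (P n k.+1) - h (P n k) = h1 c * (P n k.+1 - P n k).
    apply: (MVT (PS_lt n k)); last exact: continuous_subspaceT.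
    move=> x xP; apply: dh; apply: le_lt_trans (P_ge0 n k) _.
    by move: xP; rewrite in_itv => /andP[].
  by exists c; [move: cP; rewrite in_itv|rewrite E PS].
pose xi n k := projT1 (cid2 (mvt n k)).
have xiP n k : P n k < xi n k < P n k.+1 by rewrite /xi; case: cid2.
have xiE n k : h (P n k.+1) - h (P n k) = h1 (xi n k) * (L / n.+1%:R) by rewrite /xi; case: cid2.
pose H n x := bern n.+1 (fun k => h (P n k)) (L^-1 * x).
pose H1 n x := bern n (fun k => h1 (xi n k)) (L^-1 * x).
have [c _ hc] := EVT_max (ltW L0) (continuous_subspaceT (cont_norm _ ch)).
have [c1 _ hc1] := EVT_max (ltW L0) (continuous_subspaceT (cont_norm _ ch1)).
have hC x : 0 <= x <= L -> `|h x| <= `|h c| by move=> xL; apply: hc; rewrite in_itv.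
have h1C x : 0 <= x <= L -> `|h1 x| <= `|h1 c1| by move=> xL; apply: hc1; rewrite in_itv.
have xiL n k : (k <= n)%N -> 0 <= xi n k <= L.
  move=> kn; have /andP[a b] := xiP n k.
  by rewrite (le_trans (P_ge0 n k) (ltW a))/= (le_trans (ltW b))// P_le.
have x01 x : 0 <= x <= L -> 0 <= L^-1 * x <= 1.
  move=> /andP[x0 xL]; rewrite mulr_ge0 ?invr_ge0 ?(ltW L0)//=.
  by rewrite mulrC ler_pdivrMr// mul1r.
have approx (F : R -> R) (N : nat -> nat) (z : nat -> nat -> R) C x :
    continuous F -> 0 <= x <= L -> (forall n, (n <= N n)%N) ->
    (forall n k, (k <= N n)%N -> `|F (z n k)| <= C) -> `|F x| <= C ->
    (forall n k, (k <= N n)%N -> `|z n k - P (N n) k| <= L / (N n).+1%:R) ->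
    bern (N n) (fun k => F (z n k)) (L^-1 * x) @[n --> \oo] --> F x.
  move=> cF xL nN FC FxC zP; apply/cvgrPdist_le => e e0.
  have /cvgrPdist_le/(_ (e / 2) (ltac:(by rewrite divr_gt0)))/nbhs_ballP[d /= d0 Hd] := cF x.
  have LxE : L * (L^-1 * x) = x by rewrite mulVKf// gt_eqF.
  have C0 : 0 <= C by exact: le_trans FxC.
  near=> n; rewrite distrC.
  have := @bern_approx R (N n) F (z n) L C d (e / 2) (L^-1 * x) (x01 x xL) d0 L0 (FC n).
  rewrite LxE => /(_ FxC _ (zP n)) h2; apply: le_trans (h2 _) _.
    by move=> u ux; rewrite distrC; apply: Hd; rewrite /ball/= distrC.
  rewrite [leRHS](splitr e) lerD2l ler_pdivrMr//.
  set A := 8 * C * L ^+ 2 / d ^+ 2.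
  have A0 : 0 <= A by rewrite /A; nneg.
  rewrite -ler_pdivrMl ?divr_gt0//; apply: (@le_trans _ _ n%:R); last first.
    by rewrite ler_nat (leq_trans (nN n)).
  by near: n; exact: nbhs_infty_ger.
exists H, H1, `|h1 c1|; split.
- by move=> n; exact: smooth_bern.
- move=> n x; have dL : is_derive x 1 (fun y => L^-1 * y) L^-1 by derE; ring.
  have := der_comp _ _ _ _ _ dL (bern_derive n (fun k => h (P n k)) (L^-1 * x)).
  rewrite (eq_bern n _ (fun k => L / n.+1%:R * h1 (xi n k))) => [|k]; last first.
    by rewrite xiE mulrC.
  rewrite bernZ -/(H1 n x) => D; apply: (der_eq _ _ _ _ D).
  by field; rewrite !gt_eqF.
- move=> n x xL; apply: bern_norm; first exact: x01.
  by move=> k kn; apply: h1C; exact: xiL.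
- by move=> n; rewrite /H mulVf ?gt_eqF// bern1 /P divff ?mulr1// gt_eqF.
- move=> x xL; split.
    apply: (approx h (fun n => n.+1) P `|h c|) => //; last 2 first.
    + by exact: hC.
    (* [H n] has degree [n + 1] and nodes [k / (n + 1)], whereas [bern_approx] refers to a mesh one
       finer than the degree: hence the comparison with [k / (n + 2)]. *)
    + move=> n k kn; rewrite /P -mulrBr normrM (gtr0_norm L0) ler_wpM2l ?(ltW L0)//.
      have e1 : 0 < n.+2%:R :> R by rewrite ltr0n.
      have -> : k%:R / n.+1%:R - k%:R / n.+2%:R = (k%:R / n.+1%:R) / n.+2%:R :> R.
        rewrite -(natr1 n.+1); move: (n.+1%:R : R) (n0 n) => a a0.
        by field; rewrite !gt_eqF// addr_gt0.
      rewrite ger0_norm; last by nneg.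
      rewrite ler_piMl ?invr_ge0 ?(ltW e1)// ler_pdivrMr// mul1r ler_nat//.
    + by move=> n k kn; apply: hC; rewrite P_ge0 P_le.
  apply: (approx h1 id xi `|h1 c1|) => //; last 2 first.
  + exact: h1C.
  + move=> n k kn /=; have /andP[a b] := xiP n k.
    by rewrite ger0_norm ?subr_ge0 ?(ltW a)// -(PS n k) lerD2r ltW.
  + by move=> n k kn; apply: h1C; exact: xiL.
Unshelve. all: by end_near. Qed.

End C1Approximation.

(** * Fubini on rectangles and the integrable weight *)

Section PlaneIntegrals.
Context {R : realType}.
Notation mu := (@lebesgue_measure R).
Notation mu2 := (@lebesgue2 R).
Notation R2 := (measurableTypeR R * measurableTypeR R)%type.
Notation meas2 f := (measurable_fun setT (f : R2 -> R)).

Lemma open_measurable2 (U : set (R * R)) : open U -> measurable (U : set R2).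
Proof.
move=> oU.
pose box (t : rat * rat * rat) : set (R * R) :=
  `]ratr t.1.1 - ratr t.2, ratr t.1.1 + ratr t.2[ `*`
  `]ratr t.1.2 - ratr t.2, ratr t.1.2 + ratr t.2[.
rewrite (_ : U = \bigcup_(t in [set t | box t `<=` U]) box t); last first.
  apply/seteqP; split => [p Up|p [t tU tp]]; last exact: tU.
  have /nbhs_ballP[e /= e0 He] : nbhs p U by apply: open_nbhs_nbhs.
  have [r] := rat_in_itvoo (divr_gt0 e0 (ltr0n R 2)).
  rewrite in_itv/= => /andP[r0 re].
  have lt1 (x : R) : x < x + ratr r by rewrite ltrDl.
  have [a] := rat_in_itvoo (lt1 p.1); rewrite in_itv/= => /andP[a1 a2].
  have [b] := rat_in_itvoo (lt1 p.2); rewrite in_itv/= => /andP[b1 b2].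
  exists (a, b, r).
    move=> z [/=]; rewrite !in_itv/= => /andP[z1 z2] /andP[z3 z4].
    by apply: He; split; rewrite /ball/= ltr_norml; apply/andP; split; lra.
  by split => /=; rewrite in_itv/=; apply/andP; split; lra.
rewrite bigcup_mkcond; apply: countable_bigcupT_measurable => [|t]; first exact: countableP.
case: ifP => // _; apply: measurableX; exact: measurable_itv.
Qed.

Lemma continuous_measurable2 (f : R * R -> R) : continuous f -> meas2 f.
Proof.
move=> /continuousP cf; apply: (measurability _ (RGenOInfty.measurableE R)) => //.
move=> _ [_ [a ->] <-]; rewrite setTI; apply: open_measurable2; apply: cf.
exact: interval_open.
Qed.


Lemma tonelli_rect (A B : set R) (f : R * R -> R) : measurable A -> measurable B ->
  meas2 f -> (forall p, 0 <= f p) ->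
  (\int[mu2]_(p in A `*` B) (f p)%:E = \int[mu]_(x in A) \int[mu]_(y in B) (f (x, y))%:E)%E.
Proof.
move=> mA mB mf f0; rewrite integral_mkcond fubini_tonelli1; last 2 first.
- apply/(measurable_restrictT _ (measurableX mA mB)).
  by apply/measurable_EFinP; exact: measurable_funTS.
- by move=> p; apply: erestrict_ge0 => q _; rewrite lee_fin.
rewrite [RHS]integral_mkcond; apply: eq_integral => x _; rewrite /fubini_F patchE.
case: ifPn => xA.
  rewrite [RHS]integral_mkcond; apply: eq_integral => y _; rewrite !patchE.
  by rewrite in_setX xA.
by rewrite integral0_eq// => y _; rewrite patchE in_setX (negbTE xA).
Qed.

Lemma fubini_rect_fst (A B : set R) (f : R * R -> R) : measurable A -> measurable B ->
  mu2.-integrable (A `*` B) (EFin \o f) ->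
  (\int[mu2]_(p in A `*` B) (f p)%:E = \int[mu]_(x in A) \int[mu]_(y in B) (f (x, y))%:E)%E.
Proof.
move=> mA mB fi; rewrite integral_mkcond -integral12_prod_meas1; last first.
  by apply/integrable_restrict => //; [exact: measurableX|rewrite setTI].
rewrite [RHS]integral_mkcond; apply: eq_integral => x _; rewrite /fubini_F patchE.
case: ifPn => xA.
  rewrite [RHS]integral_mkcond; apply: eq_integral => y _; rewrite !patchE.
  by rewrite in_setX xA.
by rewrite integral0_eq// => y _; rewrite patchE in_setX (negbTE xA).
Qed.

Lemma fubini_rect_snd (A B : set R) (f : R * R -> R) : measurable A -> measurable B ->
  mu2.-integrable (A `*` B) (EFin \o f) ->
  (\int[mu2]_(p in A `*` B) (f p)%:E = \int[mu]_(y in B) \int[mu]_(x in A) (f (x, y))%:E)%E.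
Proof.
move=> mA mB fi; rewrite integral_mkcond -integral21_prod_meas1; last first.
  by apply/integrable_restrict => //; [exact: measurableX|rewrite setTI].
rewrite [RHS]integral_mkcond; apply: eq_integral => y _; rewrite /fubini_G patchE.
case: ifPn => yB.
  rewrite [RHS]integral_mkcond; apply: eq_integral => x _; rewrite !patchE.
  by rewrite in_setX yB andbT.
by rewrite integral0_eq// => x _; rewrite patchE in_setX (negbTE yB) andbF.
Qed.

Lemma measurable_Omega (L : R) : measurable (Omega L : set R2).
Proof. by apply: measurableX; exact: measurable_itv. Qed.

Lemma integrable_powR (s L : R) : 0 < s ->
  mu.-integrable `]0, L[ (fun x => (x `^ (s - 1))%:E).
Proof.
move=> s0; have mp (D : set R) : measurable_fun D (fun x : R => (x `^ (s - 1))%:E : \bar R).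
  by apply/measurable_EFinP; apply: measurable_funTS; exact: measurable_powR.
apply/integrableP; split; first exact: mp.
under eq_integral do rewrite gee0_abs ?lee_fin ?powR_ge0//.
have [L0|L0] := leP L 0.
  by rewrite set_itv_ge ?integral_set0 ?ltry// bnd_simp -leNgt.
(* The integrand may be singular at 0, so the fundamental theorem is applied on segments away from 0
   and followed by monotone convergence. The shift [n.+2] makes even the first segment
   nondegenerate. *)
pose F (n : nat) := `[L / n.+2%:R, L]%classic.
have n0 (n : nat) : 0 < n.+2%:R :> R by rewrite ltr0n.
have Fn n : L / n.+2%:R < L by rewrite ltr_pdivrMr// ltr_pMr// ltr1n.
have cover : `]0, L[ `<=` \bigcup_n F n.
  move=> x /=; rewrite in_itv/= => /andP[x0 xL].
  exists (Num.truncn (L / x)) => //; rewrite /F/= in_itv/= (ltW xL) andbT.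
  rewrite ler_pdivrMr// mulrC -ler_pdivrMr//; apply/ltW.
  by apply: lt_trans (truncnS_gt _) _; rewrite ltr_nat.
have nd : nondecreasing_seq F.
  move=> n m nm; apply/subsetPset => x; rewrite /F/= !in_itv/= => /andP[h ->]; rewrite andbT.
  apply: le_trans h; rewrite ler_wpM2l ?(ltW L0)// lef_pV2 ?posrE//.
  by rewrite ler_nat.
apply: (@le_lt_trans _ _ (\int[mu]_(x in \bigcup_n F n) (x `^ (s - 1))%:E)%E).
  apply: ge0_subset_integral => //.
  - by apply: bigcup_measurable => n _; exact: measurable_itv.
  - exact: mp.
  - by move=> x _; rewrite lee_fin powR_ge0.
apply: (@le_lt_trans _ _ (L `^ s / s)%:E); last exact: ltry.
have cvg : (\int[mu]_(x in F n) (x `^ (s - 1))%:E)%E @[n --> \oo] -->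
    (\int[mu]_(x in \bigcup_n F n) (x `^ (s - 1))%:E)%E.
  apply: ge0_nondecreasing_set_cvg_integral => //.
  - by move=> i; exact: measurable_itv.
  - by move=> i; exact: mp.
  - by move=> i x _; rewrite lee_fin powR_ge0.
rewrite -(cvg_lim _ cvg)//; apply: lime_le; first by apply/cvg_ex; eexists; exact: cvg.
apply: nearW => n.
pose G (x : R) := x `^ s / s.
have p0 (x : R) : L / n.+2%:R <= x -> 0 < x by apply: lt_le_trans; rewrite divr_gt0.
have dG (x : R) : L / n.+2%:R <= x -> is_derive x 1 G (x `^ (s - 1)).
  move=> /p0 x0; have dp := powR_derive s x x0.
  rewrite /G; derE; field; by rewrite gt_eqF.
have cG x : L / n.+2%:R <= x -> {for x, continuous G}.
  by move=> xL; exact: is_derive1_continuous (dG x xL).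
have le1 : L / n.+2%:R <= L by rewrite ltW.
have lexx1 : L / n.+2%:R <= L / n.+2%:R by [].
rewrite (@continuous_FTC2 R _ G _ _ (Fn n)).
- by rewrite -EFinB lee_fin lerBlDr lerDl divr_ge0 ?powR_ge0// ltW.
- apply: continuous_in_subspaceT => x; rewrite inE/= in_itv/= => /andP[xL _].
  by apply: powR_continuous; exact: p0.
- split; first by move=> x; rewrite in_itv/= => /andP[/ltW/dG[]].
    exact: cvg_at_right_filter (cG _ lexx1).
  exact: cvg_at_left_filter (cG _ le1).
- by move=> x; rewrite in_itv/= => /andP[/ltW/dG dx _]; rewrite derive1E; case: dx.
Qed.

(* Dominates all the integrands below, with [s = 2 * nu]. *)
Definition weight (s : R) (p : R * R) : R := 1 + p.1 `^ (s - 1).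

Lemma measurable_weight s : meas2 (weight s).
Proof.
apply: measurable_funD; first exact: measurable_cst.
exact: (@measurableT_comp _ _ _ _ _ _ (@powR R ^~ (s - 1)) _ fst).
Qed.

Lemma weight_ge0 s p : 0 <= weight s p.
Proof. by rewrite /weight; nneg. Qed.

Lemma integrable_weight s L : 0 < s -> mu2.-integrable (Omega L) (EFin \o weight s).
Proof.
move=> s0; apply/integrableP; split.
  by apply/measurable_EFinP; apply: measurable_funTS; exact: measurable_weight.
under eq_integral do rewrite /= ger0_norm ?weight_ge0//.
rewrite /Omega (tonelli_rect _ _ _ (measurable_itv _) (measurable_itv _) (measurable_weight s) (weight_ge0 s)).
rewrite (eq_integral (fun x : measurableTypeR R => (weight s (x, 0))%:E * pi%:E)%E); last first.
  move=> x _; have := @integral_cst _ _ R mu `]0, pi[ (measurable_itv _) (weight s (x, 0))%:E.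
  have E : mu `]0, pi[%classic = pi%:E.
    by rewrite lebesgue_measure_itv/= lte_fin pi_gt0 oppr0 adde0.
  by move=> /= h; apply: etrans h _; congr (_ * _)%E; exact: E.
apply: integrable_lty; first exact: measurable_itv.
apply: integrableZr; first exact: measurable_itv.
have I1 : mu.-integrable `]0, L[ (EFin \o (fun=> 1 : R)).
  apply: integrableS (continuous_integrable (fun=> 1) 0 L (cont_cst 1)) => //.
  exact: subset_itv_oo_cc.
have -> : (fun x => (weight s (x, 0))%:E) = (fun x : R => 1%:E + (x `^ (s - 1))%:E)%E.
  by apply/funext => x; rewrite -EFinD.
apply: integrableD => //; exact: integrable_powR.
Qed.

Lemma integrable_Omega s L C (f : R * R -> R) : 0 < s -> meas2 f ->
  (forall p, Omega L p -> `|f p| <= C * weight s p) -> mu2.-integrable (Omega L) (EFin \o f).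
Proof.
move=> s0 mf fC; apply: le_integrable (integrableZl _ C (integrable_weight s L s0)).
- exact: measurable_Omega.
- by apply/measurable_EFinP; exact: measurable_funTS.
- move=> p Op /=; by rewrite lee_fin (le_trans (fC p Op))// ler_norm.
- exact: measurable_Omega.
Qed.

Lemma dominated_cvg_Omega s L C (F : nat -> R * R -> R) (f : R * R -> R) : 0 < s ->
  (forall n, meas2 (F n)) -> meas2 f -> (forall n p, Omega L p -> `|F n p| <= C * weight s p) ->
  (forall p, Omega L p -> F n p @[n --> \oo] --> f p) ->
  \int[mu2]_(p in Omega L) F n p @[n --> \oo] --> \int[mu2]_(p in Omega L) f p.
Proof.
move=> s0 mF mf FC Ff.
have mO := measurable_Omega L.
have Ff' p : Omega L p -> (F n p)%:E @[n --> \oo] --> (f p)%:E.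
  by move=> Op; apply: cvg_EFin; [exact: nearW|exact: Ff].
have [|||||fi _ cvg] := @dominated_convergence _ R2 R mu2 (Omega L) mO (fun n p => (F n p)%:E)
  (EFin \o f) (fun p => (C%:E * (weight s p)%:E)%E).
- by move=> n; apply/measurable_EFinP; exact: measurable_funTS.
- by apply/measurable_EFinP; exact: measurable_funTS.
- exact: aeW.
- exact: integrableZl (integrable_weight s L s0).
- by apply: aeW => p n Op; rewrite /= lee_fin FC.
apply: fine_cvg; rewrite fineK//; exact: integrable_fin_num.
Qed.

End PlaneIntegrals.

(** * Test functions and the weak form of the eigenvalue equation *)

Section WeakForm.
Context {R : realType}.
Notation mu := (@lebesgue_measure R).
Notation mu2 := (@lebesgue2 R).
Notation R2 := (measurableTypeR R * measurableTypeR R)%type.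
Notation meas2 f := (measurable_fun setT (f : R2 -> R)).

(** Integration by parts without boundary terms: in its uses [P] is a product with a compactly
    supported factor, and [F] the sum given by the product rule. *)
Lemma integral_derive0 (P F : R -> R) (a a1 b1 b : R) : a < a1 -> a1 <= b1 -> b1 < b ->
  (forall x : R, a < x < b -> is_derive x 1 P (F x)) ->
  (forall x : R, a < x < b -> {for x, continuous F}) ->
  (forall x : R, ~~ (a1 <= x <= b1) -> P x = 0 /\ F x = 0) ->
  (\int[mu]_(x in `]a, b[) (F x)%:E = 0)%E.
Proof.
move=> aa1 ab1 b1b dP cF z.
pose c := (a + a1) / 2; pose d := (b1 + b) / 2.
have [ac ca1 b1d db] : [/\ a < c, c < a1, b1 < d & d < b] by rewrite /c /d; split; lra.
have cd : c < d by lra.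
rewrite (_ : (\int[mu]_(x in `]a, b[) (F x)%:E = \int[mu]_(x in `[c, d]) (F x)%:E)%E); last first.
  rewrite integral_mkcond [RHS]integral_mkcond; congr (integral _ _ _).
  apply/funext => x; rewrite !patchE !mem_setE !in_itv/=.
  case: ifPn => h1; case: ifPn => h2 //.
    have [] // := z x; last by move=> _ ->.
    by apply: contra h2 => /andP[h3 h4]; apply/andP; split; lra.
  by case/negP: h1; move/andP: h2 => [h3 h4]; apply/andP; split; lra.
have itv x : x \in `[c, d] -> a < x < b.
  by rewrite in_itv/= => /andP[h3 h4]; apply/andP; split; lra.
have cP x : x \in `[c, d] -> {for x, continuous P}.
  by move=> /itv h; exact: is_derive1_continuous (dP x h).
have Pc : P c = 0 by have [] // := z c; rewrite negb_and -ltNge ca1.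
have Pd : P d = 0 by have [] // := z d; rewrite negb_and -!ltNge b1d orbT.
rewrite (@continuous_FTC2 R F P c d cd).
- by rewrite Pc Pd -EFinB subrr.
- apply: continuous_in_subspaceT => x; rewrite inE => xcd; apply: cF; exact: itv.
- split.
  + by move=> x xcd; have [] := dP x (itv x (subset_itv_oo_cc xcd)).
  + by apply: cvg_at_right_filter; apply: cP; rewrite in_itv/= lexx ltW.
  + by apply: cvg_at_left_filter; apply: cP; rewrite in_itv/= lexx ltW.
- by move=> x xcd; rewrite derive1E; have [] := dP x (itv x (subset_itv_oo_cc xcd)).
Qed.

Lemma compact_subset_box (L : R) (K : set (R * R)) : 0 < L -> compact K -> K `<=` Omega L ->
  exists a1 a2 b1 b2 : R, [/\ 0 < a1, a1 <= a2, a2 < L & [/\ 0 < b1, b1 <= b2, b2 < pi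
    & forall p, K p -> a1 <= p.1 <= a2 /\ b1 <= p.2 <= b2]].
Proof.
move=> L0 cK KO.
have [->|/set0P K0] := eqVneq K set0.
  exists (L / 2), (L / 2), (pi / 2), (pi / 2).
  by have := pi_gt0 R; split; [lra..|split; [lra..|]].
have cfst : {within K, continuous (@fst R R)} by apply: continuous_subspaceT => p; exact: cvg_fst.
have csnd : {within K, continuous (@snd R R)} by apply: continuous_subspaceT => p; exact: cvg_snd.
have [a1 Ka1 H1] := compact_EVT_min K0 cK cfst.
have [a2 Ka2 H2] := compact_EVT_max K0 cK cfst.
have [b1 Kb1 H3] := compact_EVT_min K0 cK csnd.
have [b2 Kb2 H4] := compact_EVT_max K0 cK csnd.
move: Ka1 Ka2 Kb1 Kb2; rewrite !inE => Ka1 Ka2 Kb1 Kb2.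
have O p : K p -> [/\ 0 < p.1, p.1 < L, 0 < p.2 & p.2 < pi].
  by move=> /KO[/=]; rewrite !in_itv/= => /andP[? ?] /andP[? ?].
exists a1.1, a2.1, b1.2, b2.2; split; [by case: (O _ Ka1)| |by case: (O _ Ka2)|split].
- by apply: H1; rewrite inE.
- by case: (O _ Kb1).
- by apply: H3; rewrite inE.
- by case: (O _ Kb2).
- by move=> p Kp; rewrite H1 ?H2 ?H3 ?H4 ?inE.
Qed.

Section TestFunction.
Variables (L : R) (psi : R * R -> R).
Hypotheses (L0 : 0 < L) (tpsi : test_function (Omega L) psi).

Lemma test_function_continuous :
  [/\ continuous psi, continuous (pdx psi) & continuous (pdy psi)].
Proof.
case: tpsi => /(_ 1%N)/= [cp [_ _ [cx _] [cy _]]] _; by split.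
Qed.

Lemma test_function_derive_fst (x y : R) :
  is_derive x 1 (fun s => psi (s, y)) (pdx psi (x, y)).
Proof.
case: tpsi => /(_ 1%N)/= [_ [dx _ _ _]] _; have := dx (x, y).
have E : (fun h : R => h^-1 *: ((psi \o shift (x, y)) (h *: (1, 0)) - psi (x, y))) =
    (fun h : R => h^-1 *: (((fun s => psi (s, y)) \o shift x) (h *: (1 : R)) - psi (x, y))).
  apply/funext => h /=; congr (_ *: (psi _ - _)).
  by apply: injective_projections => //=; rewrite scaler0 add0r.
by rewrite /pdx /derivable /derive E => h; split.
Qed.

Lemma test_function_derive_snd (x y : R) :
  is_derive y 1 (fun s => psi (x, s)) (pdy psi (x, y)).
Proof.
case: tpsi => /(_ 1%N)/= [_ [_ dy _ _]] _; have := dy (x, y).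
have E : (fun h : R => h^-1 *: ((psi \o shift (x, y)) (h *: (0, 1)) - psi (x, y))) =
    (fun h : R => h^-1 *: (((fun s => psi (x, s)) \o shift y) (h *: (1 : R)) - psi (x, y))).
  apply/funext => h /=; congr (_ *: (psi _ - _)).
  by apply: injective_projections => //=; rewrite scaler0 add0r.
by rewrite /pdy /derivable /derive E => h; split.
Qed.

Lemma test_function_support : exists a1 a2 b1 b2 M : R,
  [/\ 0 < a1, a1 <= a2, a2 < L, [/\ 0 < b1, b1 <= b2 & b2 < pi] &
  forall p, [/\ `|psi p| <= M, `|pdx psi p| <= M, `|pdy psi p| <= M &
    ~~ ((a1 <= p.1 <= a2) && (b1 <= p.2 <= b2)) -> [/\ psi p = 0, pdx psi p = 0 & pdy psi p = 0]]].
Proof.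
case: (tpsi) => _ [K [cK KO Kz]].
have [a1 [a2 [b1 [b2 [a10 a12 a2L [b10 b12 b2pi Kbox]]]]]] := compact_subset_box L K L0 cK KO.
have [c0 cx cy] := test_function_continuous.
have near0 p : ~ K p -> \forall z \near p, psi z = 0.
  move=> Kp; have oK : open (~` K) by apply: closed_openC; apply: compact_closed.
  by near=> z; apply: Kz; near: z; exact: open_nbhs_nbhs.
have d0 v p : ~ K p -> 'D_v psi p = 0.
  by move=> Kp; rewrite (@near_eq_derive _ _ _ psi (cst 0) p v (near0 p Kp)) derive_cst.
have bnd (f : R * R -> R) : continuous f -> (forall p, ~ K p -> f p = 0) ->
    exists M : R, forall p, `|f p| <= M.
  move=> cf f0; have [E|/set0P K0] := eqVneq K set0.
    by exists 0 => p; rewrite f0 ?normr0// E.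
  have [c _ Hc] := compact_EVT_max K0 cK (continuous_subspaceT (fun p => cvg_norm (cf p))).
  exists `|f c| => p; have [Kp|Kp] := pselect (K p); last by rewrite f0// normr0.
  by apply: Hc; rewrite inE.
have [M1 H1] := bnd psi c0 (fun p Kp => Kz p Kp).
have [M2 H2] := bnd _ cx (d0 _).
have [M3 H3] := bnd _ cy (d0 _).
exists a1, a2, b1, b2, (Num.max M1 (Num.max M2 M3)); split => // p.
split; [by rewrite le_max H1|by rewrite !le_max H2 orbT|by rewrite !le_max H3 !orbT|].
move=> np; have Kp : ~ K p by move=> /Kbox[h1 h2]; rewrite h1 h2 in np.
by split; [exact: Kz|exact: d0|exact: d0].
Unshelve. all: by end_near. Qed.

End TestFunction.


Lemma integrable_box (L : R) (a1 a2 b1 b2 C : R) (f : R * R -> R) : 0 < a1 -> meas2 f ->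
  (forall p, a1 <= p.1 <= a2 -> b1 <= p.2 <= b2 -> `|f p| <= C) ->
  (forall p, ~~ ((a1 <= p.1 <= a2) && (b1 <= p.2 <= b2)) -> f p = 0) ->
  mu2.-integrable (Omega L) (EFin \o f).
Proof.
move=> a10 mf fC f0; apply: (integrable_Omega 1 L `|C|) => //.
move=> p _; have [|/f0 ->] := boolP ((a1 <= p.1 <= a2) && (b1 <= p.2 <= b2)).
  move=> /andP[h1 h2]; rewrite (le_trans (fC p h1 h2))// (le_trans (ler_norm _))// ler_peMr//.
  by rewrite /weight lerDl powR_ge0.
by rewrite normr0 mulr_ge0// weight_ge0.
Qed.


Lemma meas_fst (f : R -> R) : measurable_fun setT f -> meas2 (fun p => f p.1).
Proof. by move=> mf; exact: (@measurableT_comp _ _ _ _ _ _ f _ fst). Qed.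

Lemma meas_snd (f : R -> R) : measurable_fun setT f -> meas2 (fun p => f p.2).
Proof. by move=> mf; exact: (@measurableT_comp _ _ _ _ _ _ f _ snd). Qed.

Lemma measurable_inv_sqr : measurable_fun setT (fun x : R => (x ^+ 2)^-1).
Proof.
rewrite (_ : (fun x => _) = (fun x : R => `|x| `^ (- 2%:R))); last first.
  by apply/funext => x; rewrite powR_invn// real_normK ?num_real.
exact: (@measurableT_comp _ _ _ _ _ _ (@powR R ^~ (- 2%:R)) _ (@Num.norm _ R)).
Qed.

Lemma norm_mul_le (a b A B : R) : `|a| <= A -> `|b| <= B -> `|a * b| <= A * B.
Proof. by move=> aA bB; rewrite normrM ler_pM. Qed.

Lemma norm_add_le (a b A B : R) : `|a| <= A -> `|b| <= B -> `|a + b| <= A + B.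
Proof. by move=> aA bB; rewrite (le_trans (ler_normD _ _))// lerD. Qed.

Lemma section_fst_continuous (f : R * R -> R) (y : R) : continuous f ->
  continuous (fun x => f (x, y)).
Proof.
move=> cf x; apply: (@continuous_comp _ _ _ (fun x => (x, y)) f); last exact: cf.
exact: (cvg_pair (cvg_id : x0 @[x0 --> x] --> x) (cvg_cst y)).
Qed.

Lemma section_snd_continuous (f : R * R -> R) (x : R) : continuous f ->
  continuous (fun y => f (x, y)).
Proof.
move=> cf y; apply: (@continuous_comp _ _ _ (fun y => (x, y)) f); last exact: cf.
exact: (cvg_pair (cvg_cst x) (cvg_id : y0 @[y0 --> y] --> y)).
Qed.

Lemma segment_bound (f : R -> R) (a b : R) : a <= b ->
  (forall x : R, a <= x <= b -> {for x, continuous f}) ->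
  exists2 C, 0 <= C & forall x, a <= x <= b -> `|f x| <= C.
Proof.
move=> ab cf; have cn : {within `[a, b], continuous (fun x => `|f x|)}.
  apply: continuous_in_subspaceT => x; rewrite inE/= in_itv/= => xab.
  by apply: cvg_norm; exact: cf.
have [c _ Hc] := EVT_max ab cn.
by exists `|f c| => // x xab; apply: Hc; rewrite in_itv.
Qed.

Lemma sin_mul_derive (k y : R) : is_derive y 1 (fun y => sin (k * y)) (k * cos (k * y)).
Proof.
have dc : is_derive y 1 (fun y => k * y) k by derE; ring.
by apply: der_eq (der_comp _ _ _ _ _ dc (is_derive_sin _)) _; rewrite mulrC.
Qed.

Lemma cos_mul_derive (k y : R) : is_derive y 1 (fun y => cos (k * y)) (- (k * sin (k * y))).
Proof.
have dc : is_derive y 1 (fun y => k * y) k by derE; ring.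
by apply: der_eq (der_comp _ _ _ _ _ dc (is_derive_cos _)) _; rewrite mulrC mulrN.
Qed.

Lemma sin_mul_continuous k : continuous (fun y : R => sin (k * y)).
Proof. by move=> y; exact: is_derive1_continuous (sin_mul_derive k y). Qed.

Lemma cos_mul_continuous k : continuous (fun y : R => cos (k * y)).
Proof. by move=> y; exact: is_derive1_continuous (cos_mul_derive k y). Qed.

Section Identity.
Variables (L : R) (n : nat) (lam c : R) (Q g g1 g2 : R -> R) (psi : R * R -> R).
Hypotheses (L0 : 0 < L) (tpsi : test_function (Omega L) psi) (cQ : continuous Q).
Hypotheses (dg : forall x : R, 0 < x -> is_derive x 1 g (g1 x))
  (dg1 : forall x : R, 0 < x -> is_derive x 1 g1 (g2 x))
  (cg2 : forall x : R, 0 < x -> {for x, continuous g2})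
  (mg : measurable_fun setT g) (mg1 : measurable_fun setT g1)
  (ode : forall x : R, 0 < x < L -> g2 x = (n%:R ^+ 2 * Q x - lam + c / x ^+ 2) * g x).

(** The integrand minus [lam] times the integrand on the right is a divergence: [X] is the
    [x]-derivative of [g1 s psi] and [Y] the [y]-derivative of [Q g s1 psi]. Each integrates to 0 by
    Fubini with its own variable innermost. The support of [psi] stays away from [x = 0], so the
    singular coefficients are bounded on it. *)
Lemma weak_form :
  \int[mu2]_(p in Omega L)
    (g1 p.1 * sin (n%:R * p.2) * pdx psi p + Q p.1 * (g p.1 * (n%:R * cos (n%:R * p.2)) * pdy psi p)
     + c / p.1 ^+ 2 * (g p.1 * sin (n%:R * p.2) * psi p))
  = lam * \int[mu2]_(p in Omega L) (g p.1 * sin (n%:R * p.2) * psi p).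
Proof.
have [a1 [a2 [b1 [b2 [M [a10 a12 a2L [b10 b12 b2pi] sup]]]]]] := test_function_support L psi L0 tpsi.
have [c0 cx cy] := test_function_continuous L psi tpsi.
pose N : R := n%:R; pose s y := sin (N * y); pose s1 y := N * cos (N * y).
(* It agrees with [g2] on []0, L[], and its formula makes it measurable on the whole line. *)
pose G2 x := (N ^+ 2 * Q x - lam + c / x ^+ 2) * g x.
have cg (x : R) : 0 < x -> {for x, continuous g} by move=> x0; exact: is_derive1_continuous (dg x x0).
have cg1 (x : R) : 0 < x -> {for x, continuous g1} by move=> x0; exact: is_derive1_continuous (dg1 x x0).
have cG2 (x : R) : 0 < x < L -> {for x, continuous G2}.
  move=> /andP[x0 xL]; apply: near_eq_continuous (cg2 x x0).
  near=> y; rewrite /G2 -ode//; apply/andP; split; near: y; [exact: lt_nbhsr|exact: lt_nbhsl].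
have cs : continuous s by exact: sin_mul_continuous.
have cs1 : continuous s1 by apply: contM; [exact: cont_cst|exact: cos_mul_continuous].
have ax (x : R) : a1 <= x <= a2 -> 0 < x < L.
  by move=> /andP[h1 h2]; rewrite (lt_le_trans a10)//= (le_lt_trans h2).
have [Cg Cg0 HCg] := segment_bound g a1 a2 a12 (fun x xa => cg x (andP (ax x xa)).1).
have [Cg1 Cg10 HCg1] := segment_bound g1 a1 a2 a12 (fun x xa => cg1 x (andP (ax x xa)).1).
have [Cg2 Cg20 HCg2] := segment_bound G2 a1 a2 a12 (fun x xa => cG2 x (ax x xa)).
have [CQ CQ0 HCQ] := segment_bound Q a1 a2 a12 (fun x _ => cQ x).
have s_le y : `|s y| <= 1 by rewrite ler_norml sin_geN1 sin_le1.
have s1_le y : `|s1 y| <= N.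
  by rewrite normrM ger0_norm ?ler0n// ler_piMr ?ler0n// ler_norml cos_geN1 cos_le1.
have M0 : 0 <= M by have [h _ _ _] := sup (0, 0); apply: le_trans h.
pose X p := g1 p.1 * s p.2 * pdx psi p + G2 p.1 * s p.2 * psi p.
pose Y p := Q p.1 * (g p.1 * s1 p.2 * pdy psi p - g p.1 * (N ^+ 2 * s p.2) * psi p).
pose Z p := g p.1 * s p.2 * psi p.
have ms := meas_snd s (continuous_measurable_fun cs).
have ms1 := meas_snd s1 (continuous_measurable_fun cs1).
have mQ := meas_fst Q (continuous_measurable_fun cQ).
have m0 := continuous_measurable2 psi c0.
have mx := continuous_measurable2 (pdx psi) cx.
have my := continuous_measurable2 (pdy psi) cy.
have mg' := meas_fst g mg; have mg1' := meas_fst g1 mg1.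
have mG2 : meas2 (fun p => G2 p.1).
  apply: meas_fst; rewrite /G2; apply: measurable_funM => //; apply: measurable_funD.
    apply: measurable_funB => //; apply: measurable_funM => //.
    exact: continuous_measurable_fun.
  by apply: measurable_funM => //; exact: measurable_inv_sqr.
have mX : meas2 X.
  exact: measurable_funD (measurable_funM (measurable_funM mg1' ms) mx)
    (measurable_funM (measurable_funM mG2 ms) m0).
have mY : meas2 Y.
  apply: measurable_funM mQ (measurable_funB (measurable_funM (measurable_funM mg' ms1) my)
    (measurable_funM (measurable_funM mg' _) m0)).
  exact: (measurable_funM (measurable_cst _) ms).
have mZ : meas2 Z by exact: measurable_funM (measurable_funM mg' ms) m0.
have iX : mu2.-integrable (Omega L) (EFin \o X).
  apply: (integrable_box L a1 a2 b1 b2 (Cg1 * 1 * M + Cg2 * 1 * M)) => //.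
    move=> p h1 h2; have [h3 h4 _ _] := sup p.
    apply: norm_add_le; (apply: norm_mul_le => //; apply: norm_mul_le => //).
      exact: HCg1.
    exact: HCg2.
  by move=> p np; have [_ _ _ /(_ np)[z1 z2 _]] := sup p; rewrite /X z1 z2 !mulr0 addr0.
have iY : mu2.-integrable (Omega L) (EFin \o Y).
  apply: (integrable_box L a1 a2 b1 b2 (CQ * (Cg * N * M + Cg * (`|N ^+ 2| * 1) * M))) => //.
    move=> p h1 h2; have [h3 _ h5 _] := sup p.
    apply: norm_mul_le; first exact: HCQ.
    apply: norm_add_le; first by apply: norm_mul_le => //; apply: norm_mul_le => //; exact: HCg.
    rewrite normrN; apply: norm_mul_le => //; apply: norm_mul_le => //; first exact: HCg.
    exact: norm_mul_le.
  by move=> p np; have [_ _ _ /(_ np)[z1 _ z3]] := sup p; rewrite /Y z1 z3 !mulr0 subrr mulr0.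
have iZ : mu2.-integrable (Omega L) (EFin \o Z).
  apply: (integrable_box L a1 a2 b1 b2 (Cg * 1 * M)) => //.
    move=> p h1 h2; have [h3 _ _ _] := sup p.
    by apply: norm_mul_le => //; apply: norm_mul_le => //; exact: HCg.
  by move=> p np; have [_ _ _ /(_ np)[z1 _ _]] := sup p; rewrite /Z z1 mulr0.
have X0 : \int[mu2]_(p in Omega L) X p = 0.
  rewrite /Rintegral /Omega fubini_rect_snd//.
  rewrite integral0_eq// => y _.
  refine (integral_derive0 (fun x => g1 x * s y * psi (x, y)) (fun x => X (x, y)) 0 a1 a2 L a10 a12 a2L _ _ _).
  - move=> x x0L; have dx := test_function_derive_fst L psi tpsi x y.
    have d1 := dg1 x (andP x0L).1.
    derE; rewrite /X /= /G2 -ode//; ring.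
  - move=> x x0L; have x0 := (andP x0L).1.
    apply: cvgD; (apply: cvgM; last exact: section_fst_continuous).
      by apply: cvgM; [exact: cg1|exact: (cvg_cst (s y))].
    by apply: cvgM; [exact: cG2|exact: (cvg_cst (s y))].
  - move=> x nx; have [_ _ _ H] := sup (x, y); rewrite /X /=.
    by have [|-> -> _] := H; [rewrite negb_and nx|rewrite !mulr0 addr0].
have Y0 : \int[mu2]_(p in Omega L) Y p = 0.
  rewrite /Rintegral /Omega fubini_rect_fst//.
  rewrite integral0_eq// => x _.
  refine (integral_derive0 (fun y => Q x * (g x * s1 y * psi (x, y))) (fun y => Y (x, y)) 0 b1 b2 pi b10 b12 b2pi _ _ _).
  - move=> y y0; have dy := test_function_derive_snd L psi tpsi x y.
    have dc := cos_mul_derive N y.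
    by rewrite /s1; derE; rewrite /Y /s /s1 /=; ring.
  - have cpy := section_snd_continuous (pdy psi) x cy.
    have cp := section_snd_continuous psi x c0.
    have cY : continuous (fun y => Q x * (g x * s1 y * pdy psi (x, y) -
        g x * (N ^+ 2 * s y) * psi (x, y))) by cont.
    by move=> y _; exact: cY.
  - move=> y ny; have [_ _ _ H] := sup (x, y); rewrite /Y /=.
    by have [|-> _ ->] := H; [rewrite negb_and ny orbT|rewrite !mulr0 subrr mulr0].
have mO := measurable_Omega L.
rewrite (_ : \int[mu2]_(p in Omega L) _ = \int[mu2]_(p in Omega L) ((X p + Y p) + lam * Z p)); last first.
  by apply: eq_Rintegral => p _; rewrite /X /Y /Z /G2 -/N -/(s p.2) -/(s1 p.2); ring.
have iXY : mu2.-integrable (Omega L) (EFin \o (fun p => X p + Y p)) by have := integrableD mO iX iY.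
have ilZ : mu2.-integrable (Omega L) (EFin \o (fun p => lam * Z p)) by have := integrableZl mO lam iZ.
by rewrite (RintegralD mO iXY ilZ) (RintegralD mO iX iY) X0 Y0 !add0r (RintegralZl _ mO iZ).
Unshelve. all: by end_near. Qed.

End Identity.

End WeakForm.

(** * Explicit cut-offs and the approximation of each tensor factor *)

Section Approximants.
Context {R : realType}.
Implicit Types (x y k r L : R) (n : nat).

Lemma cvg_inv_bound (u : nat -> R) (l C : R) (N : nat) :
  (forall n, (N <= n)%N -> `|u n - l| <= C / n.+1%:R) -> u n @[n --> \oo] --> l.
Proof.
move=> H; apply/cvgrPdist_le => e e0; near=> n; rewrite distrC.
apply: le_trans (H n _) _; first by near: n; exact: nbhs_infty_ge.
rewrite ler_pdivrMr ?ltr0n// -ler_pdivrMl//; apply: (@le_trans _ _ n%:R).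
  by near: n; exact: nbhs_infty_ger.
by rewrite ler_nat.
Unshelve. all: by end_near. Qed.

Definition cut k x : R := flat k 0 0 x.
Definition dcut k x : R := k * flat k 2 0 x.

Lemma cutE k x : cut k x = if 1 < k * x then expR (- (k * x - 1)^-1) else 0.
Proof. by rewrite /cut /flat powRr0 mulr1 expr0 invr1 mul1r. Qed.

Lemma flatE k j r x : flat k j r x = flat k j 0 x * x `^ r.
Proof. by rewrite /flat; case: ifP => _; rewrite ?mul0r// powRr0 mulr1. Qed.

Lemma cut_derive k x : 0 < k -> is_derive x 1 (cut k) (dcut k x).
Proof.
by move=> k0; apply: der_eq (flat_derive k 0 0 x k0) _; rewrite /dcut; ring.
Qed.

Lemma cut_ge0 k x : 0 <= cut k x.
Proof. by rewrite cutE; case: ifP => // _; exact: expR_ge0. Qed.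

Lemma cut_le1 k x : cut k x <= 1.
Proof.
rewrite cutE; case: ifP => // kx; rewrite -[leRHS]expR0 ler_expR oppr_le0 invr_ge0.
by rewrite subr_ge0 ltW.
Qed.

Lemma cut0 k x : k * x <= 1 -> cut k x = 0.
Proof. by move=> kx; rewrite cutE ltNge kx. Qed.

Lemma dcut0 k x : k * x <= 1 -> dcut k x = 0.
Proof. by move=> kx; rewrite /dcut /flat ltNge kx mulr0. Qed.

Lemma dcutE k x : 1 < k * x -> dcut k x = k * ((k * x - 1) ^- 2 * expR (- (k * x - 1)^-1)).
Proof. by move=> kx; rewrite /dcut /flat kx powRr0 mulr1. Qed.

(** With [z = k * x - 1], the product [x * dcut k x] is [(z^-1 + z^-2) * expR (- z^-1)], at most
    [1! + 2!]. The bound is uniform in [k]: differentiating the cut-off costs only a factor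
    [1 / x]. *)
Lemma dcut_bound k x : 0 < k -> 0 < x -> `|dcut k x| <= 3 / x.
Proof.
move=> k0 x0; have [kx|kx] := leP (k * x) 1; first by rewrite dcut0// normr0; nneg.
have z0 : 0 < k * x - 1 by rewrite subr_gt0.
rewrite dcutE// ger0_norm; last by nneg.
rewrite ler_pdivlMr//.
have h1 := expRN_inv_le 1 _ z0; have h2 := expRN_inv_le 2 _ z0.
rewrite [X in X <= _](_ : _ = (k * x - 1) ^- 1 * expR (- (k * x - 1)^-1) +
  (k * x - 1) ^- 2 * expR (- (k * x - 1)^-1)); last first.
  by move: (expR _) => e; field; rewrite gt_eqF.
by move: h1 h2; rewrite /factorial /= => h1 h2; lra.
Qed.

Lemma cut_cvg x : 0 < x ->
  cut n.+1%:R x @[n --> \oo] --> (1 : R) /\ dcut n.+1%:R x @[n --> \oo] --> (0 : R).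
Proof.
move=> x0; pose N := Num.truncn (2 / x).
have HN n : (N <= n)%N -> n.+1%:R * x / 2 <= n.+1%:R * x - 1 /\ 2 <= n.+1%:R * x.
  move=> Nn; have h : 2 / x <= n.+1%:R.
    by apply/ltW; apply: lt_le_trans (truncnS_gt _) _; rewrite ler_nat ltnS.
  by move: h; rewrite ler_pdivrMr// => h; split; lra.
split.
  apply: (cvg_inv_bound _ _ (2 / x) N) => n /HN[h1 h2].
  have n0 : 0 < n.+1%:R :> R by rewrite ltr0n.
  have z0 : 0 < n.+1%:R * x - 1 by lra.
  rewrite distrC ger0_norm ?subr_ge0 ?cut_le1// cutE ifT; last by lra.
  have := expR_ge1Dx (- (n.+1%:R * x - 1)^-1).
  have : (n.+1%:R * x - 1)^-1 <= 2 / x / n.+1%:R.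
    rewrite -[leRHS]invrK lef_pV2 ?posrE ?invr_gt0 ?divr_gt0//.
    by rewrite [leLHS](_ : _ = n.+1%:R * x / 2)//; field; rewrite !gt_eqF.
  by move=> h3 h4; apply: le_trans h3; rewrite lerBlDl; move: h4; rewrite lerBlDr.
apply: (cvg_inv_bound _ _ (4 / x ^+ 2) N) => n /HN[h1 h2].
have n0 : 0 < n.+1%:R :> R by rewrite ltr0n.
have z0 : 0 < n.+1%:R * x - 1 by lra.
have kx : 1 < n.+1%:R * x by lra.
rewrite subr0 dcutE// ger0_norm; last by nneg.
apply: (@le_trans _ _ (n.+1%:R * (n.+1%:R * x / 2) ^- 2)).
  apply: ler_wpM2l; first exact: ltW.
  apply: (@le_trans _ _ ((n.+1%:R * x - 1) ^- 2)).
    rewrite ler_piMr//; first by nneg.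
    by rewrite -[leRHS]expR0 ler_expR oppr_le0 invr_ge0 ltW.
  rewrite lef_pV2 ?posrE ?exprn_gt0 ?divr_gt0 ?mulr_gt0//.
  by rewrite ler_pXn2r ?nnegrE//; nneg; exact: mulr_ge0.
by rewrite le_eqVlt; apply/orP; left; apply/eqP; field; rewrite !gt_eqF.
Qed.

(* [bump L k] is a C^oo function supported in [[1/k, L - 1/k]] that converges to 1 on ]0, L[. *)
Definition bump L k x : R := cut k x * cut k (L - x).
Definition dbump L k x : R := dcut k x * cut k (L - x) - cut k x * dcut k (L - x).

Lemma bump_derive L k x : 0 < k -> is_derive x 1 (bump L k) (dbump L k x).
Proof.
move=> k0; have d1 := cut_derive k x k0.
have dL : is_derive x 1 (fun y => L - y) (- 1) by derE; ring.
have d2 := der_comp (fun y => L - y) _ x _ _ dL (cut_derive k (L - x) k0).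
by rewrite /bump; derE; rewrite /dbump; ring.
Qed.

Lemma bump_bound L k x : `|bump L k x| <= 1.
Proof.
by rewrite ger0_norm ?mulr_ge0 ?cut_ge0// mulr_ile1 ?cut_ge0 ?cut_le1.
Qed.

Lemma dbump_bound L k x : 0 < k -> 0 < x < L -> `|dbump L k x| <= 3 / x + 3 / (L - x).
Proof.
move=> k0 /andP[x0 xL]; have Lx : 0 < L - x by rewrite subr_gt0.
have b y : `|cut k y| <= 1 by rewrite ger0_norm ?cut_ge0 ?cut_le1.
apply: norm_add_le.
  by rewrite -[3 / x]mulr1; apply: norm_mul_le; [exact: dcut_bound|exact: b].
rewrite normrN -[3 / (L - x)]mul1r; apply: norm_mul_le; [exact: b|exact: dcut_bound].
Qed.

Lemma bump_cvg L x : 0 < x < L ->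
  bump L n.+1%:R x @[n --> \oo] --> (1 : R) /\ dbump L n.+1%:R x @[n --> \oo] --> (0 : R).
Proof.
move=> /andP[x0 xL]; have Lx : 0 < L - x by rewrite subr_gt0.
have [c1 d1] := cut_cvg x x0; have [c2 d2] := cut_cvg (L - x) Lx; split.
  have h := cvgM c1 c2; rewrite mulr1 in h; exact: h.
have h := cvgB (cvgM d1 c2) (cvgM c1 d2); rewrite mul0r mulr0 subrr in h; exact: h.
Qed.

Lemma bump0 L k x : 0 < k -> ~~ (k^-1 <= x <= L - k^-1) -> bump L k x = 0 /\ dbump L k x = 0.
Proof.
move=> k0; rewrite negb_and -!ltNge => /orP[xk|xk].
  have kx : k * x <= 1 by rewrite mulrC -ler_pdivlMr// mul1r ltW.
  by rewrite /bump /dbump cut0// dcut0// !mul0r subrr.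
have kx : k * (L - x) <= 1 by rewrite mulrC -ler_pdivlMr// mul1r; lra.
by rewrite /bump /dbump (cut0 _ (L - x))// (dcut0 _ (L - x))// !mulr0 subrr.
Qed.

Lemma smooth_cut_refl L k : 0 < k -> smooth (fun x => cut k (L - x)).
Proof. by move=> k0; apply: smooth_refl; exact: smooth_flat. Qed.

(** The bounds have to be uniform in [n], although [dbump] is only bounded by [3 / x + 3 / (L - x)].
    The first term turns [x]^ r[into]x [^ (r - 1)]; the second is compensated by
    [|H n x| <= C * (L - x)], valid because [H n] vanishes at [L] together with [h]. *)
Lemma approx_fst (L r : R) (h h1 : R -> R) : 0 < L -> continuous h -> continuous h1 ->
  (forall x : R, 0 < x -> is_derive x 1 h (h1 x)) -> h L = 0 ->
  exists (al al1 : nat -> R -> R) (C : R), [/\ 0 <= C, forall n, smooth (al n),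
    forall n (x : R), 0 < x -> is_derive x 1 (al n) (al1 n x),
    forall n x, ~~ (n.+1%:R^-1 <= x <= L - n.+1%:R^-1) -> al n x = 0 &
    forall x, 0 < x < L -> [/\ forall n, `|al n x| <= C * x `^ r,
      forall n, `|al1 n x| <= C * x `^ (r - 1),
      al n x @[n --> \oo] --> x `^ r * h x &
      al1 n x @[n --> \oo] --> r * x `^ (r - 1) * h x + x `^ r * h1 x]].
Proof.
move=> L0 ch ch1 dh hL.
have [H [H1 [C [sH dH H1C HL Hcvg]]]] := C1_approx h h1 L L0 ch ch1 dh.
have C0 : 0 <= C by apply: le_trans (H1C 0%N L _) => //; rewrite lexx ltW.
have n0 n : 0 < n.+1%:R :> R by rewrite ltr0n.
have HB n x : 0 <= x <= L -> `|H n x| <= C * (L - x).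
  move=> /andP[x0 xL]; have [c cxL E] := @MVT_segment R (H n) (H1 n) x L xL
    (fun y _ => dH n y) (continuous_subspaceT (fun y => is_derive1_continuous _ _ _ (dH n y))).
  have : `|H n L - H n x| <= C * (L - x).
    rewrite E normrM (ger0_norm (_ : 0 <= L - x)) ?subr_ge0// ler_wpM2r ?subr_ge0//.
    by apply: H1C; move: cxL; rewrite in_itv/= => /andP[h2 ->]; rewrite (le_trans x0).
  by rewrite HL hL sub0r normrN.
pose al n x := flat n.+1%:R 0 r x * cut n.+1%:R (L - x) * H n x.
pose al1 n x := dbump L n.+1%:R x * (x `^ r * H n x)
  + bump L n.+1%:R x * (r * x `^ (r - 1) * H n x + x `^ r * H1 n x).
have alE n x : al n x = bump L n.+1%:R x * (x `^ r * H n x).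
  by rewrite /al flatE /bump /cut; ring.
exists al, al1, (C * (7 + `|r|) * L + C * L); split.
- by nneg.
- move=> n; apply: smoothM => //; apply: smoothM; first exact: smooth_flat.
  exact: smooth_cut_refl.
- move=> n x x0; rewrite (_ : al n = (fun x => bump L n.+1%:R x * (x `^ r * H n x))); last first.
    by apply/funext => y; exact: alE.
  have d1 := bump_derive L _ x (n0 n); have d2 := powR_derive r x x0; have d3 := dH n x.
  by derE; rewrite /al1; ring.
- by move=> n x nx; rewrite alE; have [-> _] := bump0 L _ x (n0 n) nx; rewrite mul0r.
- move=> x xL; have /andP[x0 xL'] := xL; have Lx : 0 < L - x by rewrite subr_gt0.
  have xL2 : 0 <= x <= L by rewrite !ltW.
  have [c1 d1] := bump_cvg L x xL; have [cH cH1] := Hcvg x xL2.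
  have P0 : 0 <= x `^ r by exact: powR_ge0.
  have P1 : 0 <= x `^ (r - 1) by exact: powR_ge0.
  have PE : x `^ r = x * x `^ (r - 1).
    by rewrite powRB ?(gt_eqF x0) ?implybT// powRr1 ?(ltW x0)//; field; rewrite gt_eqF.
  have HB' n : `|H n x| <= C * L.
    by apply: le_trans (HB n x xL2) _; rewrite ler_wpM2l// lerBlDr lerDl ltW.
  split.
  + move=> n; rewrite alE -[leRHS]mul1r; apply: norm_mul_le; first exact: bump_bound.
    rewrite mulrC; apply: norm_mul_le; last by rewrite ger0_norm.
    by apply: le_trans (HB' n) _; rewrite lerDr; nneg.
  + move=> n; have D := dbump_bound L _ x (n0 n) xL.
    have t1 : `|dbump L n.+1%:R x * (x `^ r * H n x)| <= C * 6 * L * x `^ (r - 1).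
      apply: (@le_trans _ _ ((3 / x + 3 / (L - x)) * (x `^ r * (C * (L - x))))).
        apply: norm_mul_le => //; apply: norm_mul_le; first by rewrite ger0_norm.
        exact: HB.
      rewrite PE [leLHS](_ : _ = C * (3 * (L - x) + 3 * x) * x `^ (r - 1)); last first.
        by field; rewrite !gt_eqF.
      by rewrite ler_wpM2r// -mulrA ler_wpM2l//; lra.
    have t2 : `|bump L n.+1%:R x * (r * x `^ (r - 1) * H n x + x `^ r * H1 n x)|
        <= C * (1 + `|r|) * L * x `^ (r - 1).
      apply: (@le_trans _ _ (1 * (`|r| * x `^ (r - 1) * (C * L) + x `^ r * C))).
        apply: norm_mul_le; first exact: bump_bound.
        apply: norm_add_le.
          by apply: norm_mul_le => //; apply: norm_mul_le => //; rewrite ger0_norm.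
        by apply: norm_mul_le; [rewrite ger0_norm|exact: H1C].
      rewrite PE -subr_ge0 [X in 0 <= X](_ : _ = C * (L - x) * x `^ (r - 1)); last by ring.
      by nneg.
    apply: le_trans (norm_add_le _ _ _ _ t1 t2) _.
    rewrite -mulrDl ler_wpM2r//.
    rewrite -subr_ge0 [X in 0 <= X](_ : _ = C * L); last by ring.
    by nneg.
  + rewrite (_ : al ^~ x = fun n => bump L n.+1%:R x * (x `^ r * H n x)); last first.
      by apply/funext => n; exact: alE.
    rewrite -[X in _ --> X]mul1r; apply: cvgM => //; apply: cvgM => //; exact: cvg_cst.
  + rewrite -[X in _ --> X]add0r -[X in _ --> X + _](mul0r (x `^ r * h x)) -[X in _ --> _ + X]mul1r.
    apply: cvgD; apply: cvgM => //; first by apply: cvgM => //; exact: cvg_cst.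
    by apply: cvgD; apply: cvgM => //; exact: cvg_cst.
Qed.

Lemma sin_nat_pi n : sin (n%:R * pi) = 0 :> R.
Proof.
elim: n => [|n IH]; first by rewrite mul0r sin0.
by rewrite -natr1 mulrDl mul1r sinDpi IH oppr0.
Qed.

(** Here the compensation takes place at both ends: [|sin (n * y)|] is at most [n] times the
    distance of [y] to 0 and to [pi]. *)
Lemma approx_snd n : exists (be be1 : nat -> R -> R) (C : R), [/\ 0 <= C, forall k : nat, smooth (be k),
    forall (k : nat) (y : R), is_derive y 1 (be k) (be1 k y),
    forall (k : nat) y, ~~ (k.+1%:R^-1 <= y <= pi - k.+1%:R^-1) -> be k y = 0 &
    forall y, 0 < y < pi -> [/\ forall k : nat, `|be k y| <= C, forall k : nat, `|be1 k y| <= C,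
      be k y @[k --> \oo] --> sin (n%:R * y) &
      be1 k y @[k --> \oo] --> n%:R * cos (n%:R * y)]].
Proof.
pose N : R := n%:R; pose s y := sin (N * y); pose s1 y := N * cos (N * y).
have N0 : 0 <= N by rewrite /N ler0n.
have k0 (k : nat) : 0 < k.+1%:R :> R by rewrite ltr0n.
have s1N y : `|s1 y| <= N * 1.
  by apply: norm_mul_le; [rewrite ger0_norm|rewrite ler_norml cos_geN1 cos_le1].
have sL x y : x <= y -> `|s y - s x| <= N * (y - x).
  move=> xy; have [c _ E] := @MVT_segment R s s1 x y xy (fun y _ => sin_mul_derive N y)
    (continuous_subspaceT (sin_mul_continuous N)).
  rewrite E normrM (ger0_norm (_ : 0 <= y - x)) ?subr_ge0// ler_wpM2r ?subr_ge0//.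
  by rewrite -[N]mulr1.
exists (fun (k : nat) y => bump pi k.+1%:R y * s y),
  (fun (k : nat) y => dbump pi k.+1%:R y * s y + bump pi k.+1%:R y * s1 y), (7 * N + 1); split.
- by nneg.
- move=> k; apply: smoothM; last exact: smooth_sin.
  by apply: smoothM; [exact: smooth_flat|exact: smooth_cut_refl].
- move=> k y; have d1 := bump_derive pi _ y (k0 k); have d2 := sin_mul_derive N y.
  by rewrite /s; derE; rewrite /s1 /s; ring.
- by move=> k y ny; have [-> _] := bump0 pi _ y (k0 k) ny; rewrite mul0r.
- move=> y yp; have /andP[y0 yp'] := yp; have py : 0 < pi - y by rewrite subr_gt0.
  have [c1 d1] := bump_cvg pi y yp.
  have a1 : `|s y| <= N * y.
    by have := sL 0 y (ltW y0); rewrite /s mulr0 sin0 !subr0.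
  have a2 : `|s y| <= N * (pi - y).
    by have := sL y pi (ltW yp'); rewrite /s sin_nat_pi sub0r normrN.
  have sy1 : `|s y| <= 1 by rewrite ler_norml sin_geN1 sin_le1.
  split.
  + move=> k; apply: (@le_trans _ _ (1 * 1)); first exact: norm_mul_le (bump_bound _ _ _) sy1.
    by rewrite mul1r lerDr mulr_ge0.
  + move=> k; apply: (@le_trans _ _ (6 * N + 1 * (N * 1))); last by lra.
    apply: norm_add_le; last exact: norm_mul_le (bump_bound _ _ _) (s1N y).
    rewrite /dbump mulrBl (_ : 6 * N = 3 * N + 3 * N); last by ring.
    have b z : `|cut k.+1%:R z| <= 1 by rewrite ger0_norm ?cut_ge0 ?cut_le1.
    apply: norm_add_le.
      apply: (@le_trans _ _ (3 / y * 1 * (N * y))).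
        by do 2 apply: norm_mul_le => //; exact: dcut_bound.
      by rewrite le_eqVlt; apply/orP; left; apply/eqP; field; rewrite gt_eqF.
    rewrite normrN; apply: (@le_trans _ _ (1 * (3 / (pi - y)) * (N * (pi - y)))).
      by do 2 apply: norm_mul_le => //; exact: dcut_bound.
    move: (pi - y) py => z z0; rewrite le_eqVlt; apply/orP; left; apply/eqP.
    by field; rewrite gt_eqF.
  + by rewrite -[X in _ --> X]mul1r; apply: cvgM => //; exact: cvg_cst.
  + rewrite -[X in _ --> X]add0r -[X in _ --> X + _](mul0r (s y)) -[X in _ --> _ + X]mul1r.
    by apply: cvgD; apply: cvgM => //; exact: cvg_cst.
Qed.

End Approximants.

(** * Square integrable functions *)

Section L2Facts.
Context {R : realType}.
Notation mu := (@lebesgue_measure R).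
Notation mu2 := (@lebesgue2 R).
Notation R2 := (measurableTypeR R * measurableTypeR R)%type.
Variables (D : set (R * R)).
Hypothesis mD : measurable (D : set R2).
Implicit Types (u v w : R * R -> R).

Lemma L2_integrable_sqr u : L2 D u -> mu2.-integrable D (fun p => ((u p) ^+ 2)%:E).
Proof.
move=> [mu_ nu_]; apply/integrableP; split.
  by apply/measurable_EFinP; exact: measurable_funX.
by under eq_integral do rewrite gee0_abs ?lee_fin ?sqr_ge0//.
Qed.

Lemma normsqE u : L2 D u -> normsq D u = (\int[mu2]_(p in D) (u p) ^+ 2)%:E.
Proof.
by move=> Lu; rewrite /Rintegral fineK//; apply: integrable_fin_num => //; exact: L2_integrable_sqr.
Qed.

Lemma L2_integrable_mul u v : L2 D u -> L2 D v -> mu2.-integrable D (EFin \o (fun p => u p * v p)).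
Proof.
move=> Lu Lv.
apply: le_integrable (integrableD mD (L2_integrable_sqr u Lu) (L2_integrable_sqr v Lv)) => //.
  by apply/measurable_EFinP; apply: measurable_funM; [case: Lu|case: Lv].
move=> p _; rewrite /= lee_fin [leRHS]ger0_norm ?addr_ge0 ?sqr_ge0//.
rewrite normrM -[X in _ <= X + _]real_normK ?num_real// -[X in _ <= _ + X]real_normK ?num_real//.
have := sqr_ge0 (`|u p| - `|v p|); have := mulr_ge0 (normr_ge0 (u p)) (normr_ge0 (v p)).
by rewrite sqrrB => h1 h2; lra.
Qed.

Lemma L2B u v : L2 D u -> L2 D v -> L2 D (u \- v).
Proof.
move=> Lu Lv; split; first by apply: measurable_funB; [case: Lu|case: Lv].
have iu := integrableZl mD 2 (L2_integrable_sqr u Lu).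
have iv := integrableZl mD 2 (L2_integrable_sqr v Lv).
have iuv := integrableD mD iu iv.
apply: (@le_lt_trans _ _ (\int[mu2]_(p in D) (2%:E * ((u p) ^+ 2)%:E + 2%:E * ((v p) ^+ 2)%:E))%E); last first.
  by have := integrable_lty mD iuv.
apply: ge0_le_integral => //.
- by move=> p _; rewrite lee_fin sqr_ge0.
- apply/measurable_EFinP; apply: measurable_funX; apply: measurable_funB; [by case: Lu|by case: Lv].
- by have := measurable_int _ iuv.
- move=> p _; rewrite lee_fin /=; have := sqr_ge0 (u p + v p); rewrite sqrrB sqrrD => h; lra.
Qed.

Lemma normsqZ c u : measurable_fun D (u : R2 -> R) ->
  normsq D (fun p => c * u p) = ((c ^+ 2)%:E * normsq D u)%E.
Proof.
move=> mu_; rewrite /normsq -ge0_integralZl//; last 3 first.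
- by apply/measurable_EFinP; exact: measurable_funX.
- by move=> p _; rewrite lee_fin sqr_ge0.
- by rewrite lee_fin sqr_ge0.
by apply: eq_integral => p _; rewrite exprMn EFinM.
Qed.

Lemma inner_cvg u v (w : nat -> R * R -> R) : L2 D u -> L2 D v -> (forall n, L2 D (w n)) ->
  normsq D (w n \- v) @[n --> \oo] --> 0%E -> inner D u (w n) @[n --> \oo] --> inner D u v.
Proof.
move=> Lu Lv Lw; have Ld n := L2B _ _ (Lw n) Lv.
under eq_fun do rewrite (normsqE _ (Ld _)).
move=> /fine_cvgP[_]; rewrite /= => cw.
have {cw} : (\int[mu2]_(p in D) ((w n \- v) p) ^+ 2) @[n --> \oo] --> (0 : R) by exact: cw.
move=> /cvgrPdist_lt cw.
set U := \int[mu2]_(p in D) (u p) ^+ 2.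
have U0 : 0 <= U by apply: Rintegral_ge0 => p _; exact: sqr_ge0.
apply/cvgrPdist_le => e e0.
(* Young's inequality [|a b| <= d / 2 * a^2 + b^2 / (2 * d)] replaces Cauchy-Schwarz; this [d] makes
   the first term at most [e / 2]. *)
pose d : R := e / (U + 1); have d0 : 0 < d by rewrite divr_gt0 ?ltr_wpDl.
have de0 : 0 < d * e / 2 by apply: divr_gt0 => //; exact: mulr_gt0.
have {cw} := cw _ de0; apply: filterS => n; rewrite sub0r normrN => h.
have I := L2_integrable_mul u _ Lu (Ld n).
have iu := L2_integrable_sqr u Lu; have id := L2_integrable_sqr _ (Ld n).
have -> : inner D u v - inner D u (w n) = - \int[mu2]_(p in D) (u p * (w n \- v) p).
  rewrite /inner -[LHS]opprB -RintegralB//; do ?exact: L2_integrable_mul.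
  by congr (- _); apply: eq_Rintegral => p _ /=; rewrite mulrBr.
rewrite normrN; apply: le_trans (le_normr_Rintegral mD I) _.
have i1 : mu2.-integrable D (EFin \o (fun p => d / 2 * (u p) ^+ 2)) by have := integrableZl mD (d / 2) iu.
have i2 : mu2.-integrable D (EFin \o (fun p => (2 * d)^-1 * ((w n \- v) p) ^+ 2)) by have := integrableZl mD ((2 * d)^-1) id.
apply: (@le_trans _ _ (\int[mu2]_(p in D) (d / 2 * (u p) ^+ 2 + (2 * d)^-1 * ((w n \- v) p) ^+ 2))).
  apply: le_Rintegral => //.
  - by have := integrable_norm I.
  - by have := integrableD mD i1 i2.
  - move=> p _; rewrite normrM; set a := `|u p|; set b := `|(w n \- v) p|.
    rewrite -[X in _ <= _ * X + _]real_normK ?num_real// -[X in _ <= _ + _ * X]real_normK ?num_real//.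
    rewrite -/a -/b -subr_ge0 [X in 0 <= X](_ : _ = (2 * d)^-1 * (d * a - b) ^+ 2); last by field; rewrite gt_eqF.
    by nneg.
rewrite (RintegralD mD i1 i2) (RintegralZl _ mD iu) (RintegralZl _ mD id) -/U.
set E := \int[mu2]_(p in D) _ in h *.
have E0 : 0 <= E by apply: Rintegral_ge0 => p _; exact: sqr_ge0.
rewrite ger0_norm// in h.
have h1 : d / 2 * U <= e / 2.
  have : d * U <= e by rewrite /d mulrAC ler_pdivrMr ?ltr_wpDl// ler_wpM2l ?(ltW e0)// lerDl.
  by move=> ?; lra.
have h2 : (2 * d)^-1 * E <= e / 2.
  have d20 : 0 < 2 * d by lra.
  by rewrite (ler_pdivrMl _ _ d20); move: (E) h E0 => F h F0; lra.
by lra.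
Qed.

End L2Facts.

(** * From dominated approximants and the weak form to the domain of the operator *)

Section FormDomain.
Context {R : realType}.
Notation mu2 := (@lebesgue2 R).
Notation R2 := (measurableTypeR R * measurableTypeR R)%type.
Notation meas2 f := (measurable_fun setT (f : R2 -> R)).

Lemma test_functionB (D : set (R * R)) (phi psi : R * R -> R) p :
  test_function D phi -> test_function D psi ->
  pdx (phi \- psi) p = pdx phi p - pdx psi p /\ pdy (phi \- psi) p = pdy phi p - pdy psi p.
Proof.
move=> [/(_ 1)[_ [f1 f2 _ _]] _] [/(_ 1)[_ [g1 g2 _ _]] _].
by split; [exact: (deriveB (f1 p) (g1 p))|exact: (deriveB (f2 p) (g2 p))].
Qed.

Lemma test_function_L2 (L : R) (psi : R * R -> R) : 0 < L ->
  test_function (Omega L) psi -> L2 (Omega L) psi.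
Proof.
move=> L0 tpsi; have [c0 _ _] := test_function_continuous L psi tpsi.
have m0 := continuous_measurable2 psi c0.
have [a1 [a2 [b1 [b2 [M [a10 _ _ _ sup]]]]]] := test_function_support L psi L0 tpsi.
split; first exact: measurable_funTS.
have : mu2.-integrable (Omega L) (EFin \o (fun p => (psi p) ^+ 2)).
  apply: (integrable_box L a1 a2 b1 b2 (M * M)) => //.
  - exact: measurable_funX.
  - by move=> p _ _; have [h _ _ _] := sup p; exact: norm_mul_le.
  - by move=> p np; have [_ _ _ /(_ np)[-> _ _]] := sup p; rewrite expr0n.
by move=> /(integrable_lty (measurable_Omega L)).
Qed.

Lemma limit_bound (l b : R) (v : nat -> R) : (forall k, `|v k| <= b) ->
  v k @[k --> \oo] --> l -> `|l| <= b.
Proof.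
move=> vb vl.
have cb : (fun=> b : R) x @[x --> \oo] --> b by exact: cvg_cst.
exact: (ler_cvg_to (cvg_norm vl) cb (nearW _ vb)).
Qed.

(** It will be used with [t = x^(nu - 1/2)]. A function of size [x * t] with an [x]-derivative of
    size [t] has all its energy terms of size [t ^+ 2 = x^(2 nu - 1)], including the one with the
    coefficient [1 / x^2]. *)
Lemma quadratic_bound (L M c C Q x t w X Y Z : R) : 0 < x -> x <= L -> t ^+ 2 <= w ->
  0 <= Q <= M -> `|X| <= C * t -> `|Y| <= C * (x * t) -> `|Z| <= C * (x * t) ->
  X ^+ 2 + Q * Y ^+ 2 + `|c| / x ^+ 2 * Z ^+ 2 <= C ^+ 2 * (1 + M * L ^+ 2 + `|c|) * w.
Proof.
move=> x0 xL tw /andP[Q0 QM] hX hY hZ.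
have sq (a b : R) : `|a| <= b -> a ^+ 2 <= b ^+ 2.
  by move=> ab; rewrite -[leLHS]real_normK ?num_real// lerXn2r ?nnegrE ?(le_trans (normr_ge0 a)).
move: (sq _ _ hX) (sq _ _ hY) (sq _ _ hZ); rewrite !exprMn => {}hX {}hY {}hZ.
have x2L : x ^+ 2 <= L ^+ 2 by rewrite lerXn2r ?nnegrE ?(ltW x0)// (le_trans (ltW x0)).
have M0 : 0 <= M by exact: le_trans QM.
have C0 : 0 <= C ^+ 2 by exact: sqr_ge0.
have t0 := sqr_ge0 t; have w0 := le_trans t0 tw; have xx0 := sqr_ge0 x.
have h1 : X ^+ 2 <= C ^+ 2 * w by apply: le_trans hX _; exact: ler_wpM2l.
have h2 : Q * Y ^+ 2 <= M * (C ^+ 2 * (L ^+ 2 * w)).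
  apply: ler_pM => //; first exact: sqr_ge0.
  by apply: le_trans hY _; apply: ler_wpM2l => //; exact: ler_pM.
have h3 : `|c| / x ^+ 2 * Z ^+ 2 <= `|c| * (C ^+ 2 * w).
  rewrite -mulrA ler_wpM2l// mulrC ler_pdivrMr ?exprn_gt0//.
  by apply: le_trans hZ _; rewrite -[leRHS]mulrA ler_wpM2l// mulrC ler_wpM2r.
rewrite [leRHS](_ : _ = C ^+ 2 * w + M * (C ^+ 2 * (L ^+ 2 * w)) + `|c| * (C ^+ 2 * w)); last by ring.
by apply: lerD => //; exact: lerD.
Qed.

Variables (nu L : R) (q Q : R -> R).
Hypotheses (nu0 : 0 < nu) (L0 : 0 < L) (cQ : continuous Q)
  (Qq : forall x, 0 < x < L -> Q x = q x ^+ 2).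
Variables (Phi : nat -> R * R -> R) (u ux uy : R * R -> R) (C : R).
Let t (p : R * R) : R := p.1 `^ (nu - 1 / 2).
Hypotheses (C0 : 0 <= C) (tPhi : forall k, test_function (Omega L) (Phi k))
  (mu_ : meas2 u) (mux : meas2 ux) (muy : meas2 uy)
  (bPhi : forall p, Omega L p -> [/\ forall k, `|Phi k p| <= C * (p.1 * t p),
    forall k, `|pdx (Phi k) p| <= C * t p & forall k, `|pdy (Phi k) p| <= C * (p.1 * t p)])
  (cPhi : forall p, Omega L p -> [/\ Phi k p @[k --> \oo] --> u p,
    pdx (Phi k) p @[k --> \oo] --> ux p & pdy (Phi k) p @[k --> \oo] --> uy p]).
Let c := nu ^+ 2 - 1 / 4.
Let s := 2 * nu.

Let s0 : 0 < s. Proof. by rewrite mulr_gt0. Qed.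

Lemma measurable_approximant k : [/\ meas2 (Phi k), meas2 (pdx (Phi k)) & meas2 (pdy (Phi k))].
Proof.
by have [c0 cx cy] := test_function_continuous L (Phi k) (tPhi k); split; exact: continuous_measurable2.
Qed.

Lemma Omega_fst p : Omega L p -> 0 < p.1 < L.
Proof. by case=> /=; rewrite in_itv. Qed.

Lemma tsq_weight p : Omega L p -> t p ^+ 2 <= weight s p.
Proof.
move=> /Omega_fst/andP[x0 _]; rewrite /t /weight -powR_mulrn ?powR_ge0// -powRrM.
by rewrite [(nu - 1 / 2) * 2](_ : _ = s - 1) ?lerDr//; rewrite /s; field.
Qed.

Lemma limit_function_bound p : Omega L p ->
  [/\ `|u p| <= C * (p.1 * t p), `|ux p| <= C * t p & `|uy p| <= C * (p.1 * t p)].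
Proof.
by move=> Op; have [b1 b2 b3] := bPhi p Op; have [c1 c2 c3] := cPhi p Op; split;
  [apply: limit_bound b1 c1|apply: limit_bound b2 c2|apply: limit_bound b3 c3].
Qed.

Lemma Q_bound : exists2 M, 0 <= M & forall p, Omega L p -> 0 <= Q p.1 <= M.
Proof.
have [M M0 QM] := segment_bound Q 0 L (ltW L0) (fun x _ => cQ x).
exists M => // p /Omega_fst xL; have /andP[x0 xL'] := xL.
rewrite {1}Qq// sqr_ge0/= (le_trans (ler_norm _))// QM//.
by rewrite !ltW.
Qed.

(** The constant [c] is negative for [nu < 1 / 2]; with its absolute value the density is
    nonnegative and dominates that of the form. *)
Let energy (p : R * R) (X Y Z : R) := X ^+ 2 + Q p.1 * Y ^+ 2 + `|c| / p.1 ^+ 2 * Z ^+ 2.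
Let gap k p := energy p (pdx (Phi k) p - ux p) (pdy (Phi k) p - uy p) (Phi k p - u p).

Lemma energy_ge0 p X Y Z : Omega L p -> 0 <= energy p X Y Z.
Proof.
move=> /Omega_fst pL; rewrite /energy Qq//; nneg.
Qed.

Lemma gap_bound : exists K, forall k p, Omega L p -> `|gap k p| <= K * weight s p.
Proof.
have [M M0 QM] := Q_bound; exists ((C + C) ^+ 2 * (1 + M * L ^+ 2 + `|c|)) => k p Op.
have [b1 b2 b3] := bPhi p Op; have [d1 d2 d3] := limit_function_bound p Op.
have /andP[x0 xL] := Omega_fst p Op.
rewrite ger0_norm ?energy_ge0//.
apply: quadratic_bound (tsq_weight p Op) (QM p Op) _ _ _ => //; first exact: ltW.
all: by rewrite mulrDl; apply: norm_add_le => //; rewrite normrN.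
Qed.

Lemma measurable_quadratic (a : R) (X Y Z : R * R -> R) : meas2 X -> meas2 Y -> meas2 Z ->
  meas2 (fun p => X p ^+ 2 + Q p.1 * Y p ^+ 2 + a / p.1 ^+ 2 * Z p ^+ 2).
Proof.
move=> mX mY mZ; have mQ := meas_fst Q (continuous_measurable_fun cQ).
have mi := measurable_funM (measurable_cst a) (meas_fst _ measurable_inv_sqr).
exact: measurable_funD (measurable_funD (measurable_funX 2 mX)
  (measurable_funM mQ (measurable_funX 2 mY))) (measurable_funM mi (measurable_funX 2 mZ)).
Qed.

Lemma measurable_gap k : meas2 (gap k).
Proof.
have [m0 mx my] := measurable_approximant k.
exact: (measurable_quadratic `|c| _ _ _ (measurable_funB mx mux)
  (measurable_funB my muy) (measurable_funB m0 mu_)).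
Qed.

Lemma integrable_gap k : mu2.-integrable (Omega L) (EFin \o gap k).
Proof.
have [K HK] := gap_bound.
by apply: (integrable_Omega s L K) => //; [exact: measurable_gap|exact: HK].
Qed.

Lemma gap_cvg : \int[mu2]_(p in Omega L) gap k p @[k --> \oo] --> (0 : R).
Proof.
have [K HK] := gap_bound.
rewrite [X in _ --> X](_ : _ = \int[mu2]_(p in Omega L) 0); last by rewrite /Rintegral integral0.
apply: (dominated_cvg_Omega s L K) => //; first by move=> k; exact: measurable_gap.
move=> p Op; have [c1 c2 c3] := cPhi p Op; rewrite /gap /energy.
have z (v : nat -> R) (l a : R) : v k @[k --> \oo] --> l -> a * (v k - l) ^+ 2 @[k --> \oo] --> (0 : R).
  move=> vl; rewrite [X in _ --> X](_ : _ = a * (l - l) ^+ 2); last by rewrite subrr expr0n mulr0.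
  apply: cvgM; first exact: cvg_cst.
  by rewrite expr2; under eq_fun do rewrite expr2; apply: cvgM; apply: cvgB => //; exact: cvg_cst.
rewrite [X in _ --> X](_ : _ = 0 + 0 + 0); last by rewrite !addr0.
apply: cvgD; last exact: z.
apply: cvgD; last exact: z.
by have := z _ _ 1 c2; under eq_fun do rewrite mul1r.
Qed.

Lemma formE (phi psi : R * R -> R) : form nu L q phi psi = \int[mu2]_(p in Omega L)
  (pdx phi p * pdx psi p + Q p.1 * (pdy phi p * pdy psi p) + c / p.1 ^+ 2 * (phi p * psi p)).
Proof.
by apply: eq_Rintegral => p; rewrite inE => /Omega_fst xL; rewrite Qq.
Qed.

(** The inequality [(a - b)^2 <= 2 (a - d)^2 + 2 (b - d)^2] is applied to each term of [energy]. It
    reduces the Cauchy property to the convergence of [gap] to 0, with no need to evaluate the form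
    at the limit. *)
Lemma form_sub_le m n : form nu L q (Phi m \- Phi n) (Phi m \- Phi n) <=
  2 * \int[mu2]_(p in Omega L) gap m p + 2 * \int[mu2]_(p in Omega L) gap n p.
Proof.
have mO := measurable_Omega L.
pose W p := energy p (pdx (Phi m) p - pdx (Phi n) p) (pdy (Phi m) p - pdy (Phi n) p) (Phi m p - Phi n p).
pose F p := (pdx (Phi m) p - pdx (Phi n) p) ^+ 2 + Q p.1 * (pdy (Phi m) p - pdy (Phi n) p) ^+ 2 +
  c / p.1 ^+ 2 * (Phi m p - Phi n p) ^+ 2.
have -> : form nu L q (Phi m \- Phi n) (Phi m \- Phi n) = \int[mu2]_(p in Omega L) F p.
  rewrite formE; apply: eq_Rintegral => p _.
  have [-> ->] := test_functionB _ _ _ p (tPhi m) (tPhi n).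
  by rewrite /F -!expr2.
have FW p : Omega L p -> `|F p| <= W p.
  move=> Op; have /andP[x0 xL] := Omega_fst p Op.
  rewrite /F /W /energy; apply: norm_add_le; first apply: norm_add_le.
  - by rewrite ger0_norm ?sqr_ge0.
  - by rewrite ger0_norm// Qq ?x0//; nneg.
  - by rewrite normrM [X in _ * X]ger0_norm ?sqr_ge0// normrM normfV (ger0_norm (sqr_ge0 p.1)).
have par (a b d : R) : (a - b) ^+ 2 <= 2 * (a - d) ^+ 2 + 2 * (b - d) ^+ 2.
  by rewrite -subr_ge0 [X in 0 <= X](_ : _ = (a + b - d - d) ^+ 2) ?sqr_ge0//; ring.
have WG p : Omega L p -> W p <= 2 * gap m p + 2 * gap n p.
  move=> Op; have /andP[x0 xL] := Omega_fst p Op.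
  rewrite /W /gap /energy.
  rewrite [leRHS](_ : _ = (2 * (pdx (Phi m) p - ux p) ^+ 2 + 2 * (pdx (Phi n) p - ux p) ^+ 2) +
     Q p.1 * (2 * (pdy (Phi m) p - uy p) ^+ 2 + 2 * (pdy (Phi n) p - uy p) ^+ 2) +
     `|c| / p.1 ^+ 2 * (2 * (Phi m p - u p) ^+ 2 + 2 * (Phi n p - u p) ^+ 2)); last by ring.
  apply: lerD; first apply: lerD => //.
  - by apply: ler_wpM2l => //; rewrite Qq ?x0// sqr_ge0.
  - by apply: ler_wpM2l => //; nneg.
have im := integrable_gap m; have in_ := integrable_gap n.
have i1 : mu2.-integrable (Omega L) (EFin \o (fun p => 2 * gap m p)) by have := integrableZl mO 2 im.
have i2 : mu2.-integrable (Omega L) (EFin \o (fun p => 2 * gap n p)) by have := integrableZl mO 2 in_.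
rewrite -(RintegralZl _ mO im) -(RintegralZl _ mO in_) -(RintegralD mO i1 i2).
have [m0 mx my] := measurable_approximant m; have [n0 nx ny] := measurable_approximant n.
have mF : meas2 F.
  exact: (measurable_quadratic c _ _ _ (measurable_funB mx nx) (measurable_funB my ny) (measurable_funB m0 n0)).
have i12 : mu2.-integrable (Omega L) (EFin \o (fun p => 2 * gap m p + 2 * gap n p)).
  by have := integrableD mO i1 i2.
have iF : mu2.-integrable (Omega L) (EFin \o F).
  apply: le_integrable i12 => //; first by apply/measurable_EFinP; exact: measurable_funTS.
  move=> p Op /=; rewrite lee_fin (le_trans (FW p Op))// (le_trans (WG p Op))//; exact: ler_norm.
apply: le_Rintegral => // p Op.
by rewrite (le_trans (ler_norm _))// (le_trans (FW p Op))// WG.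
Qed.

Lemma sqr_bound p (a b : R) : Omega L p -> `|a| <= b * (p.1 * t p) ->
  `|a ^+ 2| <= b ^+ 2 * L ^+ 2 * weight s p.
Proof.
move=> Op ab; have /andP[x0 xL] := Omega_fst p Op.
rewrite normrX -mulrA.
apply: (@le_trans _ _ ((b * (p.1 * t p)) ^+ 2)).
  by rewrite lerXn2r ?nnegrE// (le_trans _ ab).
rewrite !exprMn ler_wpM2l ?sqr_ge0// ler_pM ?sqr_ge0// ?tsq_weight//.
by rewrite lerXn2r ?nnegrE ?ltW.
Qed.

Lemma L2_of_bound (v : R * R -> R) b : meas2 v ->
  (forall p, Omega L p -> `|v p| <= b * (p.1 * t p)) -> L2 (Omega L) v.
Proof.
move=> mv vb; split; first exact: measurable_funTS.
have : mu2.-integrable (Omega L) (EFin \o (fun p => (v p) ^+ 2)).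
  apply: (integrable_Omega s L (b ^+ 2 * L ^+ 2)) => //; first exact: measurable_funX.
  by move=> p Op; apply: sqr_bound => //; exact: vb.
by move=> /(integrable_lty (measurable_Omega L)).
Qed.

Lemma L2_limit : L2 (Omega L) u.
Proof. by apply: (L2_of_bound u C) => // p /limit_function_bound[]. Qed.

Lemma L2_Phi k : L2 (Omega L) (Phi k). Proof. exact: test_function_L2. Qed.

Lemma normsq_cvg : normsq (Omega L) (Phi k \- u) @[k --> \oo] --> 0%E.
Proof.
have mO := measurable_Omega L.
under eq_fun do rewrite (normsqE _ mO _ (L2B _ mO _ _ (L2_Phi _) L2_limit)).
apply: cvg_EFin; first exact: nearW.
rewrite [X in _ --> X](_ : _ = \int[mu2]_(p in Omega L) 0); last by rewrite /Rintegral integral0.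
apply: (dominated_cvg_Omega s L ((C + C) ^+ 2 * L ^+ 2)) => //.
- by move=> k; have [m0 _ _] := measurable_approximant k; apply: measurable_funX; exact: measurable_funB.
- move=> k p Op; apply: sqr_bound => //; have [b1 _ _] := bPhi p Op; have [d1 _ _] := limit_function_bound p Op.
  by rewrite mulrDl; apply: norm_add_le => //; rewrite normrN.
- move=> p Op; have [c1 _ _] := cPhi p Op.
  rewrite [X in _ --> X](_ : _ = (u p - u p) * (u p - u p)); last by rewrite subrr mulr0.
  by under eq_fun do rewrite expr2; apply: cvgM; apply: cvgB => //; exact: cvg_cst.
Qed.

Lemma approx_subseq (k : nat -> nat) : (forall n, (n <= k n)%N) -> approx nu L q (fun n => Phi (k n)) u.
Proof.
move=> kn; split=> //.
- move=> e e0; have /cvgrPdist_lt /(_ (e / 4) (divr_gt0 e0 _))[//|N _ HN] := gap_cvg.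
  exists N => m n Nm Nn; apply: le_lt_trans (form_sub_le _ _) _.
  have h j : (N <= j)%N -> \int[mu2]_(p in Omega L) gap (k j) p < e / 4.
    move=> Nj; have := HN (k j) (leq_trans Nj (kn j)).
    by rewrite /= sub0r normrN; exact: le_lt_trans (ler_norm _).
  by move: (h _ Nm) (h _ Nn); move: (\int[mu2]_(p in Omega L) _) (\int[mu2]_(p in Omega L) _) => x y; lra.
- move=> A /normsq_cvg[N _ HN]; exists N => // n Nn.
  by apply: HN; exact: leq_trans (kn n).
Qed.

Lemma form_test_cvg (psi : R * R -> R) : test_function (Omega L) psi ->
  form nu L q (Phi k) psi @[k --> \oo] --> \int[mu2]_(p in Omega L)
    (ux p * pdx psi p + Q p.1 * (uy p * pdy psi p) + c / p.1 ^+ 2 * (u p * psi p)).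
Proof.
move=> tpsi; have [c0 cx cy] := test_function_continuous L psi tpsi.
have m0 := continuous_measurable2 psi c0.
have mx := continuous_measurable2 _ cx; have my := continuous_measurable2 _ cy.
have [a1 [a2 [b1 [b2 [B [a10 _ _ _ sup]]]]]] := test_function_support L psi L0 tpsi.
have [M M0 QM] := Q_bound.
have mQ := meas_fst Q (continuous_measurable_fun cQ).
have mi : meas2 (fun p => c / p.1 ^+ 2) by apply: measurable_funM => //; exact: (meas_fst _ measurable_inv_sqr).
under eq_fun do rewrite formE.
have B0 : 0 <= B by have [h _ _ _] := sup (0, 0); apply: le_trans h.
(* Against a fixed test function the integrand is linear in the approximant, so [t] itself is to be
   dominated and not its square: [t] is the power [s - 1] for [s = nu + 1 / 2]. *)
apply: (dominated_cvg_Omega (nu + 1 / 2) L (C * B + M * (C * L * B) + `|c| / a1 ^+ 2 * (C * L * B))).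
- by rewrite addr_gt0.
- move=> k; have [p0 px py] := measurable_approximant k.
  exact: measurable_funD (measurable_funD (measurable_funM px mx)
    (measurable_funM mQ (measurable_funM py my))) (measurable_funM mi (measurable_funM p0 m0)).
- exact: measurable_funD (measurable_funD (measurable_funM mux mx)
    (measurable_funM mQ (measurable_funM muy my))) (measurable_funM mi (measurable_funM mu_ m0)).
- move=> k p Op; have /andP[x0 xL] := Omega_fst p Op; have [d1 d2 d3] := bPhi p Op.
  have [h1 h2 h3 h4] := sup p.
  have t0 : 0 <= t p by exact: powR_ge0.
  have tw : t p <= weight (nu + 1 / 2) p.
    by rewrite /weight (_ : nu + 1 / 2 - 1 = nu - 1 / 2) ?lerDr//; field.
  have hP (z : R) : `|z| <= C * (p.1 * t p) -> `|z| <= C * L * t p.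
    move=> /le_trans; apply; rewrite -mulrA ler_wpM2l// ler_wpM2r//; exact: ltW.
  apply: (@le_trans _ _ ((C * B + M * (C * L * B) + `|c| / a1 ^+ 2 * (C * L * B)) * t p)); last first.
    by apply: ler_wpM2l => //; nneg.
  rewrite [leRHS]mulrDl [X in _ <= X + _]mulrDl; apply: norm_add_le; first apply: norm_add_le.
  + by rewrite mulrAC; apply: norm_mul_le.
  + rewrite -[M * _ * _]mulrA; apply: norm_mul_le.
      by have /andP[q0 qM] := QM p Op; rewrite ger0_norm.
    by rewrite mulrAC; apply: norm_mul_le => //; exact: hP.
  + have [/andP[/andP[ax _] _]|/h4[-> _ _]] := boolP ((a1 <= p.1 <= a2) && (b1 <= p.2 <= b2)); last first.
      by rewrite !mulr0 normr0; nneg.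
    rewrite -[_ / _ * _ * t p]mulrA; apply: norm_mul_le.
      rewrite normrM normfV ler_wpM2l// [`|_ ^+ 2|]ger0_norm ?sqr_ge0//.
      by rewrite lef_pV2 ?posrE ?exprn_gt0// lerXn2r ?nnegrE ?(ltW x0) ?(ltW a10).
    by rewrite mulrAC; apply: norm_mul_le => //; exact: hP.
- move=> p Op; have [c1 c2 c3] := cPhi p Op.
  apply: cvgD; first apply: cvgD.
  + by apply: cvgM => //; exact: cvg_cst.
  + by apply: cvgM; first exact: cvg_cst; apply: cvgM => //; exact: cvg_cst.
  + by apply: cvgM; first exact: cvg_cst; apply: cvgM => //; exact: cvg_cst.
Qed.

(* An approximating sequence of [v] is paired with a subsequence of [Phi] chosen so
   that the form at index [n] is [1/(n+1)]-close to its limit in [Phi]. *)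
Lemma operator_of_weak_form (lam : R) :
  (forall psi, test_function (Omega L) psi -> \int[mu2]_(p in Omega L)
    (ux p * pdx psi p + Q p.1 * (uy p * pdy psi p) + c / p.1 ^+ 2 * (u p * psi p))
    = lam * \int[mu2]_(p in Omega L) (u p * psi p)) ->
  opG nu L q u (fun p => lam * u p).
Proof.
move=> weak; have mO := measurable_Omega L.
have Lu := L2_limit.
have Llu : L2 (Omega L) (fun p => lam * u p).
  split; first by apply: measurable_funM => //; exact: measurable_funTS.
  by rewrite (normsqZ _ mO)//; [rewrite (normsqE _ mO)//= -EFinM ltry|exact: measurable_funTS].
split=> //; first by split => //; exists Phi; exact: (approx_subseq id).
move=> v [Lv [psi apsi]]; have [tpsi _ psiv] := apsi.
have lim n : form nu L q (Phi k) (psi n) @[k --> \oo] --> inner (Omega L) (fun p => lam * u p) (psi n).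
  have := form_test_cvg (psi n) (tpsi n); rewrite (weak _ (tpsi n)).
  rewrite -(RintegralZl _ mO); last by have := L2_integrable_mul _ mO u _ Lu (test_function_L2 L _ L0 (tpsi n)).
  by under eq_Rintegral do rewrite mulrA.
have near n : exists k, (n <= k)%N /\
    `|inner (Omega L) (fun p => lam * u p) (psi n) - form nu L q (Phi k) (psi n)| <= n.+1%:R^-1.
  have /cvgrPdist_le /(_ n.+1%:R^-1)[|N _ HN] := lim n; first by rewrite invr_gt0.
  by exists (maxn n N); split; [exact: leq_maxl|apply: HN; exact: leq_maxr].
have [k Hk] := choice near.
exists (fun n => Phi (k n)), psi; split => //; first by apply: approx_subseq => n; have [] := Hk n.
have Lpsi n := test_function_L2 L _ L0 (tpsi n).
have ci := inner_cvg _ mO _ _ _ Llu Lv Lpsi psiv.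
have cd : (inner (Omega L) (fun p => lam * u p) (psi n) - form nu L q (Phi (k n)) (psi n))
    @[n --> \oo] --> (0 : R).
  by apply: (cvg_inv_bound _ _ 1 0) => n _; rewrite subr0 div1r; have [] := Hk n.
have := cvgB ci cd; rewrite subr0; set f := _ - _ => cf.
suff -> : (fun n => form nu L q (Phi (k n)) (psi n)) = f by exact: cf.
by apply/funext => n; rewrite /f /= subKr.
Qed.

End FormDomain.

(** * The eigenfunctions of the operator *)

Section Eigenfunction.
Context {R : realType}.
Notation mu2 := (@lebesgue2 R).
Notation R2 := (measurableTypeR R * measurableTypeR R)%type.
Notation meas2 f := (measurable_fun setT (f : R2 -> R)).

Lemma tensor_test_function (L : R) (f g : R -> R) (a b : R) : 0 < a -> 0 < b ->
  smooth f -> smooth g -> (forall x, ~~ (a <= x <= L - a) -> f x = 0) ->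
  (forall y, ~~ (b <= y <= pi - b) -> g y = 0) -> test_function (Omega L) (tensor f g).
Proof.
move=> a0 b0 sf sg f0 g0; split; first by move=> k; exact: tensor_Ck.
exists (`[a, L - a] `*` `[b, pi - b]); split.
- by apply: compact_setX; exact: segment_compact.
- move=> p [] /=; rewrite !in_itv /= => /andP[h1 h2] /andP[h3 h4].
  by split; rewrite /= in_itv /=; apply/andP; split; lra.
- move=> p nK; rewrite /tensor.
  have [h1|/f0->] := boolP (a <= p.1 <= L - a); last by rewrite mul0r.
  rewrite g0 ?mulr0//; apply/negP => h2; apply: nK; split => /=; by rewrite in_itv.
Qed.

Variables (nu L lam : R) (n : nat) (q Q h h1 : R -> R).
Hypotheses (nu0 : 0 < nu) (L0 : 0 < L) (cQ : continuous Q)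
  (Qq : forall x, 0 < x < L -> Q x = q x ^+ 2)
  (ch : continuous h) (ch1 : continuous h1)
  (dh : forall x : R, 0 < x -> is_derive x 1 h (h1 x)) (hL : h L = 0)
  (dh1 : forall x : R, 0 < x ->
    is_derive x 1 h1 ((n%:R ^+ 2 * Q x - lam) * h x - (2 * nu + 1) / x * h1 x)).

Let r : R := nu + 1 / 2.
Let g (x : R) : R := x `^ r * h x.
Let g1 (x : R) : R := r * x `^ (r - 1) * h x + x `^ r * h1 x.

Lemma measurable_radial (s : R) (f : R -> R) : continuous f ->
  measurable_fun setT (fun x => x `^ s * f x).
Proof.
by move=> cf; apply: measurable_funM; [exact: measurable_powR|exact: continuous_measurable_fun].
Qed.

Lemma eigenfunction : opG nu L q (fun p => p.1 `^ (nu + 1 / 2) * h p.1 * sin (n%:R * p.2))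
  (fun p => lam * (p.1 `^ (nu + 1 / 2) * h p.1 * sin (n%:R * p.2))).
Proof.
have [al [al1 [Ca [Ca0 sal dal al0 hal]]]] := approx_fst L r h h1 L0 ch ch1 dh hL.
have [be [be1 [Cb [Cb0 sbe dbe be0 hbe]]]] := @approx_snd R n.
pose ux (p : R * R) := g1 p.1 * sin (n%:R * p.2).
pose uy (p : R * R) := g p.1 * (n%:R * cos (n%:R * p.2)).
pose Phi k : R * R -> R := tensor (al k) (be k).
have mg : measurable_fun setT g by exact: measurable_radial.
have mg1 : measurable_fun setT g1.
  apply: measurable_funD; last exact: measurable_radial.
  by under eq_fun do rewrite -mulrA; apply: measurable_funM => //; exact: measurable_radial.
have ms := meas_snd _ (continuous_measurable_fun (sin_mul_continuous (n%:R : R))).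
have mc := meas_snd _ (continuous_measurable_fun (cos_mul_continuous (n%:R : R))).
have tPhi k : test_function (Omega L) (Phi k).
  apply: (tensor_test_function L _ _ k.+1%:R^-1 k.+1%:R^-1); rewrite ?invr_gt0//.
  - exact: al0.
  - exact: be0.
have E p : Omega L p -> forall k,
    pdx (Phi k) p = al1 k p.1 * be k p.2 /\ pdy (Phi k) p = al k p.1 * be1 k p.2.
  move=> /Omega_fst/andP[x0 _] k; have := tensor_derive_fst _ (be k) _ p (dal k _ x0).
  have := tensor_derive_snd (al k) _ _ p (dbe k p.2).
  by move=> /@derive_val e1 /@derive_val e2.
have rE (x : R) : 0 < x -> x * x `^ (nu - 1 / 2) = x `^ r.
  move=> x0; rewrite -[RHS](mulr_powRB1 (ltW x0)) /r; last by rewrite addr_gt0.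
  by congr (_ * _ `^ _); field.
have rE1 : r - 1 = nu - 1 / 2 by rewrite /r; field.
apply: (operator_of_weak_form nu L q Q nu0 L0 cQ Qq Phi _ ux uy (Ca * Cb)) => //.
- exact: mulr_ge0.
- by apply: measurable_funM => //; exact: (meas_fst g).
- by apply: measurable_funM => //; exact: (meas_fst g1).
- by apply: measurable_funM; [exact: (meas_fst g)|exact: measurable_funM].
- move=> p Op; have /andP[x0 xL] := Omega_fst L p Op.
  have /andP[y0 yp] : 0 < p.2 < pi by case: Op => _ /=; rewrite in_itv.
  have [|a1 a2 _ _] := hal p.1; first by rewrite x0.
  have [|b1 b2 _ _] := hbe p.2; first by rewrite y0.
  rewrite rE// -rE1.
  by split=> k; rewrite ?(E p Op k).1 ?(E p Op k).2 mulrAC; apply: norm_mul_le.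
- move=> p Op; have /andP[x0 xL] := Omega_fst L p Op.
  have /andP[y0 yp] : 0 < p.2 < pi by case: Op => _ /=; rewrite in_itv.
  have [|_ _ a1 a2] := hal p.1; first by rewrite x0.
  have [|_ _ b1 b2] := hbe p.2; first by rewrite y0.
  split.
  - exact: cvgM.
  - by under eq_fun do rewrite (E p Op _).1; exact: cvgM.
  - by under eq_fun do rewrite (E p Op _).2; exact: cvgM.
- move=> psi tpsi.
  apply: (weak_form L n lam (nu ^+ 2 - 1 / 4) Q g g1
    (fun x => (n%:R ^+ 2 * Q x - lam + (nu ^+ 2 - 1 / 4) / x ^+ 2) * g x)) => //.
  + move=> x x0; have dr := powR_derive r x x0; have d := dh x x0.
    by rewrite /g; derE; rewrite /g1.
  (* The singular potential appears because [r * (r - 1)] is [nu ^+ 2 - 1 / 4], and the terms in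
     [h1] cancel because [2 * r] is [2 * nu + 1]. *)
  + move=> x x0; have dr := powR_derive r x x0; have dr1 := powR_derive (r - 1) x x0.
    have d := dh x x0; have d1 := dh1 x x0.
    have x'0 : x != 0 by rewrite gt_eqF.
    have e2 : x `^ (r - 1) = x * x `^ (r - 1 - 1).
      by rewrite [in RHS]powRD ?x'0 ?implybT// powR_inv1 ?(ltW x0)// mulrCA divff// mulr1.
    have e1 : x `^ r = x * x `^ (r - 1).
      by rewrite [in RHS]powRD ?x'0 ?implybT// powR_inv1 ?(ltW x0)// mulrCA divff// mulr1.
    rewrite /g1; derE; rewrite /g e1 e2; move: (x `^ (r - 1 - 1)) (h x) (h1 x) (Q x) => z hx h1x Qx.
    by rewrite /r; field.
  + move=> x x0; have dr := powR_derive r x x0; have d := dh x x0.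
    have cgx : {for x, continuous g} by rewrite /g; apply: is_derive1_continuous; derE.
    apply: cvgM => //; apply: cvgD.
      apply: cvgB; last exact: cvg_cst.
      by apply: cvgM; [exact: cvg_cst|exact: cQ].
    apply: cvgM; first exact: cvg_cst.
    by apply: cvgV; [rewrite expf_neq0// gt_eqF|apply: exprn_continuous].
Qed.
End Eigenfunction.

(** * Separated solutions and the concentration of their mass *)

Section Observation.
Context {R : realType}.
Notation mu := (@lebesgue_measure R).
Notation mu2 := (@lebesgue2 R).
Notation R2 := (measurableTypeR R * measurableTypeR R)%type.
Notation meas2 f := (measurable_fun setT (f : R2 -> R)).

Lemma L2Z (D : set (R * R)) (c : R) (u : R * R -> R) : measurable (D : set R2) -> L2 D u ->
  L2 D (fun p => c * u p).
Proof.
move=> mD Lu; have [mu_ _] := Lu; split; first exact: measurable_funM.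
by rewrite (normsqZ _ mD)// (normsqE _ mD)//= -EFinM ltry.
Qed.

(** The equation is assumed for all multiples of [u], which avoids proving that [opG] is linear. *)
Lemma is_solution_exp (nu L lam : R) (q : R -> R) (u : R * R -> R) : L2 (Omega L) u ->
  (forall c, opG nu L q (fun p => c * u p) (fun p => lam * (c * u p))) ->
  is_solution nu L q u (fun t p => expR (- lam * t) * u p).
Proof.
move=> Lu Gu; have mO := measurable_Omega L; have [mu_ _] := Lu.
set N := \int[mu2]_(p in Omega L) (u p) ^+ 2.
have NE : normsq (Omega L) u = N%:E by exact: normsqE.
have NZ c : normsq (Omega L) (fun p => c * u p) = (c ^+ 2 * N)%:E by rewrite (normsqZ _ mO)// NE.
have Nlim (k : R -> R) (F : set_system R) : Filter F -> k h @[h --> F] --> (0 : R) ->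
    normsq (Omega L) (fun p => k h * u p) @[h --> F] --> 0%E.
  move=> FF kl; under eq_fun do rewrite NZ.
  apply: cvg_EFin; first exact: nearW.
  rewrite [X in _ --> X](_ : _ = 0 * 0 * N); last by rewrite !mul0r.
  by under eq_fun do rewrite expr2; apply: cvgM; [exact: cvgM|exact: cvg_cst].
have de (t : R) : is_derive t 1 (fun t => expR (- lam * t)) (- lam * expR (- lam * t)) by derE; ring.
split.
- by move=> t _; exact: L2Z.
- rewrite (_ : _ \- _ = (fun p => 0 * u p)); first by rewrite NZ expr0n mul0r.
  by apply/funext => p /=; rewrite mulr0 expR0; ring.
- move=> t t0; rewrite (_ : (fun s => _) =
    (fun s => normsq (Omega L) (fun p => (expR (- lam * s) - expR (- lam * t)) * u p))); last first.
    by apply/funext => s; congr normsq; apply/funext => p /=; rewrite mulrBl.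
  apply: Nlim; rewrite [X in _ --> X](_ : _ = expR (- lam * t) - expR (- lam * t)); last by rewrite subrr.
  apply: cvgB; last exact: cvg_cst.
  apply: cvg_within_filter; exact: is_derive1_continuous (de t).
- move=> t t0; exists (fun p => lam * (expR (- lam * t) * u p)); split; first exact: Gu.
  rewrite (_ : (fun h => _) = (fun h => normsq (Omega L) (fun p =>
      (h^-1 * (expR (- lam * (h + t)) - expR (- lam * t)) - - lam * expR (- lam * t)) * u p))); last first.
    by apply/funext => h; congr normsq; apply/funext => p /=; rewrite [h + t]addrC; ring.
  apply: Nlim.
  rewrite [X in _ --> X](_ : _ = - lam * expR (- lam * t) - - lam * expR (- lam * t)); last by rewrite subrr.
  apply: cvgB; last exact: cvg_cst.
  have [dv /= dE] := de t; rewrite -[X in _ --> X]dE.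
  rewrite (_ : (fun h => _) =
    (fun h => h^-1 *: (((fun t => expR (- lam * t)) \o shift t) (h *: 1) - expR (- lam * t)))).
    exact: dv.
  by apply/funext => h /=; rewrite [h *: 1]mulr1.
Qed.

Lemma strip_sub_Omega (a b L : R) : 0 <= a -> b <= L -> strip a b `<=` Omega L.
Proof.
move=> a0 bL p [] /=; rewrite !in_itv /= => /andP[h1 h2] h3; split => //=.
by rewrite in_itv /= (le_lt_trans a0)//= (lt_le_trans h2).
Qed.

Lemma measurable_strip (a b : R) : measurable (strip a b : set R2).
Proof. exact: measurableX. Qed.

(** Bounding [expR (- lam * t)] by 1 under the time integral costs only the factor [T], harmless
    against estimates exponential in [n]. *)
Lemma observability_exp (L lam T C : R) (D : set (R * R)) (u : R * R -> R) :
  measurable (D : set R2) -> L2 D u -> L2 (Omega L) u -> 0 <= lam -> 0 < T -> 0 < C ->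
  (normsq (Omega L) (fun p => (expR (- lam * T) * u p)%R)
    <= C%:E * \int[mu]_(t in `]0%R, T[) normsq D (fun p => (expR (- lam * t) * u p)%R))%E ->
  ((expR (- (2 * lam * T)))%:E * normsq (Omega L) u <= (C * T)%:E * normsq D u)%E.
Proof.
move=> mD LD Lu l0 T0 C0; have mO := measurable_Omega L; have [mDu _] := LD; have [mu_ _] := Lu.
rewrite (normsqZ _ mO)// -expRM_natl (_ : 2 * (- lam * T) = - (2 * lam * T)); last by ring.
move=> /le_trans; apply; rewrite EFinM -muleA lee_pmul2l ?lte_fin//.
rewrite (normsqE _ mD)//; set N := \int[mu2]_(p in D) _.
have N0 : 0 <= N by apply: Rintegral_ge0 => p _; exact: sqr_ge0.
under eq_integral do rewrite (normsqZ _ mD)// (normsqE _ mD)// -/N -EFinM.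
apply: (@le_trans _ _ (\int[mu]_(t in `]0%R, T[) (cst N%:E t))%E); last first.
  by rewrite integral_cst//= lebesgue_measure_itv/= lte_fin T0 oppr0 adde0 muleC.
apply: ge0_le_integral => //.
- by move=> t _; rewrite lee_fin mulr_ge0 ?sqr_ge0.
- apply/measurable_EFinP; apply: measurable_funM => //; apply: measurable_funX.
  apply: measurable_funTS; apply: continuous_measurable_fun; apply: cont_expR; exact: mulrl_continuous.
- move=> t; rewrite /= in_itv /= => /andP[t0 _]; rewrite lee_fin ler_piMl//.
  rewrite exprn_ile1 ?expR_ge0// -[leRHS]expR0 ler_expR mulNr oppr_le0 mulr_ge0//; exact: ltW.
Qed.

Lemma tensor_normsq (A B : set R) (g s : R -> R) : measurable A -> measurable B ->
  measurable_fun setT g -> measurable_fun setT s ->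
  (normsq (A `*` B) (fun p => (g p.1 * s p.2)%R) =
   \int[mu]_(x in A) ((g x) ^+ 2)%:E * \int[mu]_(y in B) ((s y) ^+ 2)%:E)%E.
Proof.
move=> mA mB mg ms; rewrite /normsq tonelli_rect//; last 2 first.
- by apply: measurable_funX; apply: measurable_funM; [exact: meas_fst|exact: meas_snd].
- by move=> p; exact: sqr_ge0.
have mg2 : measurable_fun A (fun x => ((g x) ^+ 2)%:E).
  by apply/measurable_EFinP; apply: measurable_funX; exact: measurable_funTS.
have ms2 : measurable_fun B (fun x => ((s x) ^+ 2)%:E).
  by apply/measurable_EFinP; apply: measurable_funX; exact: measurable_funTS.
rewrite -ge0_integralZr//; last 2 first.
- by move=> x _; rewrite lee_fin sqr_ge0.
- by apply: integral_ge0 => y _; rewrite lee_fin sqr_ge0.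
apply: eq_integral => x _; rewrite -ge0_integralZl//; last 2 first.
- by move=> y _; rewrite lee_fin sqr_ge0.
- by rewrite lee_fin sqr_ge0.
by apply: eq_integral => y _; rewrite /= exprMn EFinM.
Qed.

Lemma integral_ge_cst (A : set R) (f : R -> R) (m a b : R) : measurable A -> measurable_fun setT f ->
  (forall x, 0 <= f x) -> `]a, b[ `<=` A -> a < b -> 0 <= m ->
  (forall x, a < x < b -> m <= f x) -> ((m * (b - a))%:E <= \int[mu]_(x in A) (f x)%:E)%E.
Proof.
move=> mA mf f0 sA ab m0 mfx.
have mfA (B : set R) : measurable_fun B (EFin \o f) by apply/measurable_EFinP; exact: measurable_funTS.
apply: (@le_trans _ _ (\int[mu]_(x in `]a, b[) (f x)%:E)%E); last first.
  by apply: ge0_subset_integral => //; [exact: mfA|move=> x _; rewrite lee_fin].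
apply: (@le_trans _ _ (\int[mu]_(x in `]a, b[) (cst m%:E x))%E).
  by rewrite integral_cst//= lebesgue_measure_itv/= lte_fin ab -EFinD -EFinM.
apply: ge0_le_integral => //.
  exact: mfA.
Qed.

Lemma integral_gt0 (a b x0 : R) (f : R -> R) : measurable_fun setT f -> (forall x, 0 <= f x) ->
  a < x0 < b -> {for x0, continuous f} -> 0 < f x0 -> (0 < \int[mu]_(x in `]a, b[) (f x)%:E)%E.
Proof.
move=> mf f0 /andP[ax xb] cf fx0.
have : \forall x \near x0, f x0 / 2 <= f x.
  near=> x; apply: ltW; near: x; apply: (cvgr_gt (f x0)) => //; lra.
move=> /nbhs_ballP[d /= d0 Hd].
pose e := Num.min d (b - x0).
have e0 : 0 < e by rewrite lt_min d0 subr_gt0.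
have [ed eb] : e <= d /\ e <= b - x0 by split; rewrite ge_min lexx ?orbT.
apply: (@lt_le_trans _ _ ((f x0 / 2 * (x0 + e - x0))%:E)).
  by rewrite lte_fin addrC addKr mulr_gt0// divr_gt0.
apply: integral_ge_cst => //.
- move=> x; rewrite /= !in_itv /= => /andP[h1 h2]; apply/andP; split; lra.
- by rewrite ltrDl.
- by rewrite divr_ge0.
- move=> x /andP[h1 h2]; apply: Hd; rewrite /ball /= ltr_distlC; apply/andP; split; lra.
Unshelve. all: by end_near. Qed.

(** The reference interval []x0, 2 * x0[] has length [x0]. Averaging the hypothesis over it bounds
    [g y ^+ 2] by [rho / x0] times the whole mass of [g ^+ 2], and integrating over []a, b[] adds
    the factor [b - a]. *)
Lemma normsq_concentration (L a b x0 rho : R) (n : nat) (g : R -> R) : measurable_fun setT g ->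
  0 < x0 -> 2 * x0 <= L -> a < b -> 0 < rho ->
  (forall x y, x0 < x < 2 * x0 -> a < y < b -> (g y) ^+ 2 <= rho * (g x) ^+ 2) ->
  (normsq (strip a b) (fun p => (g p.1 * sin (n%:R * p.2))%R)
   <= (rho * (b - a) / x0)%:E * normsq (Omega L) (fun p => (g p.1 * sin (n%:R * p.2))%R))%E.
Proof.
move=> mg x00 x0L ab rho0 H.
have ms := continuous_measurable_fun (sin_mul_continuous (n%:R : R)).
rewrite !(tensor_normsq _ _ g _ _ _ mg ms)// muleA.
have S0 : (0 <= \int[mu]_(y in `]0%R, pi[) (sin (n%:R * y) ^+ 2)%:E)%E.
  by apply: integral_ge0 => y _; rewrite lee_fin sqr_ge0.
apply: lee_wpmul2r => //.
set I := (X in (_ <= _ * X)%E).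
have mg2 : measurable_fun setT (fun x => (g x) ^+ 2) by exact: measurable_funX.
have I0 : (0 <= I)%E by apply: integral_ge0 => x _; rewrite lee_fin sqr_ge0.
apply: (@le_trans _ _ (\int[mu]_(x in `]a, b[) (cst ((rho / x0)%:E * I) x))%E); last first.
  rewrite integral_cst//= lebesgue_measure_itv/= lte_fin ab -EFinD muleAC -EFinM.
  by rewrite mulrAC.
apply: ge0_le_integral => //.
- by move=> x _; rewrite lee_fin sqr_ge0.
- by apply/measurable_EFinP; exact: measurable_funTS.
- move=> y; rewrite /= in_itv /= => yab.
  have : ((rho^-1 * (g y) ^+ 2 * (2 * x0 - x0))%:E <= I)%E.
    apply: integral_ge_cst => //.
    + by move=> x; exact: sqr_ge0.
    + move=> x; rewrite /= !in_itv /= => /andP[h1 h2]; apply/andP; split; lra.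
    + lra.
    + by rewrite mulr_ge0 ?sqr_ge0// invr_ge0 ltW.
    + by move=> x xx; rewrite ler_pdivrMl// H.
  have r0 : 0 < rho / x0 by rewrite divr_gt0.
  move=> h; have := @lee_wpmul2l _ (rho / x0)%:E _ _ _ h; rewrite lee_fin (ltW r0) => /(_ isT).
  apply: le_trans; rewrite -EFinM lee_fin le_eqVlt; apply/orP; left; apply/eqP.
  by field; rewrite !gt_eqF.
Qed.

Lemma normsq_gt0 (L x0 : R) (n : nat) (g : R -> R) : measurable_fun setT g -> (0 < n)%N ->
  0 < x0 < L -> {for x0, continuous g} -> 0 < g x0 ->
  (0 < normsq (Omega L) (fun p => (g p.1 * sin (n%:R * p.2))%R))%E.
Proof.
move=> mg n0 x0L cg g0.
have cs := sin_mul_continuous (n%:R : R); have ms := continuous_measurable_fun cs.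
rewrite (tensor_normsq _ _ g _ _ _ mg ms)// mule_gt0//.
  apply: (integral_gt0 _ _ x0) => //.
  - exact: measurable_funX.
  - by move=> x; exact: sqr_ge0.
  - exact: (cvgM cg cg).
  - exact: exprn_gt0.
have n0' : 0 < n%:R :> R by rewrite ltr0n.
apply: (integral_gt0 _ _ (pi / 2 / n%:R)) => //.
- exact: measurable_funX.
- by move=> x; exact: sqr_ge0.
- rewrite !divr_gt0 ?pi_gt0//= ltr_pdivrMr// (@lt_le_trans _ _ (pi * 1))//.
    by have := pi_gt0 R; lra.
  by rewrite ler_wpM2l ?pi_ge0// ler1n.
- exact: (cvgM (cs _) (cs _)).
- by rewrite mulrC divfK ?gt_eqF// sin_pihalf expr1n.
Qed.

End Observation.

(** * Extension of the coefficient to the whole line *)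

Section Coefficient.
Context {R : realType}.
Implicit Types (q dq f : R -> R) (L x y e d : R).

(* [q \o clamp L] continues [q] by constants, so that the equation is posed on the whole line. *)
Definition clamp L x : R := Num.max 0 (Num.min x L).

Lemma clamp_in L x : 0 < L -> 0 <= clamp L x <= L.
Proof. by move=> L0; rewrite /clamp le_max lexx ge_max (ltW L0) ge_min lexx orbT. Qed.

Lemma clamp_id L x : 0 <= x <= L -> clamp L x = x.
Proof. by move=> /andP[x0 xL]; rewrite /clamp (min_idPl xL) (max_idPr x0). Qed.

Lemma clamp_lipschitz L x y : 0 < L -> `|clamp L x - clamp L y| <= `|x - y|.
Proof.
move=> L0; have := ler_norm (x - y); have := ler_norm (y - x); rewrite distrC => h1 h2.
have m z : [\/ z <= 0 /\ clamp L z = 0, [/\ 0 <= z, z <= L & clamp L z = z] | L <= z /\ clamp L z = L].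
  rewrite /clamp; have [z0|z0] := leP z 0.
    by apply: Or31; rewrite (min_idPl (le_trans z0 (ltW L0))) (max_idPl z0).
  have [zL|zL] := leP z L; first by apply: Or32; rewrite (max_idPr (ltW z0)) ltW.
  by apply: Or33; rewrite (max_idPr (ltW L0)) ltW.
rewrite ler_norml; apply/andP.
by case: (m x) => [[? ->]|[? ? ->]|[? ->]]; case: (m y) => [[? ->]|[? ? ->]|[? ->]]; split; lra.
Qed.

Lemma C1_on_estimate L q dq x e : C1_on L q dq -> 0 <= x <= L -> 0 < e ->
  exists2 d, 0 < d & forall y, 0 <= y <= L -> `|y - x| < d ->
    `|q y - q x - dq x * (y - x)| <= e * `|y - x|.
Proof.
move=> [_ H] xL e0; have /cvgrPdist_le /(_ e e0) := H x xL.
rewrite /within /dnbhs /= => /nbhs_ballP[d /= d0 Hd]; exists d => // y yL yx.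
have [->|yx0] := eqVneq y x; first by rewrite !subrr mulr0 subr0 !normr0 mulr0.
have xyd : ball x d y by rewrite /ball /= distrC.
have := Hd y xyd yx0 yL; rewrite distrC => h.
have yx1 : y - x != 0 by rewrite subr_eq0.
by rewrite -[X in `|X - _|](@divfK _ (y - x))// -mulrBl normrM ler_wpM2r.
Qed.

Lemma within_estimate L f x e : {within `[0, L], continuous f} -> 0 <= x <= L -> 0 < e ->
  exists2 d, 0 < d & forall y, 0 <= y <= L -> `|y - x| < d -> `|f y - f x| <= e.
Proof.
move=> cf xL e0; have : f y @[y --> within `[0, L] (nbhs x)] --> f x.
  have xI : `[0, L]%classic x by rewrite /= in_itv.
  by rewrite (nbhs_subspace_in xI); exact: cf.
move=> /cvgrPdist_le /(_ e e0); rewrite /within /= => /nbhs_ballP[d /= d0 Hd].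
exists d => // y yL yx; rewrite distrC; apply: Hd => //.
by rewrite /ball /= distrC.
Qed.

Lemma clamp_comp_continuous L f : 0 < L ->
  (forall x e, 0 <= x <= L -> 0 < e ->
    exists2 d, 0 < d & forall y, 0 <= y <= L -> `|y - x| < d -> `|f y - f x| <= e) ->
  continuous (fun x => f (clamp L x)).
Proof.
move=> L0 H x; apply/cvgrPdist_le => e e0.
have [d d0 Hd] := H (clamp L x) e (clamp_in L x L0) e0.
apply: filterS (near_dist x d d0) => y xy.
rewrite distrC Hd ?clamp_in// (le_lt_trans (clamp_lipschitz _ _ _ L0))// distrC//.
Qed.

Lemma C1_on_continuous L q dq : 0 < L -> C1_on L q dq ->
  continuous (fun x => q (clamp L x)) /\ continuous (fun x => dq (clamp L x)).
Proof.
move=> L0 hq; split; apply: clamp_comp_continuous => // x e xL e0; last first.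
  by apply: within_estimate => //; case: hq.
have [d d0 Hd] := C1_on_estimate L q dq x 1 hq xL ltr01.
pose M := 1 + `|dq x|; have M0 : 0 < M by rewrite ltr_wpDr.
exists (Num.min d (e / M)); first by rewrite lt_min d0 divr_gt0.
move=> y yL; rewrite lt_min => /andP[yd ye].
have h := Hd y yL yd.
rewrite -[q y - q x](subrK (dq x * (y - x))) (le_trans (ler_normD _ _))//.
apply: (@le_trans _ _ (M * `|y - x|)).
  by rewrite mulrDl; apply: lerD => //; rewrite normrM.
by rewrite mulrC -ler_pdivlMr// ltW.
Qed.

Lemma C1_on_derive L q dq x : 0 < L -> C1_on L q dq -> 0 < x < L ->
  is_derive x 1 (fun y => q (clamp L y)) (dq x).
Proof.
move=> L0 hq /andP[x0 xL].
have xL' : 0 <= x <= L by rewrite !ltW.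
have key : h^-1 *: (((fun y => q (clamp L y)) \o shift x) (h *: 1) - q (clamp L x)) @[h --> 0^'] --> dq x.
  apply/cvgrPdist_le => e e0; have [d d0 Hd] := C1_on_estimate L q dq x e hq xL' e0.
  have e1 : 0 < Num.min d (Num.min x (L - x)) by rewrite !lt_min d0 x0 subr_gt0.
  rewrite /dnbhs /within /=; apply: filterS (near_dist 0 _ e1) => h; rewrite sub0r normrN !lt_min.
  move=> /and3P[hd hx hL] h0.
  have /andP[k1 k2] : - x < h < x by rewrite -ltr_norml.
  have /andP[k3 k4] : - (L - x) < h < L - x by rewrite -ltr_norml.
  have hxL : 0 <= h + x <= L by apply/andP; split; lra.
  have := Hd (h + x) hxL; rewrite addrK => /(_ hd) H.
  rewrite [h *: 1]mulr1 !clamp_id// distrC /=.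
  rewrite (_ : _ - dq x = h^-1 * (q (h + x) - q x - dq x * h)).
    by rewrite normrM normfV ler_pdivrMl ?normr_gt0// [leRHS]mulrC.
  by rewrite [h^-1 *: _]/(h^-1 * _) mulrBr mulrCA mulVf// mulr1.
apply: DeriveDef; first exact: cvgP key.
exact: cvg_lim key.
Qed.

End Coefficient.

(** * Eigenfunctions for large frequency and the exponents in the observability inequality *)

Section MinimalTime.
Context {R : realType}.
Variables (nu L : R) (q dq : R -> R) (a b : R).
Hypotheses (hnu : 0 < nu) (hL : 0 < L) (hq : C1_on L q dq) (hq0 : q 0 = 0)
  (hqpos : forall x, 0 < x -> x <= L -> 0 < q x) (ha : 0 < a) (hab : a < b) (hbL : b <= L).

Let p : R := 2 * nu + 1.
(** Despite its name not a derivative but the extension of [q] by constants; the derivative is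
    [dq]. *)
Let q' x := q (clamp L x).
Let d x := prim q' x.

Lemma coef_continuous : continuous q'. Proof. exact: (C1_on_continuous L q dq hL hq).1. Qed.

Lemma coef_ge0 x : 0 <= q' x.
Proof.
have /andP[] := clamp_in L x hL; rewrite /q' le_eqVlt => /orP[/eqP<-|h1 h2]; first by rewrite hq0.
by rewrite ltW// hqpos.
Qed.

Lemma coef_bound (f : R -> R) : continuous (fun x => f (clamp L x)) ->
  exists2 M, 0 <= M & forall x, `|f (clamp L x)| <= M.
Proof.
move=> cf; have [M M0 HM] := segment_bound _ 0 L (ltW hL) (fun x _ => cf x).
exists M => // x; have := HM (clamp L x) (clamp_in L x hL).
by rewrite clamp_id// clamp_in.
Qed.

Lemma prim_coef_le x y : x <= y -> d x <= d y.
Proof.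
have main (z w : R) : 0 <= z -> z <= w -> d z <= d w.
  move=> z0 zw; apply: (derive_mono (prim q') q') => //.
  - by apply: continuous_subspaceT; exact: (prim_continuous q' coef_continuous).
  - move=> t /andP[zt _]; apply: (prim_derive q' t coef_continuous); exact: le_lt_trans zt.
  - by move=> t _; exact: coef_ge0.
move=> xy; have [x0|x0] := lerP 0 x; first exact: main.
have [y0|y0] := lerP 0 y; last by rewrite /d !prim0// ltW.
by have := main 0 y (lexx 0) y0; rewrite /d [prim q' 0]prim0// [prim q' x]prim0// ltW.
Qed.

Lemma d_agmE : d_agm q a = d a.
Proof.
apply: eq_Rintegral => x; rewrite inE /= in_itv /= => /andP[x0 xa].
by rewrite /q' clamp_id// x0 (le_trans xa)// (le_trans (ltW hab)).
Qed.

(** The eigenvalue is of order at most [n], the potential of order [n ^+ 2]. For [kappa < 1] and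
    away from 0, where [q] has a positive lower bound, the gap [(1 - kappa ^+ 2) * n ^+ 2 * q ^+ 2]
    therefore absorbs both [lam] and the derivative of [kappa * n * q]. *)
Lemma agmon_eigenfunctions (kappa Q0 delta x0 : R) : 0 < kappa < 1 -> 0 < Q0 -> 0 < delta <= L ->
  (forall x, 0 <= x <= delta -> q x <= Q0 * x) -> 0 < x0 < L ->
  exists N, forall n, (N <= n)%N -> exists lam h,
    [/\ 0 <= lam <= n%:R * Q0 * (p + 1) + 2 * (p + 1) / delta ^+ 2,
      radial_solution p (fun x => n%:R ^+ 2 * q' x ^+ 2 - lam) h,
      forall x, 0 <= x <= L -> 0 <= h x, h L = 0 &
      forall x y, x0 <= x -> x <= y -> y <= L ->
        h y <= h x * expR (- (kappa * n%:R * (d y - d x)))].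
Proof.
move=> /andP[k0 k1] Q00 /andP[de0 deL] qQ0 /andP[x00 x0L].
have p0 : 0 < p by rewrite addr_gt0// mulr_gt0.
have cq := coef_continuous; have cdq := (C1_on_continuous L q dq hL hq).2.
have [M M0 HM] := coef_bound q cq; have [M1 M10 HM1] := coef_bound dq cdq.
have [m m0 Hm] : exists2 m, 0 < m & forall x, x0 <= x <= L -> m <= q' x.
  have [c cx Hc] := EVT_min (ltW x0L) (continuous_subspaceT cq).
  move: cx; rewrite in_itv /= => /andP[c1 c2].
  have cL : 0 <= c <= L by rewrite (le_trans (ltW x00)).
  exists (q' c); first by rewrite /q' clamp_id// hqpos// (lt_le_trans x00).
  by move=> x xx; apply: Hc; rewrite in_itv.
pose B := 2 * (p + 1) / delta ^+ 2.
have B0 : 0 <= B by rewrite /B; nneg.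
pose K := (1 - kappa ^+ 2) * m ^+ 2.
have K0 : 0 < K by rewrite mulr_gt0 ?exprn_gt0// subr_gt0 expr_lt1// ltW.
(* [N1] makes [n * K] exceed the coefficients of [lam] and of the derivative term; [N2] gives the
   hypothesis of [radial_solution_zero] for frequency [n * Q0] and radius [delta]. *)
pose N1 := Num.truncn ((Q0 * (p + 1) + B + M1) / K).
pose N2 := Num.truncn ((p + 1) / (2 * Q0 * delta ^+ 2)).
exists (maxn N1 N2).+1 => n Nn.
have n0 : 0 < n%:R :> R by rewrite ltr0n (leq_trans _ Nn).
have n1 : 1 <= n%:R :> R by rewrite ler1n (leq_trans _ Nn).
have nN1 : (Q0 * (p + 1) + B + M1) <= n%:R * K.
  rewrite -ler_pdivrMr// ltW// (lt_le_trans (truncnS_gt _))// ler_nat (leq_trans _ Nn)// ltnS leq_max leqnn//.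
have nN2 : (p + 1) / 2 <= n%:R * Q0 * delta ^+ 2.
  have : (p + 1) / (2 * Q0 * delta ^+ 2) <= n%:R.
    by rewrite ltW// (lt_le_trans (truncnS_gt _))// ler_nat (leq_trans _ Nn)// ltnS leq_max leqnn orbT.
  by rewrite ler_pdivrMr ?mulr_gt0 ?exprn_gt0// => h; lra.
pose W x := n%:R ^+ 2 * q' x ^+ 2.
have cW : continuous W by rewrite /W; cont.
have [||h zh|lam [h [/andP[l0 lL] rh h0 hL0]]] :=
  ground_state p W (n%:R ^+ 2 * M ^+ 2) L (n%:R * Q0 * (p + 1) + B) p0 hL _ cW.
- by nneg.
- move=> r; rewrite /W; apply/andP; split; first by nneg.
  rewrite ler_wpM2l ?sqr_ge0// lerXn2r ?nnegrE// ?coef_ge0//.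
  exact: le_trans (ler_norm _) (HM r).
- have HW x : 0 <= x <= delta -> W x <= (n%:R * Q0 * x) ^+ 2.
    move=> xd; have /andP[x0' xd'] := xd.
    rewrite /W -exprMn lerXn2r ?nnegrE ?mulr_ge0 ?coef_ge0// ?(ltW Q00)//.
    rewrite -mulrA ler_wpM2l// /q' clamp_id ?qQ0// x0'.
    exact: le_trans deL.
  have [x /andP[x0' xd] hx] :=
    radial_solution_zero p W h (n%:R * Q0) delta p0 (mulr_gt0 n0 Q00) de0 cW nN2 HW zh.
  by exists x => //; rewrite x0' (le_trans xd).
exists lam, h; split => //; first by rewrite l0.
move=> x y xx xy yL.
have cV : continuous (fun x => W x - lam) by cont.
have cQ : continuous (fun x => kappa * n%:R * q' x) by cont.
have dQ z : x0 < z < L -> is_derive z 1 (fun x => kappa * n%:R * q' x) (kappa * n%:R * dq z).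
  move=> /andP[z0 zL]; have dz : is_derive z 1 q' (dq z).
    by apply: (C1_on_derive L q dq z hL hq); rewrite (lt_trans x00).
  by derE; ring.
have HQ z : x0 < z < L -> 0 <= kappa * n%:R * q' z /\
    (kappa * n%:R * q' z) ^+ 2 - kappa * n%:R * dq z <= W z - lam.
  move=> /andP[z0 zL]; have q0 := coef_ge0 z; split; first by nneg.
  have mz : m ^+ 2 <= q' z ^+ 2.
    by rewrite lerXn2r ?nnegrE ?(ltW m0)// Hm// !ltW.
  have h1 : n%:R * (n%:R * K) <= n%:R * (n%:R * ((1 - kappa ^+ 2) * q' z ^+ 2)).
    do 2 (rewrite ler_wpM2l//); rewrite ler_wpM2l// subr_ge0 expr_le1// ltW//.
  have h2 : n%:R * (Q0 * (p + 1) + B + M1) <= n%:R * (n%:R * K) by rewrite ler_wpM2l.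
  have h3 : B <= n%:R * B by rewrite ler_peMl.
  have h4 : - (kappa * n%:R * dq z) <= n%:R * M1.
    have dM := HM1 z; rewrite clamp_id ?(ltW zL) ?andbT in dM; last by rewrite ltW// (lt_trans x00).
    rewrite -mulrN -mulrA mulrCA ler_wpM2l// (le_trans (ler_norm _))// normrM normrN gtr0_norm//.
    by rewrite (le_trans _ dM)// ler_piMl// ltW.
  have alg (k i w dz P b' M' Z l : R) : Z <= i * (i * ((1 - k ^+ 2) * w ^+ 2)) ->
      i * (P + b' + M') <= Z -> b' <= i * b' -> - (k * i * dz) <= i * M' -> l <= i * P + b' ->
      (k * i * w) ^+ 2 - k * i * dz <= i ^+ 2 * w ^+ 2 - l.
    by move=> g1 g2 g3 g4 g5; nra.
  by rewrite -mulrA in lL; exact: alg h1 h2 h3 h4 lL.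
have := radial_solution_decay p (fun x => W x - lam) h (fun x => kappa * n%:R * q' x)
  (fun x => kappa * n%:R * dq x) x0 L p0 cV rh x00 cQ dQ HQ h0 hL0 x y xx xy yL.
have pE z : prim (fun x => kappa * n%:R * q' x) z = kappa * n%:R * d z.
  by rewrite /prim RintegralZl//; exact: continuous_integrable.
by rewrite !pE -mulrBr.
Qed.

Lemma wav_derive (V h : R -> R) (x : R) : 0 < p -> continuous V -> radial_solution p V h -> 0 < x ->
  is_derive x 1 h (wav p (fun r => V r * h r) x) /\
  is_derive x 1 (wav p (fun r => V r * h r))
    (V x * h x - p / x * wav p (fun r => V r * h r) x).
Proof.
move=> p0 cV rh x0.
have wE y : 0 < y -> wav p (fun r => V r * h r) y = flux p V h y / y `^ p by move=> y0; rewrite /wav y0.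
have xp : x `^ p != 0 by rewrite gt_eqF// powR_gt0.
have x0' : x != 0 by rewrite gt_eqF.
split; first by rewrite wE//; exact: radial_solution_derive.
apply: (der_near _ (fun y => flux p V h y / y `^ p)).
  by apply: filterS (near_gt x 0 x0) => y; exact: wE.
have df := flux_derive p V h p0 cV rh x x0; have dp := powR_derive p x x0.
have dm := derM _ _ _ _ _ df (derV (fun y => y `^ p) _ _ xp dp).
refine (der_eq _ _ _ _ dm _); rewrite wE//.
have -> : x `^ p = x * x `^ (p - 1) by rewrite mulr_powRB1// ltW.
by field; rewrite x0'/= gt_eqF// powR_gt0.
Qed.

Lemma radial_solution_gt0 (V h : R -> R) : radial_solution p V h -> exists2 x, 0 < x < L & 0 < h x.
Proof.
move=> rh; have ch := radial_solution_continuous p V h rh.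
have := ch 0; rewrite /continuous_at (radial_solution0 p V h rh) => /cvgrPdist_lt /(_ 1 ltr01).
move=> /nbhs_ballP[e /= e0 He]; pose m := Num.min e L.
have m0 : 0 < m by rewrite lt_min e0.
have [me mL] : m <= e /\ m <= L by split; rewrite ge_min lexx ?orbT.
exists (m / 2); first by apply/andP; split; lra.
have mb : ball (0 : R) e (m / 2) by rewrite /ball /= sub0r normrN gtr0_norm; lra.
by have := He _ mb; rewrite /= ltr_norml => /andP[_ ?]; lra.
Qed.

(** The mass in the strip is compared with the mass over []x0, 2 * x0[], because the decay estimate
    starts only at [x0]; hence [d (2 * x0)], which tends to 0 with [x0]. *)
Lemma observable_exponent (T kappa Q0 delta x0 : R) : 0 < kappa < 1 -> 0 < Q0 -> 0 < delta <= L ->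
  (forall x, 0 <= x <= delta -> q x <= Q0 * x) -> 0 < x0 -> 2 * x0 <= a -> 0 < T ->
  observable nu L q (strip a b) T -> kappa * (d a - d (2 * x0)) <= Q0 * (p + 1) * T.
Proof.
move=> k01 Q00 de qQ0 x00 x0a T0 [C [C0 obs]].
have p0 : 0 < p by rewrite addr_gt0// mulr_gt0.
move: ha hab hbL => a0 ab bL.
have x0L : 0 < x0 < L by rewrite x00/=; lra.
have [N HN] := agmon_eigenfunctions kappa Q0 delta x0 k01 Q00 de qQ0 x0L.
have cq := coef_continuous.
pose r := nu + 1 / 2; have r0 : 0 < r by rewrite addr_gt0.
pose K := b `^ r / x0 `^ r.
have b0 : 0 < b by exact: lt_trans hab.
have K0 : 0 < K by rewrite divr_gt0 ?powR_gt0.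
pose Delta := d a - d (2 * x0).
pose B := 2 * (p + 1) / delta ^+ 2.
pose C' := C * T * (K ^+ 2 * (b - a) / x0).
have key n : (N < n)%N ->
    expR (- (2 * (n%:R * Q0 * (p + 1) + B) * T)) <= C' * expR (- (2 * (kappa * n%:R * Delta))).
  move=> Nn; have [lam [h [/andP[l0 lL] rh h0 hL0 dec]]] := HN n (ltnW Nn).
  pose V x := n%:R ^+ 2 * q' x ^+ 2 - lam.
  have cV : continuous V by rewrite /V; cont.
  have ch := radial_solution_continuous p V h rh.
  pose h1 := wav p (fun r => V r * h r).
  have ch1 : continuous h1 by apply: wav_continuous => //; exact: contM.
  pose g x := x `^ r * h x.
  pose u (z : R * R) := g z.1 * sin (n%:R * z.2).
  have cq2 : continuous (fun x => q' x ^+ 2) by cont.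
  have Qq x : 0 < x < L -> q' x ^+ 2 = q x ^+ 2.
    by move=> /andP[x1 x2]; rewrite /q' clamp_id// !ltW.
  have eig c : opG nu L q (fun z => c * u z) (fun z => lam * (c * u z)).
    have e1 : (fun z : R * R => c * u z) = (fun z => z.1 `^ (nu + 1 / 2) * (c * h z.1) * sin (n%:R * z.2)).
      by apply/funext => z; rewrite /u /g -/r; ring.
    rewrite (_ : (fun z : R * R => lam * (c * u z)) =
      (fun z => lam * (z.1 `^ (nu + 1 / 2) * (c * h z.1) * sin (n%:R * z.2)))); last first.
      by apply/funext => z; rewrite /u /g -/r; ring.
    rewrite e1.
    apply: (eigenfunction nu L lam n q (fun x => q' x ^+ 2) (fun x => c * h x) (fun x => c * h1 x)) => //.
    - by cont.
    - by cont.
    - by move=> x x1; have [d1 _] := wav_derive V h x p0 cV rh x1; derE; rewrite /h1; ring.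
    - by rewrite hL0 mulr0.
    - by move=> x x1; have [_ d2] := wav_derive V h x p0 cV rh x1; derE; rewrite /h1 /V /p; ring.
  have mO := measurable_Omega L; have mS := measurable_strip a b.
  have sub := strip_sub_Omega a b L (ltW ha) hbL.
  have mg : measurable_fun setT g by exact: measurable_radial.
  have Lu : L2 (Omega L) u.
    have [[+ _] _ _] := eig 1; rewrite (_ : (fun z => 1 * u z) = u)//.
    by apply/funext => z; rewrite mul1r.
  have LD : L2 (strip a b) u.
    have [m1 m2] := Lu; split; first exact: measurable_funS m1.
    apply: le_lt_trans m2; apply: ge0_subset_integral => //.
      by apply/measurable_EFinP; exact: measurable_funX.
    by move=> z _; rewrite lee_fin sqr_ge0.
  have := observability_exp L lam T C _ u mS LD Lu l0 T0 C0
    (obs _ _ Lu (is_solution_exp nu L lam q u Lu eig)).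
  pose E := expR (- (kappa * n%:R * Delta)).
  have E0 : 0 < E := expR_gt0 _.
  have rho0 : 0 < (K * E) ^+ 2 by rewrite exprn_gt0// mulr_gt0.
  have conc x y : x0 < x < 2 * x0 -> a < y < b -> g y ^+ 2 <= (K * E) ^+ 2 * g x ^+ 2.
    move=> /andP[x1 x2] /andP[y1 y2].
    have hx : 0 <= h x by apply: h0; apply/andP; split; lra.
    have hy : 0 <= h y by apply: h0; apply/andP; split; lra.
    have xr : 0 <= x `^ r by exact: powR_ge0.
    have gx0 : 0 <= g x by rewrite mulr_ge0.
    have gy0 : 0 <= g y by rewrite mulr_ge0 ?powR_ge0.
    have KE0 : 0 <= K * E := ltW (mulr_gt0 K0 E0).
    rewrite -exprMn; apply: lerXn2r; rewrite ?nnegrE//; first exact: (mulr_ge0 KE0 gx0).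
    have hyE : h y <= h x * E.
      apply: le_trans (dec x y (ltW x1) _ _) _; [lra|lra|].
      rewrite ler_wpM2l// ler_expR lerN2 ler_wpM2l//.
        by case/andP: k01 => k0 _; rewrite mulr_ge0// ltW.
      by apply: lerB; apply: prim_coef_le; exact: ltW.
    apply: (@le_trans _ _ (b `^ r * (h x * E))).
      apply: ler_pM; rewrite ?powR_ge0//.
      by apply: ge0_ler_powR; rewrite ?nnegrE ?(ltW r0)//; lra.
    rewrite (_ : K * E * _ = (b `^ r * (h x * E)) * (x `^ r / x0 `^ r)); last by rewrite /K /g; ring.
    rewrite ler_peMr ?mulr_ge0 ?powR_ge0 ?(ltW E0)// ler_pdivlMr ?powR_gt0// mul1r.
    by apply: ge0_ler_powR; rewrite ?nnegrE ?(ltW r0)//; lra.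
  have x0L2 : 2 * x0 <= L by lra.
  have := normsq_concentration L a b x0 _ n g mg x00 x0L2 hab rho0 conc.
  have [x1 x1L hx1] := radial_solution_gt0 V h rh.
  have cg : {for x1, continuous g}.
    have /andP[x10 _] := x1L; apply: cvgM; [exact: powR_continuous|exact: ch].
  have gx1 : 0 < g x1 by have /andP[x10 _] := x1L; rewrite mulr_gt0// powR_gt0.
  have := normsq_gt0 L x1 n g mg (leq_ltn_trans (leq0n N) Nn) x1L cg gx1.
  rewrite -/u (normsqE _ mO u Lu) (normsqE _ mS u LD) -!EFinM !lee_fin lte_fin.
  set NO := \int[_]_(_ in _) _; set NS := \int[_]_(_ in _) _ => NO0 hS hO.
  have : expR (- (2 * lam * T)) * NO <= C * T * ((K * E) ^+ 2 * (b - a) / x0) * NO.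
    apply: le_trans hO _; rewrite -[leRHS]mulrA ler_wpM2l// mulr_ge0// ltW//.
  rewrite ler_pM2r// => h3.
  apply: le_trans (le_trans h3 _).
    rewrite ler_expR lerN2 ler_wpM2r ?(ltW T0)// ler_wpM2l//.
  rewrite [X in _ <= _ * X](_ : _ = E ^+ 2); last by rewrite /E -expRM_natl; congr expR; ring.
  by rewrite /C' le_eqVlt; apply/orP; left; apply/eqP; ring.
rewrite leNgt; apply/negP => lt; rewrite -/Delta in lt.
(* If the claim failed, [X] would be positive, while [key] and [1 + y <= expR y] bound [n * X]
   independently of [n]. *)
pose X := 2 * (kappa * Delta - Q0 * (p + 1) * T).
have X0 : 0 < X by rewrite mulr_gt0// subr_gt0.
have bound n : (N < n)%N -> n%:R * X <= C' + 2 * B * T.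
  move=> /key; rewrite -ler_pdivrMr ?expR_gt0// -expRN -expRD => h.
  have := le_trans (expR_ge1Dx _) h.
  have alg (i A P e c D : R) : 1 + (- (2 * (i * P + e) * T) - - (2 * (kappa * i * D))) <= c ->
      i * (2 * (kappa * D - P * T)) <= c + 2 * e * T by move=> g1; nra.
  by rewrite -[n%:R * Q0 * _]mulrA; exact: alg.
pose M := Num.truncn ((C' + 2 * B * T) / X).
have := bound (maxn M N).+1 (leq_maxr _ _).
rewrite leNgt => /negP; apply.
rewrite -ltr_pdivrMr// (lt_le_trans (truncnS_gt _))// ler_nat ltnS leq_maxl//.
Qed.

End MinimalTime.

Theorem theorem1p4 (R : realType) (nu L : R) (q dq : R -> R) (a b : R)
    (hnu : 0 < nu) (hL : 0 < L)
    (hq : C1_on L q dq) (hq0 : q 0 = 0) (hdq0 : 0 < dq 0)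
    (hqpos : forall x, 0 < x -> x <= L -> 0 < q x)
    (ha : 0 < a) (hab : a < b) (hbL : b <= L) :
  ((d_agm q a / (2 * dq 0 * (1 + nu)))%:E
     <= minimal_time nu L q (strip a b))%E.
Proof.
apply: le_ereal_inf_tmp => _ [T [T0 obs] <-]; rewrite lee_fin leNgt; apply/negP => ltT.
set D := d_agm q a in ltT.
(* [P] is [2 (1 + nu) T], so that the assumed failure of the bound reads [dq 0 * P < D]. All
   parameters are then chosen strictly inside this gap. *)
pose P := (2 * nu + 1 + 1) * T; have P0 : 0 < P by rewrite mulr_gt0//; lra.
have DP : dq 0 * P < D.
  by move: ltT; rewrite ltr_pdivlMr ?mulr_gt0//; [move=> h; rewrite /P; lra|lra].
(* The midpoint of [dq 0] and [D / P]: a slope above [q] near 0 for which [m = Q0 * P] is still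
   below [D]. *)
pose Q0 := (D / P + dq 0) / 2.
have Q0P : Q0 * P = (D + dq 0 * P) / 2 by rewrite /Q0; field; rewrite gt_eqF.
have Q0dq : dq 0 < Q0 by rewrite -(ltr_pM2r P0) Q0P; lra.
have Q00 : 0 < Q0 by exact: lt_trans Q0dq.
pose m := Q0 * P; have m0 : 0 < m by rewrite mulr_gt0.
have mD : m < D by rewrite /m Q0P; lra.
have zL : 0 <= (0 : R) <= L by rewrite lexx ltW.
have e0 : 0 < Q0 - dq 0 by rewrite subr_gt0.
have [d d0 Hd] := C1_on_estimate L q dq 0 _ hq zL e0.
pose delta := Num.min (d / 2) L.
have de0 : 0 < delta by rewrite lt_min hL divr_gt0.
have [ded deL] : delta <= d / 2 /\ delta <= L by split; rewrite ge_min lexx ?orbT.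
have qQ0 x : 0 <= x <= delta -> q x <= Q0 * x.
  move=> /andP[x0 xd].
  have xL : 0 <= x <= L by rewrite x0 (le_trans xd).
  have := Hd x xL; rewrite subr0 hq0 subr0 ger0_norm// => /(_ _)/ler_normlP[].
    by lra.
  by move=> _ h; lra.
have cq := coef_continuous L q dq hL hq.
have cd := prim_continuous _ cq.
pose g := prim (fun x => q (clamp L x)).
have e1 : 0 < (D - m) / 2 by lra.
have := cd 0; rewrite /continuous_at prim0// => /cvgrPdist_lt /(_ _ e1) /nbhs_ballP[d2 /= d20 Hd2].
(* Then [2 * x0] is half of the minimum: strictly inside the ball of radius [d2], and at most
   [a]. *)
pose x0 := Num.min d2 a / 4.
have m1 : 0 < Num.min d2 a by rewrite lt_min d20.
have [md ma] : Num.min d2 a <= d2 /\ Num.min d2 a <= a by split; rewrite ge_min lexx ?orbT.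
have x00 : 0 < x0 by rewrite divr_gt0.
have x0a : 2 * x0 <= a by rewrite /x0; lra.
have hx0 : g (2 * x0) < (D - m) / 2.
  have b0 : ball (0 : R) d2 (2 * x0).
    by rewrite /ball /= sub0r normrN gtr0_norm; rewrite /x0; lra.
  by have := Hd2 _ b0; rewrite /= sub0r normrN; exact: le_lt_trans (ler_norm _).
(* Since [g (2 * x0)] is less than [(D - m) / 2], the distance [D - g (2 * x0)] exceeds
   [(D + m) / 2]. This [kappa] is below 1 and maps [(D + m) / 2] to [m], which contradicts the
   inequality between the exponents. *)
pose kappa := m / ((D + m) / 2).
have m2 : 0 < (D + m) / 2 by lra.
have k01 : 0 < kappa < 1 by rewrite divr_gt0// ltr_pdivrMr// mul1r; lra.
have := observable_exponent nu L q dq a b hnu hL hq hq0 hqpos ha hab hbL T kappa Q0 delta x0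
  k01 Q00 _ qQ0 x00 x0a T0 obs.
rewrite de0 deL -mulrA -/P -/m -/g => /(_ isT).
have -> : g a = D := esym (d_agmE L q a b hab hbL).
rewrite leNgt => /negP; apply.
have -> : m = kappa * ((D + m) / 2) by rewrite /kappa divfK// gt_eqF.
by case/andP: k01 => k0 _; rewrite ltr_pM2l//; lra.
Qed.
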